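(* Let $X_1,X_2,\ldots$ be i.i.d. with PMF $p(x)$ on a finite set $\mathcal{X}$, let $d\colon\mathcal{X}\times\hat{\mathcal{X}}\to[0,\infty]$ be a distortion function whose distortion-rate function $D(\cdot)$ is bounded on $[0,\infty)$, and let $p(v,z|u)$ be a discrete memoryless wiretap channel whose capacity $C=\max_{p(u)}I(U;V)$ and secrecy capacity $C_{\mathrm{WT}}=\max_{p(w,u)}\left[I(W;V)-I(W;Z)\right]$ are finite. For a given cumulative rate distribution function (CRDF) $G$ and cumulative leakage function (CLF) $L$, define $G^{\mathrm{eff}}_{\mathrm{out}}\colon[0,1]\to[0,\infty)$ by $$G^{\mathrm{eff}}_{\mathrm{out}}(\alpha):=\max\Big\{C_{\mathrm{WT}}\,G(\alpha),\; C\,G(\alpha)-\sup_{\beta\in[0,1]}\big((C-C_{\mathrm{WT}})G(\beta)-L(\beta)\big)\Big\}.$$ If the CRDF $G$ is achievable, given the CLF $L$, with distortion level $\bar d$, then $$\int_0^1 D\left(\frac{\mathrm{d}\hat G^{\mathrm{eff}}_{\mathrm{out}}}{\mathrm{d}\alpha}(\alpha)\right)\mathrm{d}\alpha\le\bar d,$$ where $\hat G^{\mathrm{eff}}_{\mathrm{out}}\colon[0,1]\to[0,\infty)$ is the concave envelope of $G^{\mathrm{eff}}_{\mathrm{out}}$.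
   Context: Logarithms are in base 2. $x_m^n$ denotes $(x_m,\ldots,x_n)$ and $x^n=x_1^n$. **Regular cumulative function.** $F\colon[0,1]\to[0,\infty)$ is a regular cumulative function if it is non-decreasing, $F(0)=0$, and $F$ is right-continuous on $[0,1)$. A *CRDF* (cumulative rate distribution function) $G$ and a *CLF* (cumulative leakage function) $L$ are both regular cumulative functions; $G$ describes the cumulative rate allowed for encoding, $L$ the cumulative leakage allowed. **Channel.** $p(v,z|u)$ is a discrete memoryless wiretap channel with input $u\in\mathcal{U}$, output $v\in\mathcal{V}$ at the decoder and output $z\in\mathcal{Z}$ at the eavesdropper; it is used without feedback, i.e. given the inputs, the output pairs $(V_t,Z_t)$ are conditionally independent, each drawn from $p(v,z|u_t)$, and also independent of the source given the inputs. In the definition of $C_{\mathrm{WT}}$, $W$ is an auxiliary random variable with $W\to U\to(V,Z)$ a Markov chain. **$(G,k,n)$-source-channel code** ($k,n\in\mathbb{N}$, $G$ a CRDF). Put $r_i=G(i/k)-G((i-1)/k)$ for $i=1,\ldots,k$, $m_0=0$, $m_i=\lfloor nkr_i\rfloor+m_{i-1}$. The code consists of - $k$ sequential encoders $\varphi_i\colon\mathcal{X}^{in}\to\mathcal{U}^{m_i-m_{i-1}}$, $x^{in}\mapsto u_{m_{i-1}+1}^{m_i}$, $i=1,\ldots,k$ (encoder $i$ sees only the first $i$ source sub-blocks of length $n$); - a decoder $\psi\colon\mathcal{V}^{m_k}\to\hat{\mathcal{X}}^{nk}$, $v^{m_k}\mapsto\hat x^{nk}$, where $\hat{\mathcal{X}}$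 is the reconstruction alphabet. The sequence $U^{m_k}$ is sent through the channel, producing $V^{m_k}$ (decoder) and $Z^{m_k}$ (eavesdropper), and $\hat X^{nk}=\psi(V^{m_k})$. **Achievability.** A CRDF $G$ is achievable, given CLF $L$, with distortion level $\bar d$, if for every $k\in\mathbb{N}$ there is a sequence of $(G,k,n)$-source-channel codes, $n\in\mathbb{N}$, such that $$\limsup_{n\to\infty}\mathbb{E}\big[d(X^{nk},\hat X^{nk})\big]\le\bar d,\qquad \frac1{nk}I(X^{in};Z^{m_i})\le L(i/k)\quad\text{for all } i\in\{1,\ldots,k\},$$ where $d(X^{nk},\hat X^{nk}):=\frac1{nk}\sum_{i=1}^{nk}d(X_i,\hat X_i)$. **Distortion-rate function.** The rate-distortion function of $X\sim p(x)$ is $R(D)=\min I(X;\hat X)$ over conditional PMFs $p(\hat x|x)$ with $\mathbb{E}[d(X,\hat X)]\le D$; the distortion-rate function is its inverse, $D(R)=\min\{D: R(D)\le R\}$, $R\ge0$. It is assumed that $D(R)$ is finite for all $R\ge0$. **Concave envelope.** $\hat f$ is the concave envelope of $f\colon[0,1]\to\mathbb{R}$ if $\hat f$ is concave, $\hat f\ge f$, and $\hat f\le g$ for every concave $g\ge f$ on $[0,1]$. (Its derivative exists for almost every $\alpha$.) *)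

(* Defs.v *)
From HB Require Import structures.
From mathcomp Require Export all_boot all_order all_algebra.
From mathcomp Require Export all_classical all_reals all_analysis.
Export Order.TTheory GRing.Theory Num.Theory.
Export numFieldNormedType.Exports.

Set Implicit Arguments.
Unset Strict Implicit.
Unset Printing Implicit Defensive.

Local Open Scope classical_set_scope.
Local Open Scope ring_scope.

(* Discrete random variables are functions on a sample space T equipped with a
   PMF p : T -> R.  T need not be finite, so sums over T are [esum]s. *)
Section DiscreteProbability.
Context {R : realType}.

Definition is_pmf (T : choiceType) (p : T -> R) : Prop :=
  (forall t, 0 <= p t) /\ (\esum_(t in [set: T]) (p t)%:E = 1)%E.

Definition law (T A : choiceType) (p : T -> R) (f : T -> A) (a : A) : R :=
  fine (\esum_(t in f @^-1` [set a]) (p t)%:E).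

Definition expectation_pmf (T : choiceType) (p : T -> R) (f : T -> \bar R)
  : \bar R := (\esum_(t in [set: T]) ((p t)%:E * f t))%E.

Definition log2 (x : R) : R := ln x / ln 2.

Definition minfo_term (T A B : choiceType) (p : T -> R) (f : T -> A)
    (g : T -> B) (ab : A * B) : R :=
  let q := law p (fun t => (f t, g t)) ab in
  q * log2 (q / (law p f ab.1 * law p g ab.2)).

(* I(f; g) in bits; possibly +oo on infinite alphabets.  [esum] is only
   meaningful for nonnegative families, hence the split into positive and
   negative parts; the latter is always summable.  Since ln 0 = 0, points of
   zero mass contribute 0. *)
Definition mutual_info (T A B : choiceType) (p : T -> R) (f : T -> A)
    (g : T -> B) : \bar R :=
  (\esum_(ab in [set: A * B]) ((minfo_term p f g)^\+ ab)%:E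
   - \esum_(ab in [set: A * B]) ((minfo_term p f g)^\- ab)%:E)%E.

End DiscreteProbability.

Section RateDistortion.
Context {R : realType} (X : finType) (Xhat : choiceType).
Variables (p : X -> R) (d : X -> Xhat -> \bar R).

Definition test_channel_law (q : X -> Xhat -> R) (w : X * Xhat) : R :=
  p w.1 * q w.1 w.2.

(* Infima instead of minima, which need not be attained when Xhat is infinite;
   they agree whenever the minima exist. *)
Definition rate_distortion (D : R) : \bar R :=
  ereal_inf [set I | exists q : X -> Xhat -> R,
    [/\ forall x, is_pmf (q x),
        (expectation_pmf (test_channel_law q) (fun w => d w.1 w.2) <= D%:E)%E
      & I = mutual_info (test_channel_law q) fst snd]].

Definition distortion_rate (r : R) : \bar R :=
  ereal_inf [set D%:E | D in [set D : R | (rate_distortion D <= r%:E)%E]].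

End RateDistortion.

(* A wiretap channel p(v,z|u) is a family of PMFs [ch u] on V * Z.  As for
   rate-distortion, suprema are used in place of maxima. *)
Section WiretapChannel.
Context {R : realType} {U V Z : countType}.
Variable ch : U -> V * Z -> R.

Definition capacity : \bar R :=
  ereal_sup [set I | exists2 pu : U -> R, is_pmf pu
    & I = mutual_info (fun w : U * (V * Z) => pu w.1 * ch w.1 w.2)
            (fun w => w.1) (fun w => w.2.1)].

Definition aux_law (W : countType) (pwu : W * U -> R)
    (w : (W * U) * (V * Z)) : R :=
  pwu w.1 * ch w.1.2 w.2.

(* If capacity is finite then so is I(W;V), and the difference below is not
   of the form +oo - +oo. *)
Definition secrecy_capacity : \bar R :=
  ereal_sup [set I | exists (W : countType) (pwu : W * U -> R), is_pmf pwu
    /\ I = (mutual_info (aux_law pwu) (fun w => w.1.1) (fun w => w.2.1)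
            - mutual_info (aux_law pwu) (fun w => w.1.1) (fun w => w.2.2))%E].

End WiretapChannel.

Section Cumulative.
Context {R : realType}.

(* Functions on [0,1] are represented by functions on R whose values outside
   [0,1] are irrelevant. *)
Definition regular_cumulative (F : R -> R) : Prop :=
  [/\ forall a, a \in `[0, 1] -> 0 <= F a,
      {in `[0, 1] &, {homo F : a b / a <= b}},
      F 0 = 0
    & forall a, a \in `[0, 1[ -> F x @[x --> a^'+] --> F a].

Definition concave_on01 (f : R -> R) : Prop :=
  convex_function (`[0, 1] : set R^o) (fun a => - f a : R^o).

Definition concave_envelope (f fhat : R -> R) : Prop :=
  [/\ concave_on01 fhat,
      forall a, a \in `[0, 1] -> f a <= fhat a
    & forall g : R -> R, concave_on01 g ->
        (forall a, a \in `[0, 1] -> f a <= g a) ->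
        forall a, a \in `[0, 1] -> fhat a <= g a].

Definition Geff_out (C CWT : R) (G L : R -> R) (a : R) : R :=
  Num.max (CWT * G a)
    (C * G a - sup [set (C - CWT) * G b - L b | b in `[0, 1]]).

End Cumulative.

Section Code.
Context {R : realType}.
Variables (X : finType) (U V Z : countType) (Xhat : choiceType).
Variables (G : R -> R) (k n : nat).

(* r_i, for 1 <= i <= k *)
Definition rate (i : nat) : R := G (i%:R / k%:R) - G (i.-1%:R / k%:R).

(* m_i - m_(i-1), for 1 <= i <= k; [truncn] is the floor on nonnegative reals *)
Definition block_len (i : nat) : nat := Num.truncn ((n * k)%:R * rate i).

(* m_i *)
Definition cum_len (i : nat) : nat := (\sum_(j < i) block_len j.+1)%N.

(* The index i : 'I_k is 0-based: [encoder i] is phi_(i+1). *)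
Record code := Code {
  encoder : forall i : 'I_k, (i.+1 * n).-tuple X -> (block_len i.+1).-tuple U;
  decoder : (cum_len k).-tuple V -> (k * n).-tuple Xhat
}.

Lemma prefix_le (i : 'I_k) : (i.+1 * n <= k * n)%N.
Proof. by rewrite leq_mul2r ltn_ord orbT. Qed.

Definition source_prefix (x : (k * n).-tuple X) (i : 'I_k)
  : (i.+1 * n).-tuple X :=
  [tuple tnth x (widen_ord (prefix_le i) j) | j < i.+1 * n].

Definition channel_input_seq (c : code) (x : (k * n).-tuple X) : seq U :=
  flatten [seq tval (encoder c (source_prefix x i)) | i <- enum 'I_k].

Lemma size_channel_input_seq (c : code) (x : (k * n).-tuple X) :
  size (channel_input_seq c x) == cum_len k.
Proof.
rewrite size_flatten /shape -map_comp sumnE big_map big_enum /=.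
by apply/eqP/eq_bigr => i _; rewrite size_tuple.
Qed.

(* u^(m_k) *)
Definition channel_input (c : code) (x : (k * n).-tuple X)
  : (cum_len k).-tuple U := Tuple (size_channel_input_seq c x).

(* Joint PMF of (X^(nk), (V^(m_k), Z^(m_k))): i.i.d. source, memoryless channel
   without feedback. *)
Definition system_law (p : X -> R) (ch : U -> V * Z -> R) (c : code)
    (w : (k * n).-tuple X * ((cum_len k).-tuple V * (cum_len k).-tuple Z))
  : R :=
  (\prod_(j < k * n) p (tnth w.1 j)) *
  (\prod_(t < cum_len k) ch (tnth (channel_input c w.1) t)
                            (tnth w.2.1 t, tnth w.2.2 t)).

Definition avg_distortion (d : X -> Xhat -> \bar R) (x : (k * n).-tuple X)
    (xhat : (k * n).-tuple Xhat) : \bar R :=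
  (((n * k)%:R^-1)%:E * \sum_(j < k * n) d (tnth x j) (tnth xhat j))%E.

Definition expected_distortion (p : X -> R) (ch : U -> V * Z -> R)
    (d : X -> Xhat -> \bar R) (c : code) : \bar R :=
  expectation_pmf (system_law p ch c)
    (fun w => avg_distortion d w.1 (decoder c w.2.1)).

(* (1 / nk) I(X^(in); Z^(m_i)) *)
Definition leakage_rate (p : X -> R) (ch : U -> V * Z -> R) (c : code)
    (i : nat) : \bar R :=
  (((n * k)%:R^-1)%:E *
   mutual_info (system_law p ch c)
     (fun w => take (i * n) w.1) (fun w => take (cum_len i) w.2.2))%E.

End Code.

(* Block lengths range over positive integers, hence the [n.+1]. *)
Definition achievable {R : realType} (X : finType) (U V Z : countType)
    (Xhat : choiceType) (p : X -> R) (d : X -> Xhat -> \bar R)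
    (ch : U -> V * Z -> R) (G L : R -> R) (dbar : R) : Prop :=
  forall k : nat, (0 < k)%N ->
    exists c : forall n : nat, code X U V Xhat G k n.+1,
      (limn_esup (fun n => expected_distortion p ch d (c n)) <= dbar%:E)%E
      /\ forall n i : nat, (0 < i <= k)%N ->
           (leakage_rate p ch (c n) i <= (L (i%:R / k%:R))%:E)%E.

(* Main.v *)
(* For a letter [l] of the source put
   [rho_l = H(X) - H(X_l | X^(l-1), V^m) >= I(X_l; Xhat_l)], so that the expected
   distortion is at least the average of [D(rho_l)].  By the chain rule the sum
   of [rho_l] over the letters after block [i] is [I(X_tail; V^m | X^(in))].  The
   channel uses up to [m_i] do not depend on the tail, so this is at most
   [C (m_k - m_i)]; exchanging the outputs [V_t] for [Z_t] one at a time up to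
   [m_j], at the cost of [C_WT] per use, bounds it also by
   [C (m_k - m_j) + C_WT (m_j - m_i)] plus the leakage after block [j].  With [j / k]
   close to a point where the supremum in [G_eff_out] is almost reached, the two
   bounds say that the sums of [rho_l] over tails are, up to a small error, below
   the increments of [G_eff_out] up to 1.
   For a hinge [(s - x)^+], these inequalities place [G_eff_out], hence also its
   concave envelope, below a line of slope [s] whose height is given by the average
   of [(s - rho_l)^+]; as the slopes of the envelope decrease, their hinges are
   positive on a final segment only, and their sum there telescopes to the gap
   between the line and the envelope.  A convex nonincreasing [D] is, up to small
   shifts, a positive combination of hinges; the shift is harmless near 0 because
   [D] is continuous there, by a Pinsker-type estimate. *)
From mathcomp Require Import ring lra measurable_realfun.
Require Import Defs.
Local Open Scope classical_set_scope.
Local Open Scope ring_scope.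

Set Implicit Arguments.
Unset Strict Implicit.
Unset Printing Implicit Defensive.

Import HBNNSimple.

(** The alphabets [V] and [Z] may be infinite, and output entropies with them; so each information
    is written as a difference of entropies of the finite source, unconditional and conditional, and
    outputs serve only as summation indices. [D] is an infimum over infima: couplings come with a
    slack in cost or rate. The parameters are chosen in the order [eps], [tau], the hinges, then
    [delta], [K], [k]; the final inequality holds for each block length, hence for the limit
    superior. The number of hinges depends on [tau], so the loss due to the shifts, proportional to
    [tau] times the total weight of the hinges, is not small by itself: that product is at most
    [D 0 - D tau], and this is where continuity at 0 enters. The integrand is never shown
    measurable. As [D] is nonincreasing and the envelope concave, [D] of the derivative on a cell of
    length [1 / K] is at most [D] of the mean slope on the next cell, outside a countable set; on
    the last cell only the bound on [D] is left, which costs at most [M / K]. *)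

Section EsumType.
Context {R : realType}.
Implicit Types T S : choiceType.

Lemma esum_pair T S (f : T * S -> \bar R) : (forall w, (0 <= f w)%E) ->
  (\esum_(w in [set: T * S]) f w =
   \esum_(t in [set: T]) \esum_(s in [set: S]) f (t, s))%E.
Proof.
move=> f0; rewrite (@esum_esum _ _ _ setT (fun=> setT) (fun t s => f (t, s)))//.
rewrite (_ : [set: T] `*`` _ = setT); last by apply/seteqP; split.
by apply: eq_esum => -[].
Qed.

Lemma esum_swap T S (f : T -> S -> \bar R) : (forall t s, (0 <= f t s)%E) ->
  (\esum_(t in [set: T]) \esum_(s in [set: S]) f t s =
   \esum_(s in [set: S]) \esum_(t in [set: T]) f t s)%E.
Proof.
move=> f0; rewrite -(esum_pair (f := fun w => f w.1 w.2))//.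
rewrite -(esum_pair (f := fun w => f w.2 w.1))//.
rewrite (reindex_esum [set: S * T] setT (fun w => (w.2, w.1)))//.
split=> //= [[a b] [c d] _ _ [-> ->]//|[a b] _].
by exists (b, a).
Qed.

Lemma esumZl T (D : set T) (c : R) (f : T -> \bar R) : 0 <= c ->
  (forall t, (0 <= f t)%E) ->
  (\esum_(t in D) (c%:E * f t) = c%:E * \esum_(t in D) f t)%E.
Proof.
move=> + f0; rewrite le_eqVlt => /predU1P[<-|c0].
  by rewrite mul0e esum1// => i _; rewrite mul0e.
(* [H] comes from finite subsums; applied also to the scaled family with factor [c^-1], it gives the
   reverse inequality. *)
suff H (k : R) g : 0 < k -> (forall t, (0 <= g t)%E) ->
    (\esum_(t in D) (k%:E * g t) <= k%:E * \esum_(t in D) g t)%E.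
  apply/eqP; rewrite eq_le H//=.
  rewrite -lee_pdivlMl//; apply: le_trans (H _ _ _ _); last 2 first.
  - by rewrite invr_gt0.
  - by move=> t; rewrite mule_ge0// lee_fin ltW.
  apply/le_esum => t _.
  by rewrite muleA -EFinM mulVf ?mul1e// gt_eqF.
move=> k0 g0; apply: ge_ereal_sup => _ [X [finX XD] <-].
rewrite fsbig_finite//= -ge0_sume_distrr//.
apply: lee_wpmul2l; first by rewrite lee_fin ltW.
by apply: ereal_sup_ubound; exists X => //; rewrite fsbig_finite.
Qed.

Lemma esumZr T (D : set T) (c : R) (f : T -> \bar R) : 0 <= c ->
  (forall t, (0 <= f t)%E) ->
  (\esum_(t in D) (f t * c%:E) = (\esum_(t in D) f t) * c%:E)%E.
Proof.
move=> c0 f0; rewrite muleC -esumZl//.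
by apply: eq_esum => t _; rewrite muleC.
Qed.

Lemma esum_fin (T : finType) (f : T -> \bar R) : (forall t, (0 <= f t)%E) ->
  (\esum_(t in [set: T]) f t = \sum_t f t)%E.
Proof.
move=> f0; rewrite (esum_fset finite_finset (fun i _ => f0 i)).
rewrite (_ : setT = [set` enum T]).
  by rewrite -fsbig_seq ?enum_uniq// big_enum.
by apply/seteqP; split=> // t _ /=; rewrite mem_enum.
Qed.

Lemma esum_fiber T S (g : T -> S) (f : T -> \bar R) :
  (forall t, (0 <= f t)%E) ->
  (\esum_(s in [set: S]) \esum_(t in g @^-1` [set s]) f t =
   \esum_(t in [set: T]) f t)%E.
Proof.
move=> f0; rewrite (@esum_esum _ _ _ setT (fun s => g @^-1` [set s]) (fun _ t => f t))//.
rewrite (reindex_esum setT (setT `*`` (fun s => g @^-1` [set s])) (fun t => (g t, t)))//.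
by split=> //= [t u _ _ []//|[s t] /= [_ <-]]; exists t.
Qed.

Lemma esum_fiber_setI T S (g : T -> S) (D : set T) (f : T -> \bar R) :
  (forall t, (0 <= f t)%E) ->
  (\esum_(s in [set: S]) \esum_(t in D `&` g @^-1` [set s]) f t =
   \esum_(t in D) f t)%E.
Proof.
move=> f0; rewrite [RHS]esum_mkcond -(esum_fiber g) //=.
  by apply: eq_esum => s _; rewrite esum_mkcondl.
by move=> t; case: ifP.
Qed.

Lemma esum_only T (f : T -> \bar R) (t0 : T) :
  (forall t, (0 <= f t)%E) -> (forall t, t != t0 -> f t = 0%E) ->
  (\esum_(t in [set: T]) f t = f t0)%E.
Proof.
move=> f0 h; rewrite -(@esum_set1 _ _ t0 f)// [RHS]esum_mkcond.
apply: eq_esum => t _; case: ifP => //; rewrite in_set1 => /negbT.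
exact: h.
Qed.

Lemma esum_term_le T (f : T -> \bar R) (t0 : T) :
  (forall t, (0 <= f t)%E) -> (f t0 <= \esum_(t in [set: T]) f t)%E.
Proof.
move=> f0; rewrite -(@esum_set1 _ _ t0 f)// [leLHS]esum_mkcond.
by apply: le_esum => t _; case: ifP.
Qed.

Lemma esum_fin_num T (D : set T) (f : T -> \bar R) (M : R) :
  (forall t, (0 <= f t)%E) -> (\esum_(t in D) f t <= M%:E)%E ->
  \esum_(t in D) f t \is a fin_num.
Proof.
move=> f0 fM; rewrite ge0_fin_numE ?esum_ge0//.
by rewrite (le_lt_trans fM)// ltry.
Qed.

End EsumType.

(** * Entropy of unnormalised mass functions *)

Notation nneg a := (forall t, 0 <= a t) (only parsing).

Section Log2.
Context {R : realType}.
Implicit Types x y : R.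

Lemma ln2_gt0 : 0 < ln 2 :> R.
Proof. by rewrite ln_gt0// ltr1n. Qed.

Lemma log2_1 : log2 1 = 0 :> R.
Proof. by rewrite /log2 ln1 mul0r. Qed.

Lemma log2_le x : 0 < x -> log2 x <= (x - 1) / ln 2.
Proof.
move=> x0; rewrite /log2 ler_pM2r ?invr_gt0 ?ln2_gt0//.
have := @le_ln1Dx R (x - 1); have -> : 1 + (x - 1) = x by ring.
by apply; lra.
Qed.

Lemma log2M x y : 0 < x -> 0 < y -> log2 (x * y) = log2 x + log2 y.
Proof. by move=> x0 y0; rewrite /log2 lnM ?posrE// mulrDl. Qed.

Lemma log2V x : 0 < x -> log2 x^-1 = - log2 x.
Proof. by move=> x0; rewrite /log2 lnV ?posrE// mulNr. Qed.

Lemma log2_div x y : 0 < x -> 0 < y -> log2 (x / y) = log2 x - log2 y.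
Proof. by move=> x0 y0; rewrite log2M ?invr_gt0// log2V. Qed.

Lemma log2_ge0 x : 1 <= x -> 0 <= log2 x.
Proof. by move=> x1; rewrite divr_ge0 ?ln_ge0// ler1n. Qed.

Lemma log2_le0 x : x <= 1 -> log2 x <= 0.
Proof. by move=> x1; rewrite pmulr_lle0 ?ln_le0// invr_gt0 ln2_gt0. Qed.

End Log2.

Section Entropy.
Context {R : realType}.

(* Entropy of an unnormalised mass function: for [a] of total mass [s],
   [entropy a] is [s] times the entropy of [a / s].  Being homogeneous, it
   turns conditional entropies into plain sums [\sum_y entropy (a_y)]. *)
Definition entropy (W : finType) (a : W -> R) : R :=
  \sum_w a w * log2 ((\sum_w' a w') / a w).

Definition push (W E : finType) (F : W -> E) (a : W -> R) (e : E) : R :=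
  \sum_(w | F w == e) a w.

(** The unnormalised conditional law given [F = e]. Its mass is the probability of that event, so
    its entropy is already weighted and [cond_entropy] below is H(W | F). *)
Definition restr (W : finType) (E : eqType) (F : W -> E) (a : W -> R) (e : E)
    (w : W) : R :=
  if F w == e then a w else 0.

Definition cond_entropy (W E : finType) (F : W -> E) (a : W -> R) : R :=
  \sum_e entropy (restr F a e).

Lemma eq_entropy (W : finType) (a b : W -> R) : a =1 b -> entropy a = entropy b.
Proof.
move=> ab; apply: eq_bigr => w _; rewrite ab.
by congr (_ * log2 (_ / _)); apply: eq_bigr.
Qed.

Lemma mass_ge (W : finType) (a : W -> R) w : nneg a -> a w <= \sum_w' a w'.
Proof.
by move=> a0; rewrite (bigD1 w)//= lerDl sumr_ge0.
Qed.

(** Gibbs' inequality, from [log2 x <= (x - 1) / ln 2] at [x = (s / a w) * b w]: with [b] of mass at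
    most 1, the errors add up to a nonpositive number. The supports must be nested since [log2 0] is
    0 here and not minus infinity. *)
Lemma gibbs (W : finType) (a b : W -> R) : nneg a -> nneg b ->
  \sum_w b w <= 1 -> (forall w, a w != 0 -> b w != 0) ->
  entropy a <= \sum_w a w * - log2 (b w).
Proof.
move=> a0 b0 b1 ab; set s := \sum_w a w.
have s0 : 0 <= s by apply: sumr_ge0.
suff H w : a w * log2 (s / a w) <= a w * - log2 (b w) + (s * b w - a w) / ln 2.
  rewrite /entropy -/s (le_trans (ler_sum _ (fun w _ => H w)))// big_split/=.
  rewrite gerDl -mulr_suml big_split/= -mulr_sumr sumrN -/s.
  rewrite mulr_le0_ge0 ?invr_ge0 ?(ltW ln2_gt0)//.
  by rewrite subr_le0 ler_piMr.
have [->|aw0] := eqVneq (a w) 0.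
  by rewrite !mul0r add0r subr0 divr_ge0 ?(ltW ln2_gt0)// mulr_ge0.
have aw : 0 < a w by rewrite lt_neqAle eq_sym aw0 a0.
have bw : 0 < b w by rewrite lt_neqAle eq_sym ab ?b0.
have sw : 0 < s by rewrite (lt_le_trans aw)// mass_ge.
rewrite -lerBlDl -mulrBr opprK -log2M ?divr_gt0//.
have /(ler_wpM2l (ltW aw))/le_trans : log2 (s / a w * b w) <= _ :=
  log2_le (mulr_gt0 (divr_gt0 sw aw) bw).
apply; rewrite mulrA ler_pM2r ?invr_gt0 ?ln2_gt0// mulrBr mulr1 lerD2r.
by rewrite -(mulrA s) mulrCA mulVKf.
Qed.

Lemma entropy_ge0 (W : finType) (a : W -> R) : nneg a -> 0 <= entropy a.
Proof.
move=> a0; apply: sumr_ge0 => w _.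
have [->|aw0] := eqVneq (a w) 0; first by rewrite mul0r.
have aw : 0 < a w by rewrite lt_neqAle eq_sym aw0 a0.
by rewrite mulr_ge0// log2_ge0// ler_pdivlMr// mul1r mass_ge.
Qed.

Lemma entropy0 (W : finType) (a : W -> R) : a =1 (fun=> 0) -> entropy a = 0.
Proof. by move=> a0; rewrite /entropy big1// => w _; rewrite a0 mul0r. Qed.

Lemma entropyZ (W : finType) (c : R) (a : W -> R) :
  entropy (fun w => c * a w) = c * entropy a.
Proof.
rewrite /entropy mulr_sumr; apply: eq_bigr => w _; rewrite -mulr_sumr.
have [->|c0] := eqVneq c 0; first by rewrite !mul0r.
by rewrite -mulf_div divff// mul1r -mulrA.
Qed.

(** Conditioning reduces entropy. The cross entropy against the normalised sum [s / S] is linear in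
    the mass function, so [gibbs], used with this one reference for all [a j], adds up to
    [entropy s]. *)
Lemma entropy_superadd (W : finType) (J : choiceType) (D : set J)
    (a : J -> W -> R) (s : W -> R) :
  (forall j, nneg (a j)) ->
  (forall w, \esum_(j in D) (a j w)%:E = (s w)%:E) ->
  (\esum_(j in D) (entropy (a j))%:E <= (entropy s)%:E)%E.
Proof.
move=> a0 as_.
have s0 w : 0 <= s w.
  by rewrite -lee_fin -as_; apply: esum_ge0 => j _; rewrite lee_fin.
have ale j w : D j -> a j w <= s w.
  move=> Dj; rewrite -lee_fin -as_ -(@esum_set1 _ _ j (fun j => (a j w)%:E)) ?lee_fin//.
  rewrite esum_mkcond [leRHS]esum_mkcond; apply: le_esum => i _.
  case: ifPn => [/set_mem/= ->|_]; first by rewrite mem_set.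
  by case: ifP; rewrite lee_fin.
set S := \sum_w s w.
have [S0|SN0] := eqVneq S 0.
  have s00 w : s w = 0.
    by have/eqP := S0; rewrite psumr_eq0// => /allP/(_ w (mem_index_enum w))/eqP.
  rewrite esum1 ?lee_fin ?entropy_ge0// => j Dj.
  by rewrite entropy0// => w; apply/eqP; rewrite eq_le a0 andbT -[leRHS](s00 w) ale.
have S_gt0 : 0 < S by rewrite lt_neqAle eq_sym SN0 sumr_ge0.
pose b w := s w / S.
have b0 : nneg b by move=> w; rewrite divr_ge0// ltW.
have b1 : \sum_w b w = 1 by rewrite -mulr_suml divff.
have nlb w : 0 <= - log2 (b w).
  by rewrite oppr_ge0 log2_le0// -b1 mass_ge.
have -> : entropy s = \sum_w s w * - log2 (b w).
  apply: eq_bigr => w _; rewrite -/S.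
  have [->|sw0] := eqVneq (s w) 0; first by rewrite !mul0r.
  by rewrite -log2V ?invf_div// divr_gt0// lt_neqAle eq_sym sw0 s0.
have -> : ((\sum_w s w * - log2 (b w))%:E =
    \esum_(j in D) (\sum_w a j w * - log2 (b w))%:E)%E.
  rewrite -sumEFin.
  under [RHS]eq_esum do rewrite -sumEFin.
  rewrite esum_sum; last by move=> j w _ _; rewrite lee_fin mulr_ge0.
  apply: eq_bigr => w _.
  rewrite EFinM -as_ -esumZr//.
  by move=> j; rewrite lee_fin.
apply: le_esum => j Dj; rewrite lee_fin; apply: gibbs => //.
  by rewrite b1.
move=> w; apply: contra; rewrite mulf_eq0 invr_eq0 (negPf SN0) orbF => /eqP sw0.
by rewrite eq_le a0 andbT -sw0 ale.
Qed.

Lemma nneg_push (W E : finType) (F : W -> E) a : nneg a -> nneg (push F a).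
Proof. by move=> a0 e; apply: sumr_ge0. Qed.

Lemma nneg_restr (W : finType) (E : eqType) (F : W -> E) a e :
  nneg a -> nneg (restr F a e).
Proof. by move=> a0 w; rewrite /restr; case: ifP. Qed.

Lemma sum_push (W E : finType) (F : W -> E) (a : W -> R) :
  \sum_e push F a e = \sum_w a w.
Proof. by rewrite [RHS](partition_big F predT). Qed.

Lemma push_id (W : finType) (a : W -> R) : push id a =1 a.
Proof. by move=> w; rewrite /push big_pred1_eq. Qed.

Lemma push_ge (W E : finType) (F : W -> E) (a : W -> R) w :
  nneg a -> a w <= push F a (F w).
Proof. by move=> a0; rewrite /push (bigD1 w)//= lerDl sumr_ge0. Qed.

Lemma entropy_push (W E : finType) (F : W -> E) (a : W -> R) :
  entropy (push F a) = \sum_w a w * log2 ((\sum_w' a w') / push F a (F w)).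
Proof.
rewrite [RHS](partition_big F predT)//=; apply: eq_bigr => e _.
rewrite sum_push mulr_suml; apply: eq_bigr => w /eqP we.
by rewrite we.
Qed.

(** [H] need only separate the same points as the pair of [F] and [G]; a prefix of length [l + 1]
    can thus stand for the prefix of length [l] together with the next letter. The fibre masses
    telescope inside the logarithm. *)
Lemma chain_rule (W E1 E2 E : finType) (F : W -> E1) (G : W -> E2) (H : W -> E)
    (a : W -> R) : nneg a ->
  (forall w w', (H w == H w') = (F w == F w') && (G w == G w')) ->
  entropy (push H a) =
  entropy (push F a) + \sum_e entropy (push G (restr F a e)).
Proof.
move=> a0 HFG.
have -> : \sum_e entropy (push G (restr F a e)) =
    \sum_w a w * log2 (push F a (F w) / push H a (H w)).
  rewrite [RHS](partition_big F predT)//=; apply: eq_bigr => e _.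
  rewrite entropy_push (bigID (fun w => F w == e))/= [X in _ + X]big1 ?addr0.
    apply: eq_bigr => w /eqP we; rewrite /restr we eqxx -big_mkcond/=.
    congr (_ * log2 (_ / _)); rewrite /push -big_mkcondr/=; apply: eq_bigl => w'.
    by rewrite HFG we andbC.
  by move=> w /negPf we; rewrite /restr we mul0r.
rewrite !entropy_push -big_split/=; apply: eq_bigr => w _.
have [->|aw0] := eqVneq (a w) 0; first by rewrite !mul0r add0r.
have aw : 0 < a w by rewrite lt_neqAle eq_sym aw0 a0.
have Fw := lt_le_trans aw (push_ge F w a0).
have Hw := lt_le_trans aw (push_ge H w a0).
have sw := lt_le_trans aw (mass_ge w a0).
by rewrite -mulrDr !log2_div//; congr (_ * _); ring.
Qed.

Lemma entropy_cond (W E : finType) (F : W -> E) (a : W -> R) : nneg a ->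
  entropy a = entropy (push F a) + cond_entropy F a.
Proof.
move=> a0; rewrite -(eq_entropy (push_id a)) (chain_rule (F := F) (G := id))//.
  congr (_ + _); apply: eq_bigr => e _; apply: eq_entropy; exact: push_id.
by move=> w w'; case: (eqVneq w w') => [->|]; rewrite ?eqxx ?andbF.
Qed.

Lemma cond_entropy_ge0 (W E : finType) (F : W -> E) (a : W -> R) : nneg a ->
  0 <= cond_entropy F a.
Proof. by move=> a0; apply: sumr_ge0 => e _; apply/entropy_ge0/nneg_restr. Qed.

End Entropy.

(** * Signed sums and laws of joint sources *)

Section SignedSum.
Context {R : realType}.
Implicit Types T S : choiceType.

(** The convention of [mutual_info], which is convertible to [ssum (minfo_term p f g)]. *)
Definition ssum T (h : T -> R) : \bar R :=
  (\esum_(t in [set: T]) (h^\+ t)%:E - \esum_(t in [set: T]) (h^\- t)%:E)%E.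

Lemma ssum0 T : ssum (fun _ : T => 0) = 0%E.
Proof.
rewrite /ssum !esum1 ?subee// => t _; last by rewrite /funrpos maxxx.
by rewrite /funrneg oppr0 maxxx.
Qed.

Lemma pos_sub_neg T (h : T -> R) t : h t = h^\+ t - h^\- t.
Proof. by rewrite -[in LHS](funrposBneg h). Qed.

Lemma ssum_sub T (h t1 t2 : T -> R) : nneg t1 -> nneg t2 ->
  (forall t, h t = t1 t - t2 t) ->
  \esum_(t in [set: T]) (t1 t)%:E \is a fin_num ->
  \esum_(t in [set: T]) (t2 t)%:E \is a fin_num ->
  ssum h = (\esum_(t in [set: T]) (t1 t)%:E - \esum_(t in [set: T]) (t2 t)%:E)%E.
Proof.
move=> t10 t20 ht f1 f2; rewrite /ssum.
have P0 t : 0 <= h^\+ t by apply: funrpos_ge0.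
have N0 t : 0 <= h^\- t by apply: funrneg_ge0.
have E : (\esum_(t in [set: T]) (h^\+ t)%:E + \esum_(t in [set: T]) (t2 t)%:E =
    \esum_(t in [set: T]) (h^\- t)%:E + \esum_(t in [set: T]) (t1 t)%:E)%E.
  rewrite -!esumD; try by move=> t _; rewrite lee_fin.
  apply: eq_esum => t _; rewrite -!EFinD; congr EFin.
  by have := ht t; rewrite (pos_sub_neg h); lra.
have Pf : \esum_(t in [set: T]) (h^\+ t)%:E \is a fin_num.
  move: f1; rewrite !ge0_fin_numE ?esum_ge0//; try by move=> t _; rewrite lee_fin.
  apply: le_lt_trans; apply: le_esum => t _; rewrite lee_fin.
  by rewrite /funrpos ge_max t10 ht gerBl t20.
have Nf : \esum_(t in [set: T]) (h^\- t)%:E \is a fin_num.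
  move: f2; rewrite !ge0_fin_numE ?esum_ge0//; try by move=> t _; rewrite lee_fin.
  apply: le_lt_trans; apply: le_esum => t _; rewrite lee_fin.
  by rewrite /funrneg ge_max t20 ht opprB gerBl t10.
move: E; rewrite -(fineK f1) -(fineK f2) -(fineK Pf) -(fineK Nf).
by rewrite -!EFinD => -[E]; congr EFin; lra.
Qed.

(** Comparison up to corrections [t1] and [t2] of finite mass, which absorb the errors of [log2_le].
    With the negative parts moved across, only sums of nonnegative families remain; [h1] may still
    sum to [+oo]. *)
Lemma ssum_le T (h1 h2 t1 t2 : T -> R) : nneg t1 -> nneg t2 ->
  (forall t, h2 t + t2 t <= h1 t + t1 t) ->
  (\esum_(t in [set: T]) (t1 t)%:E <= \esum_(t in [set: T]) (t2 t)%:E)%E ->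
  \esum_(t in [set: T]) (t2 t)%:E \is a fin_num ->
  \esum_(t in [set: T]) (h1^\- t)%:E \is a fin_num ->
  (ssum h2 <= ssum h1)%E.
Proof.
move=> t10 t20 ht le12 f2 n1; rewrite /ssum.
have E : (\esum_(t in [set: T]) (h2^\+ t)%:E + \esum_(t in [set: T]) (t2 t)%:E +
    \esum_(t in [set: T]) (h1^\- t)%:E <=
    \esum_(t in [set: T]) (h1^\+ t)%:E + \esum_(t in [set: T]) (t1 t)%:E +
    \esum_(t in [set: T]) (h2^\- t)%:E)%E.
  have P0 h (t : T) : 0 <= h^\+ t :> R by apply: funrpos_ge0.
  have N0 h (t : T) : 0 <= h^\- t :> R by apply: funrneg_ge0.
  rewrite -!esumD; try by move=> t _; rewrite -?EFinD lee_fin ?addr_ge0.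
  apply: le_esum => t _; rewrite -!EFinD lee_fin.
  by have := ht t; rewrite (pos_sub_neg h1) (pos_sub_neg h2); lra.
have f1 : \esum_(t in [set: T]) (t1 t)%:E \is a fin_num.
  move: f2; rewrite !ge0_fin_numE ?esum_ge0//; try by move=> t _; rewrite lee_fin.
  exact: le_lt_trans.
have P1 : (0 <= \esum_(t in [set: T]) (h1^\+ t)%:E)%E.
  by apply: esum_ge0 => t _; rewrite lee_fin funrpos_ge0.
have P2 : (0 <= \esum_(t in [set: T]) (h2^\+ t)%:E)%E.
  by apply: esum_ge0 => t _; rewrite lee_fin funrpos_ge0.
have N2 : (0 <= \esum_(t in [set: T]) (h2^\- t)%:E)%E.
  by apply: esum_ge0 => t _; rewrite lee_fin funrneg_ge0.
move: E le12; rewrite -(fineK f1) -(fineK f2) -(fineK n1).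
move: P1 P2 N2.
case: (esum _ _) => [a| |]; case: (esum _ _) => [b| |]; case: (esum _ _) => [c| |] //.
- by rewrite !lee_fin => _ _ _; lra.
- by move=> *; exact: leNye.
- by move=> *; exact: leNye.
- by move=> *; exact: leey.
Qed.

Lemma esum_fiber_weight T S (phi : T -> S) (r : T -> R) (q : S -> R) (f : S -> R) :
  nneg r -> nneg f ->
  (forall s, \esum_(t in phi @^-1` [set s]) (r t)%:E = (q s)%:E) ->
  (\esum_(t in [set: T]) (r t * f (phi t))%:E =
   \esum_(s in [set: S]) (q s * f s)%:E)%E.
Proof.
move=> r0 f0 rq; rewrite -(esum_fiber phi); last first.
  by move=> t; rewrite lee_fin mulr_ge0.
apply: eq_esum => s _; rewrite EFinM -rq -esumZr//.
by apply: eq_esum => t /= ->.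
Qed.

Lemma posM (x y : R) : 0 <= x -> Num.max (x * y) 0 = x * Num.max y 0.
Proof. by move=> x0; rewrite maxr_pMr// mulr0. Qed.

Lemma negM (x y : R) : 0 <= x -> Num.max (- (x * y)) 0 = x * Num.max (- y) 0.
Proof. by move=> x0; rewrite -mulrN posM. Qed.

Section Fiber.
Variables (T S : choiceType) (phi : T -> S) (r : T -> R) (q : S -> R) (f : S -> R).
Hypotheses (r0 : nneg r)
  (rq : forall s, \esum_(t in phi @^-1` [set s]) (r t)%:E = (q s)%:E).

Let q0 s : 0 <= q s.
Proof. by rewrite -lee_fin -rq; apply: esum_ge0 => t _; rewrite lee_fin. Qed.

Lemma esum_pos_fiber :
  (\esum_(t in [set: T]) ((fun t => r t * f (phi t))^\+ t)%:E =
   \esum_(s in [set: S]) ((fun s => q s * f s)^\+ s)%:E)%E.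
Proof.
under eq_esum do rewrite /funrpos posM//.
under [RHS]eq_esum do rewrite /funrpos posM//.
rewrite (esum_fiber_weight (f := fun s => Num.max (f s) 0) r0 _ rq)//.
by move=> s; rewrite le_max lexx orbT.
Qed.

Lemma esum_neg_fiber :
  (\esum_(t in [set: T]) ((fun t => r t * f (phi t))^\- t)%:E =
   \esum_(s in [set: S]) ((fun s => q s * f s)^\- s)%:E)%E.
Proof.
under eq_esum do rewrite /funrneg negM//.
under [RHS]eq_esum do rewrite /funrneg negM//.
rewrite (esum_fiber_weight (f := fun s => Num.max (- f s) 0) r0 _ rq)//.
by move=> s; rewrite le_max lexx orbT.
Qed.

Lemma ssum_fiber :
  ssum (fun t => r t * f (phi t)) = ssum (fun s => q s * f s).
Proof. by rewrite /ssum esum_pos_fiber esum_neg_fiber. Qed.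

End Fiber.

End SignedSum.

Section Law.
Context {R : realType} (T : choiceType) (p : T -> R).
Hypothesis hp : is_pmf p.
Implicit Types A B S : choiceType.

Let p0 t : 0 <= p t. Proof. exact: hp.1. Qed.

Lemma lawE A (f : T -> A) a :
  (law p f a)%:E = (\esum_(t in f @^-1` [set a]) (p t)%:E)%E.
Proof.
rewrite /law fineK// (@esum_fin_num _ _ _ _ 1)//.
rewrite -hp.2 esum_mkcond; apply: le_esum => t _.
by case: ifP; rewrite lee_fin.
Qed.

Lemma law_ge0 A (f : T -> A) a : 0 <= law p f a.
Proof. by rewrite -lee_fin lawE; apply: esum_ge0 => t _; rewrite lee_fin. Qed.

Lemma law_pmf A (f : T -> A) : is_pmf (law p f).
Proof.
split; first exact: law_ge0.
under eq_esum do rewrite lawE.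
by rewrite (esum_fiber f) ?hp.2// => t; rewrite lee_fin.
Qed.

Lemma law_le A (f : T -> A) t : p t <= law p f (f t).
Proof.
rewrite -lee_fin lawE -(@esum_set1 _ _ t (fun t => (p t)%:E)) ?lee_fin//.
rewrite esum_mkcond [leRHS]esum_mkcond; apply: le_esum => u _.
case: ifPn => [/set_mem/= ->|_]; first by rewrite mem_set.
by case: ifP; rewrite lee_fin.
Qed.

Lemma law_marginl A B (f : T -> A) (g : T -> B) a :
  (\esum_(b in [set: B]) (law p (fun t => (f t, g t)) (a, b))%:E =
   (law p f a)%:E)%E.
Proof.
rewrite lawE -(esum_fiber_setI g); last by move=> t; rewrite lee_fin.
apply: eq_esum => b _; rewrite lawE.
congr esum; apply/seteqP; split=> t /=; first by move=> [<- <-].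
by move=> [-> ->].
Qed.

Lemma law_marginr A B (f : T -> A) (g : T -> B) b :
  (\esum_(a in [set: A]) (law p (fun t => (f t, g t)) (a, b))%:E =
   (law p g b)%:E)%E.
Proof.
rewrite lawE -(esum_fiber_setI f); last by move=> t; rewrite lee_fin.
apply: eq_esum => a _; rewrite lawE.
congr esum; apply/seteqP; split=> t /=; first by move=> [<- <-].
by move=> [-> ->].
Qed.

Lemma law_le_marginl A B (f : T -> A) (g : T -> B) a b :
  law p (fun t => (f t, g t)) (a, b) <= law p f a.
Proof.
rewrite -lee_fin -(law_marginl f g).
by apply: (esum_term_le (f := fun b => (law p _ (a, b))%:E)) => b'; rewrite lee_fin law_ge0.
Qed.

Lemma law_le_marginr A B (f : T -> A) (g : T -> B) a b :
  law p (fun t => (f t, g t)) (a, b) <= law p g b.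
Proof.
rewrite -lee_fin -(law_marginr f g).
by apply: (esum_term_le (f := fun a => (law p _ (a, b))%:E)) => b'; rewrite lee_fin law_ge0.
Qed.

Lemma law_comp S A (phi : T -> S) (p' : S -> R) (f : S -> A) :
  law p phi =1 p' -> law p (f \o phi) =1 law p' f.
Proof.
move=> pp' a; rewrite /law -(esum_fiber_setI phi); last by move=> t; rewrite lee_fin.
rewrite [in RHS]esum_mkcond; congr fine; apply: eq_esum => s _.
case: ifPn => [/set_mem/= sa|/negP sa].
  rewrite -pp' lawE; congr esum; apply/seteqP; split=> t /=; first by case.
  by move=> ts; rewrite ts.
rewrite esum1// => t /= [ta ts]; exfalso; apply: sa.
by rewrite inE/= -ts.
Qed.

Lemma mutual_info_comp S A B (phi : T -> S) (p' : S -> R) (f : S -> A) (g : S -> B) :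
  law p phi =1 p' -> mutual_info p (f \o phi) (g \o phi) = mutual_info p' f g.
Proof.
move=> pp'; rewrite /mutual_info.
suff -> : minfo_term p (f \o phi) (g \o phi) = minfo_term p' f g by [].
apply/funext => ab; rewrite /minfo_term.
rewrite (law_comp (fun t => (f t, g t)) pp') (law_comp f pp').
by rewrite (law_comp g pp').
Qed.

(** The tangent bound on the logarithm gives a lower bound that sums to zero: hence both the
    finiteness of the negative part and the nonnegativity of mutual information. *)
Lemma minfo_term_ge A B (f : T -> A) (g : T -> B) a b :
  (law p (fun t => (f t, g t)) (a, b) - law p f a * law p g b) / ln 2 <=
  minfo_term p f g (a, b).
Proof.
rewrite /minfo_term/=; set q := law p _ _; set x := law p f a; set y := law p g b.
have [q0|q0] := eqVneq q 0.
  by rewrite q0 !mul0r sub0r mulNr oppr_le0 divr_ge0 ?mulr_ge0 ?law_ge0// ltW// ln2_gt0.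
have q_gt0 : 0 < q by rewrite lt_neqAle eq_sym q0 law_ge0.
have x0 : 0 < x by rewrite (lt_le_trans q_gt0)// law_le_marginl.
have y0 : 0 < y by rewrite (lt_le_trans q_gt0)// law_le_marginr.
have xy0 : 0 < x * y by rewrite mulr_gt0.
rewrite -[q / (x * y)]invf_div log2V ?divr_gt0// mulrN lerNr.
apply: (le_trans (ler_wpM2l (ltW q_gt0) (log2_le (divr_gt0 xy0 q_gt0)))).
by rewrite -mulNr opprB mulrA ler_pM2r ?invr_gt0 ?ln2_gt0// mulrBr mulr1 mulrC divfK.
Qed.

Lemma prod_law_sum A B (f : T -> A) (g : T -> B) :
  (\esum_(ab in [set: A * B]) (law p f ab.1 * law p g ab.2 / ln 2)%:E =
   ((ln 2)^-1)%:E)%E.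
Proof.
have l0 : 0 <= (ln 2 : R)^-1 by rewrite invr_ge0 ltW// ln2_gt0.
rewrite esum_pair; last first.
  by move=> w; rewrite lee_fin !mulr_ge0 ?law_ge0.
rewrite -[RHS]mul1e -(law_pmf f).2 -esumZr//; last first.
  by move=> a; rewrite lee_fin law_ge0.
apply: eq_esum => a _ /=.
under eq_esum do rewrite mulrAC EFinM.
rewrite esumZl ?mulr_ge0 ?law_ge0//; last by move=> b; rewrite lee_fin law_ge0.
by rewrite (law_pmf g).2 mule1 EFinM.
Qed.

Lemma minfo_neg_fin A B (f : T -> A) (g : T -> B) :
  \esum_(ab in [set: A * B]) ((minfo_term p f g)^\- ab)%:E \is a fin_num.
Proof.
apply: (@esum_fin_num _ _ _ _ (ln 2)^-1) => [ab|].
  by rewrite lee_fin funrneg_ge0.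
rewrite -(prod_law_sum f g); apply: le_esum => -[a b] _; rewrite lee_fin /=.
have l0 : 0 <= (ln 2 : R)^-1 by rewrite invr_ge0 ltW// ln2_gt0.
rewrite /funrneg ge_max; apply/andP; split; last by rewrite !mulr_ge0 ?law_ge0.
rewrite lerNl; apply: le_trans (minfo_term_ge f g a b).
by rewrite mulrBl lerBrDl subrr mulr_ge0 ?law_ge0.
Qed.

Lemma mutual_info_ge0 A B (f : T -> A) (g : T -> B) :
  (0 <= mutual_info p f g)%E.
Proof.
have l0 : 0 <= (ln 2 : R)^-1 by rewrite invr_ge0 ltW// ln2_gt0.
rewrite -(ssum0 (A * B)%type).
have H : \esum_(ab in [set: A * B]) (law p (fun t => (f t, g t)) ab / ln 2)%:E =
    ((ln 2)^-1)%:E.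
  rewrite -[RHS]mul1e -(law_pmf (fun t => (f t, g t))).2 -esumZr//.
  by move=> ab; rewrite lee_fin law_ge0.
apply: (@ssum_le _ _ _ _ (fun ab => law p f ab.1 * law p g ab.2 / ln 2)
    (fun ab => law p (fun t => (f t, g t)) ab / ln 2)).
- by move=> ab; rewrite !mulr_ge0 ?law_ge0.
- by move=> ab; rewrite !mulr_ge0 ?law_ge0.
- by move=> [a b] /=; rewrite add0r -lerBlDr -mulrBl minfo_term_ge.
- by rewrite prod_law_sum H.
- by rewrite H.
- exact: minfo_neg_fin.
Qed.

(** Written over the sample space, informations with different alphabets can be compared point by
    point, as data processing requires. *)
Lemma mutual_infoE A B (f : T -> A) (g : T -> B) :
  mutual_info p f g = ssum (fun t => p t *
    log2 (law p (fun t => (f t, g t)) (f t, g t) / (law p f (f t) * law p g (g t)))).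
Proof.
symmetry; exact: (ssum_fiber (fun ab => log2 (law p (fun t => (f t, g t)) ab /
  (law p f ab.1 * law p g ab.2))) p0 (fun ab => esym (lawE (fun t => (f t, g t)) ab))).
Qed.

Lemma mutual_info_neg_fin A B (f : T -> A) (g : T -> B) :
  \esum_(t in [set: T]) ((fun t => p t *
    log2 (law p (fun t => (f t, g t)) (f t, g t) /
          (law p f (f t) * law p g (g t))))^\- t)%:E \is a fin_num.
Proof.
have := minfo_neg_fin f g.
by rewrite (esum_neg_fiber (fun ab => log2 (law p (fun t => (f t, g t)) ab /
  (law p f ab.1 * law p g ab.2))) p0 (fun ab => esym (lawE (fun t => (f t, g t)) ab))).
Qed.

Lemma mutual_info_inj A A' B (h : A -> A') (f : T -> A) (g : T -> B) :
  injective h -> mutual_info p (h \o f) g = mutual_info p f g.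
Proof.
move=> hI; rewrite !mutual_infoE; congr ssum; apply/funext => t.
have -> : law p (fun t => ((h \o f) t, g t)) ((h \o f) t, g t) =
    law p (fun t => (f t, g t)) (f t, g t).
  congr (fine (esum _ _)); apply/seteqP; split=> u /=.
    by move=> [/hI -> ->].
  by move=> [-> ->].
have -> // : law p (h \o f) ((h \o f) t) = law p f (f t).
by congr (fine (esum _ _)); apply/seteqP; split=> [u /= /hI //|u /= ->].
Qed.

(** I = H(f) - H(f | g), meaningful for infinite [B] because only entropies of the finite side
    occur: each term splits as [t1 - t2], both nonnegative and summable. *)
Lemma mutual_info_fin (A : finType) B (f : T -> A) (g : T -> B) :
  mutual_info p f g = ((entropy (law p f))%:E -
   \esum_(b in [set: B]) (entropy (fun a => law p (fun t => (f t, g t)) (a, b)))%:E)%E.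
Proof.
pose q ab := law p (fun t => (f t, g t)) ab.
have q0 ab : 0 <= q ab by apply: law_ge0.
pose t1 ab := q ab * log2 (law p f ab.1)^-1.
pose t2 ab := q ab * log2 (law p g ab.2 / q ab).
have law1 (a : A) : law p f a <= 1.
  by rewrite -lee_fin -(law_pmf f).2;
    apply: (esum_term_le (f := fun a => (law p f a)%:E)) => b; rewrite lee_fin law_ge0.
have qp a b : q (a, b) != 0 -> [/\ 0 < q (a, b), 0 < law p f a & 0 < law p g b].
  move=> qn0; have q_gt0 : 0 < q (a, b) by rewrite lt_neqAle eq_sym qn0 q0.
  by split=> //; apply: (lt_le_trans q_gt0); [exact: law_le_marginl|exact: law_le_marginr].
have t10 ab : 0 <= t1 ab.
  case: ab => a b; rewrite /t1; have [->|/qp[qp0 fp gp]] := eqVneq (q (a, b)) 0.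
    by rewrite mul0r.
  by rewrite mulr_ge0// log2_ge0// invf_ge1.
have t20 ab : 0 <= t2 ab.
  case: ab => a b; rewrite /t2; have [->|/qp[qp0 fp gp]] := eqVneq (q (a, b)) 0.
    by rewrite mul0r.
  by rewrite mulr_ge0// log2_ge0// ler_pdivlMr// mul1r law_le_marginr.
have t12 ab : minfo_term p f g ab = t1 ab - t2 ab.
  case: ab => a b; rewrite /t1 /t2.
  change (q (a, b) * log2 (q (a, b) / (law p f a * law p g b)) =
    q (a, b) * log2 (law p f a)^-1 - q (a, b) * log2 (law p g b / q (a, b))).
  have [->|/qp[qp0 fp gp]] := eqVneq (q (a, b)) 0; first by rewrite !mul0r subr0.
  rewrite !log2_div ?mulr_gt0// log2M// log2V//.
  by ring.
have E1 : \esum_(ab in [set: A * B]) (t1 ab)%:E = (entropy (law p f))%:E.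
  rewrite esum_pair//= esum_fin; last first.
    by move=> a; apply: esum_ge0 => b _; rewrite lee_fin.
  rewrite /entropy -sumEFin; apply: eq_bigr => a _.
  under eq_esum => b do
    rewrite (_ : (t1 (a, b))%:E = (q (a, b))%:E * (log2 (law p f a)^-1)%:E)%E//.
  have [a0|a0] := eqVneq (law p f a) 0.
    rewrite a0 mul0r esum1// => b _.
    suff -> : q (a, b) = 0 by rewrite mul0e.
    by apply/eqP; rewrite eq_le q0 andbT -a0 law_le_marginl.
  have a_gt0 : 0 < law p f a by rewrite lt_neqAle eq_sym a0 law_ge0.
  rewrite esumZr; last 2 first.
  - by rewrite log2_ge0// invf_ge1.
  - by move=> b; rewrite lee_fin law_ge0.
  rewrite law_marginl -EFinM; congr (_ * log2 _)%:E.
  suff -> : \sum_a law p f a = 1 by rewrite div1r.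
  apply: EFin_inj; rewrite -sumEFin -esum_fin ?(law_pmf f).2// => b.
  by rewrite lee_fin law_ge0.
have E2 : \esum_(ab in [set: A * B]) (t2 ab)%:E = \esum_(b in [set: B])
    (entropy (fun a => law p (fun t => (f t, g t)) (a, b)))%:E.
  rewrite esum_pair// esum_swap; last by move=> a b; rewrite lee_fin.
  apply: eq_esum => b _.
  rewrite esum_fin; last by move=> a; rewrite lee_fin.
  rewrite sumEFin; congr EFin; apply: eq_bigr => a _.
  rewrite /t2/=; congr (_ * log2 (_ / _)).
  apply: EFin_inj; rewrite -sumEFin -esum_fin ?law_marginr// => c.
  by rewrite lee_fin law_ge0.
have F2 : \esum_(ab in [set: A * B]) (t2 ab)%:E \is a fin_num.
  apply: (@esum_fin_num _ _ _ _ (entropy (law p f))) => //.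
  rewrite E2; apply: entropy_superadd => [b a|a]; first exact: law_ge0.
  exact: law_marginl.
rewrite -E1 -E2 /mutual_info; apply: ssum_sub => //.
by rewrite E1.
Qed.

End Law.

(** * The wiretap channel *)

Section Channel.
Context {R : realType} {U V Z : countType}.
Variable ch : U -> V * Z -> R.
Hypothesis hch : forall u, is_pmf (ch u).

Let ch0 u y : 0 <= ch u y. Proof. exact: (hch u).1. Qed.

Lemma channel_sum u : (\esum_(y in [set: V * Z]) (ch u y)%:E = 1)%E.
Proof. exact: (hch u).2. Qed.

Lemma aux_law_pmf (W : countType) (pwu : W * U -> R) :
  is_pmf pwu -> is_pmf (aux_law ch pwu).
Proof.
move=> hpwu; split=> [[w y]|]; first by rewrite mulr_ge0 ?hpwu.1.
rewrite esum_pair => [|[w y]]; last by rewrite lee_fin mulr_ge0 ?hpwu.1.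
rewrite -hpwu.2; apply: eq_esum => w _.
rewrite /aux_law /=; under eq_esum do rewrite EFinM.
rewrite esumZl ?hpwu.1// => [|y]; last by rewrite lee_fin.
by rewrite channel_sum mule1.
Qed.

Lemma law_fst_sum u v :
  (\esum_(z in [set: Z]) (ch u (v, z))%:E = (law (ch u) fst v)%:E)%E.
Proof.
rewrite -(law_marginl (hch u) fst snd); apply: eq_esum => z _.
rewrite (lawE (hch u)) (_ : _ @^-1` _ = [set (v, z)]) ?esum_set1 ?lee_fin//.
by apply/seteqP; split=> [[a b]|[a b]] /= [-> ->].
Qed.

Section DataProcessing.
Variables (W : countType) (pwu : W * U -> R).
Hypothesis hpwu : is_pmf pwu.
Let P := aux_law ch pwu.
Let hP : is_pmf P := aux_law_pmf hpwu.

Lemma law_aux_channel (u : U) (y : V * Z) :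
  law P (fun t => (t.1.2, t.2)) (u, y) = law pwu snd u * ch u y.
Proof.
apply: EFin_inj; rewrite (lawE hP) EFinM (lawE hpwu) -esumZr//; last first.
  by move=> w; rewrite lee_fin hpwu.1.
rewrite esum_mkcond [RHS]esum_mkcond esum_pair; last first.
  by move=> t; case: ifP => // _; rewrite lee_fin hP.1.
apply: eq_esum => w _.
rewrite (esum_only (t0 := y)) => [|y'|y' /eqP yy'].
- case: ifPn => [/set_mem/= [wu]|wu].
    by rewrite mem_set// -EFinM /P /aux_law /= wu.
  rewrite ifF//; apply/negbTE; apply: contra wu => /set_mem/= wu.
  by apply/mem_set; rewrite /= wu.
- by case: ifP => // _; rewrite lee_fin hP.1.
- by rewrite ifF//; apply/negP => /set_mem/= [].
Qed.

Lemma law_aux_uv (u : U) (v : V) :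
  law P (fun t => (t.1.2, t.2.1)) (u, v) = law pwu snd u * law (ch u) fst v.
Proof.
apply: EFin_inj; rewrite EFinM -law_fst_sum -esumZl; last 2 first.
- exact: law_ge0 hpwu _ _ _.
- by move=> z; rewrite lee_fin.
rewrite (lawE hP) -(esum_fiber_setI (fun t : (W * U) * (V * Z) => t.2.2)); last first.
  by move=> t; rewrite lee_fin hP.1.
apply: eq_esum => z _; rewrite -EFinM -law_aux_channel (lawE hP).
congr esum; apply/seteqP; split=> -[[w u'] [v' z']] /=.
  by move=> [[-> ->] ->].
by move=> [-> -> ->].
Qed.

Lemma aux_data_processing :
  (mutual_info P (fun t => t.1.1) (fun t => t.2.1) <=
   mutual_info P (fun t => t.1.2) (fun t => t.2.1))%E.
Proof.
have l0 : 0 <= (ln 2 : R)^-1 by rewrite invr_ge0 ltW// ln2_gt0.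
rewrite !(mutual_infoE hP).
have arith (x F1 F2 y l : R) : x * F2 <= x * ((y - 1) * l) ->
    x * (F1 + F2) + x * l <= x * F1 + x * y * l.
  by rewrite (_ : x * ((y - 1) * l) = x * y * l - x * l); [lra|ring].
pose Pw w := law P (fun t => t.1.1) w.
pose q2 wv := law P (fun t => (t.1.1, t.2.1)) wv.
(* [s] is [P] with V redrawn given W alone, and Z following its law given U and the new V. The
   logarithm of [s / P] is the difference of the two information densities, so [log2_le] and a mass
   at most 1 for [s] give the inequality. *)
pose s (t : (W * U) * (V * Z)) := pwu t.1 / Pw t.1.1 * (q2 (t.1.1, t.2.1) *
  (ch t.1.2 t.2 / law (ch t.1.2) fst t.2.1)).
have Pw0 w : 0 <= Pw w by apply: law_ge0 hP _ _ _.
have q20 w : 0 <= q2 w by apply: law_ge0 hP _ _ _.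
have k0 u v : 0 <= law (ch u) fst v by apply: law_ge0 (hch u) _ _ _.
have s0 t : 0 <= s t by rewrite !mulr_ge0 ?invr_ge0 ?hpwu.1.
have s1 : (\esum_(t in [set: (W * U) * (V * Z)]) (s t)%:E <= 1)%E.
  rewrite esum_pair; last by move=> t; rewrite lee_fin.
  rewrite -hpwu.2; apply: le_esum => -[w u] _.
  rewrite esum_pair; last by move=> t; rewrite lee_fin.
  apply: (@le_trans _ _ (\esum_(v in [set: V])
      ((pwu (w, u) / Pw w)%:E * (q2 (w, v))%:E)))%E.
    apply: le_esum => v _; rewrite /s /=.
    under eq_esum do rewrite !mulrA -(mulrA _ (ch _ _)) (mulrC (ch _ _)) mulrA EFinM.
    rewrite esumZl; last 2 first.
    - by rewrite !mulr_ge0 ?invr_ge0 ?hpwu.1.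
    - by move=> z; rewrite lee_fin.
    rewrite law_fst_sum -!EFinM lee_fin.
    have [->|kn0] := eqVneq (law (ch u) fst v) 0.
      by rewrite mulr0 !mulr_ge0 ?invr_ge0 ?hpwu.1.
    by rewrite divfK.
  rewrite esumZl; last 2 first.
  - by rewrite !mulr_ge0 ?invr_ge0 ?hpwu.1.
  - by move=> z; rewrite lee_fin.
  rewrite (law_marginl hP) -EFinM lee_fin -/(Pw w).
  have [->|kn0] := eqVneq (Pw w) 0; first by rewrite mulr0 hpwu.1.
  by rewrite divfK.
apply: (@ssum_le _ _ _ _ (fun t => s t / ln 2) (fun t => P t / ln 2)).
- by move=> t; rewrite mulr_ge0.
- by move=> t; rewrite mulr_ge0 ?hP.1.
- move=> t /=.
  have [->|Pt0] := eqVneq (P t) 0; first by rewrite !mul0r !add0r mulr_ge0.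
  have Pt : 0 < P t by rewrite lt_neqAle eq_sym Pt0 hP.1.
  have H1 := lt_le_trans Pt (law_le hP (fun t => t.1.1) t).
  have H2 := lt_le_trans Pt (law_le hP (fun t => t.1.2) t).
  have H3 := lt_le_trans Pt (law_le hP (fun t => t.2.1) t).
  have H4 := lt_le_trans Pt (law_le hP (fun t => (t.1.1, t.2.1)) t).
  have H5 := lt_le_trans Pt (law_le hP (fun t => (t.1.2, t.2.1)) t).
  have E6 : law P (fun t => t.1.2) t.1.2 = law pwu snd t.1.2.
    apply: EFin_inj; rewrite -(law_marginl hP (fun t => t.1.2) (fun t => t.2)).
    under eq_esum do rewrite law_aux_channel EFinM.
    by rewrite esumZl ?channel_sum ?mule1//; [exact: law_ge0|move=> y; rewrite lee_fin].
  rewrite /= in H1 H2 H3 H4 H5.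
  set a := law P (fun t => t.1.1) _ in H1 *.
  set b := law P (fun t => t.1.2) _ in H2 E6 *.
  set c := law P (fun t => t.2.1) _ in H3 *.
  set d := law P (fun t => (t.1.1, t.2.1)) _ in H4 *.
  set e := law P (fun t => (t.1.2, t.2.1)) _ in H5 *.
  have Ee : e = b * law (ch t.1.2) fst t.2.1 by rewrite E6 -law_aux_uv.
  have K : 0 < law (ch t.1.2) fst t.2.1 by move: H5; rewrite Ee pmulr_rgt0.
  have Es : s t = P t * (d * b / (a * e)).
    rewrite Ee; set k := law (ch t.1.2) fst t.2.1 in K *.
    change (pwu t.1 / a * (d * (ch t.1.2 t.2 / k)) =
      pwu t.1 * ch t.1.2 t.2 * (d * b / (a * (b * k)))).
    by field; rewrite !gt_eqF.
  have x0 : 0 < d * b / (a * e) by rewrite divr_gt0 ?mulr_gt0.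
  have -> : log2 (d / (a * c)) = log2 (e / (b * c)) + log2 (d * b / (a * e)).
    by rewrite !log2_div ?mulr_gt0// !log2M//; ring.
  have := ler_wpM2l (ltW Pt) (log2_le x0).
  by rewrite Es; exact: arith.
- under eq_esum do rewrite EFinM.
  rewrite esumZr//; under [leRHS]eq_esum do rewrite EFinM.
  rewrite esumZr//; last by move=> t; rewrite lee_fin hP.1.
  by rewrite hP.2 lee_wpmul2r.
- under eq_esum do rewrite EFinM.
  by rewrite esumZr ?hP.2 ?mul1e// => t; rewrite lee_fin hP.1.
- exact: mutual_info_neg_fin.
Qed.

Lemma mutual_info_aux_le_capacity :
  (mutual_info P (fun t => t.1.1) (fun t => t.2.1) <= capacity ch)%E.
Proof.
apply: (le_trans aux_data_processing); apply: ereal_sup_ubound.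
exists (law pwu snd); first exact: law_pmf.
rewrite -(@mutual_info_comp _ _ _ hP _ _ _ (fun t => (t.1.2, t.2)))// => -[u y].
exact: law_aux_channel.
Qed.

End DataProcessing.

Lemma secrecy_capacity_le : (secrecy_capacity ch <= capacity ch)%E.
Proof.
apply: ge_ereal_sup => _ [W [pwu [hpwu ->]]].
apply: le_trans (mutual_info_aux_le_capacity hpwu).
by rewrite geeDl// oppe_le0 (mutual_info_ge0 (aux_law_pmf hpwu)).
Qed.

End Channel.

(** * One use of the channel *)

Section ChannelUse.
Context {R : realType} {U V Z : countType}.
Variable ch : U -> V * Z -> R.
Hypothesis hch : forall u, is_pmf (ch u).

Lemma entropy_kernel_le (W : finType) (Y : choiceType) (K : Y -> W -> R)
    (a : W -> R) : nneg a -> (forall y w, 0 <= K y w) ->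
  (forall w, \esum_(y in [set: Y]) (K y w)%:E = 1%E) ->
  (\esum_(y in [set: Y]) (entropy (fun w => a w * K y w))%:E <= (entropy a)%:E)%E.
Proof.
move=> a0 K0 K1; apply: entropy_superadd => [y w|w]; first by rewrite mulr_ge0.
under eq_esum do rewrite EFinM.
by rewrite esumZl// ?K1 ?mule1// => y; rewrite lee_fin.
Qed.

Section OneUse.
Variables (W : finType) (u : W -> U).

(** Law of (W, U) for an input that is a function of W: the finite source word will be the auxiliary
    variable of the wiretap channel. *)
Definition det_input (b : W -> R) (wu : W * U) : R :=
  b wu.1 * (wu.2 == u wu.1)%:R.

Lemma det_input_pmf (b : W -> R) : nneg b -> \sum_w b w = 1 ->
  is_pmf (det_input b).
Proof.
move=> b0 b1; have d0 wu : 0 <= det_input b wu by rewrite mulr_ge0.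
split=> //; rewrite esum_pair//.
rewrite esum_fin => [|w]; last by apply: esum_ge0 => u' _; rewrite lee_fin.
rewrite -b1 -sumEFin; apply: eq_bigr => w _.
rewrite (esum_only (t0 := u w)) => [|u'|u' /negPf uu'].
- by rewrite /det_input/= eqxx mulr1.
- by rewrite lee_fin.
- by rewrite /det_input/= uu' mulr0.
Qed.

Lemma law_det_input (b : W -> R) (Y : choiceType) (h : V * Z -> Y) w y :
  nneg b -> \sum_w b w = 1 ->
  law (aux_law ch (det_input b)) (fun t => (t.1.1, h t.2)) (w, y) =
  b w * law (ch (u w)) h y.
Proof.
move=> b0 b1; have d_pmf := det_input_pmf b0 b1.
have hP := aux_law_pmf hch d_pmf.
apply: EFin_inj; rewrite (lawE hP) EFinM (lawE (hch _)).
rewrite -esumZl//; last by move=> t; rewrite lee_fin (hch _).1.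
rewrite esum_mkcond esum_pair; last by move=> t; case: ifP; rewrite // lee_fin hP.1.
rewrite (esum_only (t0 := (w, u w))) => [|wu|[w' u'] wu].
- rewrite [RHS]esum_mkcond; apply: eq_esum => t _.
  case: ifPn => [/set_mem/= [ty]|ty].
    by rewrite mem_set// /aux_law /det_input /= eqxx mulr1.
  rewrite ifF//; apply/negbTE; apply: contra ty => /set_mem/= ty.
  by apply/mem_set; rewrite /= ty.
- by apply: esum_ge0 => t _; case: ifP; rewrite // lee_fin hP.1.
- rewrite esum1// => t _; case: ifPn => // /set_mem/= [ww' _].
  rewrite /aux_law /det_input /= ww' (_ : u' == u w = false) ?mulr0 ?mul0r//.
  by apply: contraNF wu => /eqP ->; rewrite ww'.
Qed.

Lemma law_det_input_fst (b : W -> R) w : nneg b -> \sum_w b w = 1 ->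
  law (aux_law ch (det_input b)) (fun t => t.1.1) w = b w.
Proof.
move=> b0 b1; have hP := aux_law_pmf hch (det_input_pmf b0 b1).
apply: EFin_inj; rewrite -(law_marginl hP _ (fun t => t.2.1)).
under eq_esum do rewrite (law_det_input fst)// EFinM.
rewrite esumZl//; last by move=> y; rewrite lee_fin (law_ge0 (hch _)).
by rewrite (law_pmf (hch _) fst).2 mule1.
Qed.

Lemma minfo_det_input (b : W -> R) (Y : choiceType) (h : V * Z -> Y) :
  nneg b -> \sum_w b w = 1 ->
  mutual_info (aux_law ch (det_input b)) (fun t => t.1.1) (fun t => h t.2) =
  ((entropy b)%:E -
   \esum_(y in [set: Y]) (entropy (fun w => b w * law (ch (u w)) h y))%:E)%E.
Proof.
move=> b0 b1; have hP := aux_law_pmf hch (det_input_pmf b0 b1).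
rewrite (mutual_info_fin hP); congr (_ - _)%E.
  by congr EFin; apply: eq_entropy => w; rewrite law_det_input_fst.
apply: eq_esum => y _; congr EFin; apply: eq_entropy => w.
exact: law_det_input.
Qed.

Let cond_fin (Y : choiceType) (h : V * Z -> Y) (a : W -> R) : nneg a ->
  \esum_(y in [set: Y]) (entropy (fun w => a w * law (ch (u w)) h y))%:E
  \is a fin_num.
Proof.
move=> a0; apply: (@esum_fin_num _ _ _ _ (entropy a)).
  move=> y; rewrite lee_fin; apply: entropy_ge0 => w.
  by rewrite mulr_ge0// (law_ge0 (hch _)).
apply: entropy_kernel_le => // [y w|w]; first exact: (law_ge0 (hch _)).
exact: (law_pmf (hch _) h).2.
Qed.

Let homog (Y : choiceType) (h : V * Z -> Y) (s : R) (a b : W -> R) : 0 <= s ->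
  nneg b -> (forall w, a w = s * b w) ->
  (\esum_(y in [set: Y]) (entropy (fun w => a w * law (ch (u w)) h y))%:E =
  s%:E * \esum_(y in [set: Y]) (entropy (fun w => b w * law (ch (u w)) h y))%:E)%E.
Proof.
move=> s0 b0 asb; rewrite -esumZl//; last first.
  move=> y; rewrite lee_fin; apply: entropy_ge0 => w.
  by rewrite mulr_ge0// (law_ge0 (hch _)).
apply: eq_esum => y _; rewrite -EFinM -entropyZ; congr EFin.
by apply: eq_entropy => w; rewrite asb mulrA.
Qed.

(** The capacities concern probability laws, whereas both sides of the bounds below are homogeneous
    in [a]; only the zero mass cannot be normalised. *)
Let normalise (a : W -> R) : nneg a -> exists b : W -> R,
  [/\ nneg b, forall w, a w = (\sum_w a w) * b w & \sum_w a w = 0 \/ \sum_w b w = 1].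
Proof.
move=> a0; have [s0|s0] := eqVneq (\sum_w a w) 0.
  exists (fun=> 0); split=> //; last by left.
  move=> w; rewrite mulr0; apply/eqP; rewrite eq_le a0 andbT -s0.
  exact: mass_ge.
exists (fun w => a w / \sum_w a w); split.
- by move=> w; rewrite divr_ge0// sumr_ge0.
- by move=> w; rewrite mulrC divfK.
- by right; rewrite -mulr_suml divff.
Qed.

Lemma capacity_use (a : W -> R) : capacity ch \is a fin_num -> nneg a ->
  ((entropy a)%:E <=
   \esum_(v in [set: V]) (entropy (fun w => a w * law (ch (u w)) fst v))%:E +
   ((\sum_w a w) * fine (capacity ch))%:E)%E.
Proof.
move=> hC a0; have [b [b0 ab b1]] := normalise a0.
have s0 : 0 <= \sum_w a w by apply: sumr_ge0.
move: (\sum_w a w) ab b1 s0 => s ab b1 s0.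
rewrite (homog fst s0 b0 ab) (eq_entropy ab) entropyZ.
case: b1 => [->|b1]; first by rewrite !mul0r mul0e add0e.
rewrite !EFinM -muleDr ?fin_num_adde_defl//; apply: lee_wpmul2l => //.
rewrite fineK// addeC -leeBlDr ?cond_fin//.
rewrite -(minfo_det_input fst)//.
by apply: mutual_info_aux_le_capacity => //; exact: det_input_pmf.
Qed.

(** I(W;V) - I(W;Z) is H(W | Z) - H(W | V), since H(W) cancels, and W with a deterministic input is
    admissible in [secrecy_capacity]. *)
Lemma secrecy_use (a : W -> R) : secrecy_capacity ch \is a fin_num -> nneg a ->
  (\esum_(z in [set: Z]) (entropy (fun w => a w * law (ch (u w)) snd z))%:E <=
   \esum_(v in [set: V]) (entropy (fun w => a w * law (ch (u w)) fst v))%:E +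
   ((\sum_w a w) * fine (secrecy_capacity ch))%:E)%E.
Proof.
move=> hC a0; have [b [b0 ab b1]] := normalise a0.
have s0 : 0 <= \sum_w a w by apply: sumr_ge0.
move: (\sum_w a w) ab b1 s0 => s ab b1 s0.
rewrite (homog fst s0 b0 ab) (homog snd s0 b0 ab).
case: b1 => [->|b1]; first by rewrite !mul0r !mul0e add0e.
rewrite !EFinM -muleDr ?fin_num_adde_defl//; apply: lee_wpmul2l => //.
have : (mutual_info (aux_law ch (det_input b)) (fun t => t.1.1) (fun t => t.2.1) -
        mutual_info (aux_law ch (det_input b)) (fun t => t.1.1) (fun t => t.2.2) <=
        secrecy_capacity ch)%E.
  apply: ereal_sup_ubound; exists W, (det_input b); split=> //.
  exact: det_input_pmf.
rewrite (minfo_det_input fst)// (minfo_det_input snd)//.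
rewrite -(fineK hC) -(fineK (cond_fin fst b0)) -(fineK (cond_fin snd b0)).
by rewrite -!EFinD !lee_fin /=; lra.
Qed.

End OneUse.
End ChannelUse.

(** * Output sequences of several channel uses *)

Section EsumSeq.
Context {R : realType} {Y : choiceType}.

Lemma esum_seq_nil (f : seq Y -> \bar R) : (forall ys, (0 <= f ys)%E) ->
  (forall y ys, f (y :: ys) = 0%E) ->
  (\esum_(ys in [set: seq Y]) f ys = f [::])%E.
Proof. by move=> f0 fc; rewrite (esum_only (t0 := [::]))// => -[]. Qed.

Lemma esum_seq_cons (f : seq Y -> \bar R) : (forall ys, (0 <= f ys)%E) ->
  f [::] = 0%E ->
  (\esum_(ys in [set: seq Y]) f ys =
   \esum_(y in [set: Y]) \esum_(ys in [set: seq Y]) f (y :: ys))%E.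
Proof.
move=> f0 fnil; rewrite -(esum_pair (f := fun t => f (t.1 :: t.2)))//.
rewrite -(@reindex_esum _ (Y * seq Y)%type (seq Y) setT [set ys | ys != [::]]
  (fun t => t.1 :: t.2)); last first.
  split=> [t _ //|[y1 s1] [y2 s2] _ _ [-> ->]//|[//|y ys] _].
  by exists (y, ys).
rewrite [RHS]esum_mkcond; apply: eq_esum => -[|y ys] _.
  by rewrite fnil; case: ifP.
by rewrite mem_set.
Qed.

End EsumSeq.

Section SeqKernel.
Context {R : realType} {U : Type} {W : finType} {I : eqType}.
Variable f : I -> W -> U.

Section Kernel.
Context {Y : choiceType}.
Variable kappa : U -> Y -> R.
Hypothesis kappa_pmf : forall u, is_pmf (kappa u).

Let k0 u y : 0 <= kappa u y. Proof. exact: (kappa_pmf u).1. Qed.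

(** Probability of the outputs [ys] when [w] is sent through the uses listed in [s]. It vanishes for
    a wrong length, so sums can run over all of [seq Y] and concatenation needs no casts between
    tuples. *)
Fixpoint seq_kernel (s : seq I) (ys : seq Y) (w : W) : R :=
  match s, ys with
  | [::], [::] => 1
  | i :: s', y :: ys' => kappa (f i w) y * seq_kernel s' ys' w
  | _, _ => 0
  end.

(** H(W | outputs of the uses in [s]), finite even for infinite [Y]. *)
Definition seq_entropy (s : seq I) (a : W -> R) : \bar R :=
  \esum_(ys in [set: seq Y]) (entropy (fun w => a w * seq_kernel s ys w))%:E.

Lemma seq_kernel_ge0 s ys w : 0 <= seq_kernel s ys w.
Proof.
by elim: s ys => [[]|i s IH [|y ys]]//=; rewrite mulr_ge0.
Qed.

Lemma eq_seq_entropy s a b : a =1 b -> seq_entropy s a = seq_entropy s b.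
Proof.
move=> ab; apply: eq_esum => ys _; congr EFin.
by apply: eq_entropy => w; rewrite ab.
Qed.

Lemma seq_entropy_ge0 s a : nneg a -> (0 <= seq_entropy s a)%E.
Proof.
move=> a0; apply: esum_ge0 => ys _; rewrite lee_fin.
by apply: entropy_ge0 => w; rewrite mulr_ge0// seq_kernel_ge0.
Qed.

Let term_ge0 s a ys : nneg a ->
  (0 <= (entropy (fun w => a w * seq_kernel s ys w))%:E)%E.
Proof.
move=> a0; rewrite lee_fin.
by apply: entropy_ge0 => w; rewrite mulr_ge0// seq_kernel_ge0.
Qed.

Lemma seq_entropy_nil a : nneg a -> seq_entropy [::] a = (entropy a)%:E.
Proof.
move=> a0; rewrite /seq_entropy esum_seq_nil => [|ys|y ys].
- by congr EFin; apply: eq_entropy => w; rewrite /= mulr1.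
- exact: term_ge0.
- by rewrite entropy0// => w; rewrite /= mulr0.
Qed.

Lemma seq_entropy_cons i s a : nneg a -> seq_entropy (i :: s) a =
  \esum_(y in [set: Y]) seq_entropy s (fun w => a w * kappa (f i w) y).
Proof.
move=> a0; rewrite /seq_entropy esum_seq_cons => [|ys|].
- apply: eq_esum => y _; apply: eq_esum => ys _; congr EFin.
  by apply: eq_entropy => w; rewrite /= mulrA.
- exact: term_ge0.
- by rewrite entropy0// => w; rewrite /= mulr0.
Qed.

Lemma seq_entropy1 i a : nneg a -> seq_entropy [:: i] a =
  \esum_(y in [set: Y]) (entropy (fun w => a w * kappa (f i w) y))%:E.
Proof.
move=> a0; rewrite seq_entropy_cons//; apply: eq_esum => y _.
by rewrite seq_entropy_nil// => w; rewrite mulr_ge0.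
Qed.

Lemma seq_kernel_sum s w :
  (\esum_(ys in [set: seq Y]) (seq_kernel s ys w)%:E = 1)%E.
Proof.
elim: s => [|i s IH]; first by rewrite esum_seq_nil// => -[].
rewrite esum_seq_cons//; last by move=> ys; rewrite lee_fin seq_kernel_ge0.
rewrite -(kappa_pmf (f i w)).2; apply: eq_esum => y _ /=.
under eq_esum do rewrite EFinM.
by rewrite esumZl ?IH ?mule1// => ys; rewrite lee_fin seq_kernel_ge0.
Qed.

Lemma seq_entropy_le s a : nneg a -> (seq_entropy s a <= (entropy a)%:E)%E.
Proof.
move=> a0; apply: entropy_kernel_le => // [ys w|w].
  exact: seq_kernel_ge0.
exact: seq_kernel_sum.
Qed.

Lemma seq_entropy_fin s a : nneg a -> seq_entropy s a \is a fin_num.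
Proof.
move=> a0; apply: (@esum_fin_num _ _ _ _ (entropy a)) => [ys|].
  exact: term_ge0.
exact: seq_entropy_le.
Qed.

Lemma kernel_mass s a : nneg a ->
  (\esum_(ys in [set: seq Y]) (\sum_w a w * seq_kernel s ys w)%:E =
   (\sum_w a w)%:E)%E.
Proof.
move=> a0; under eq_esum do rewrite -sumEFin.
rewrite esum_sum; last first.
  by move=> ys w _ _; rewrite lee_fin mulr_ge0// seq_kernel_ge0.
rewrite -sumEFin; apply: eq_bigr => w _.
under eq_esum do rewrite EFinM.
by rewrite esumZl// ?seq_kernel_sum ?mule1// => ys; rewrite lee_fin seq_kernel_ge0.
Qed.

Lemma kappa_mass i a : nneg a ->
  (\esum_(y in [set: Y]) (\sum_w a w * kappa (f i w) y)%:E =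
   (\sum_w a w)%:E)%E.
Proof.
move=> a0; under eq_esum do rewrite -sumEFin.
rewrite esum_sum; last by move=> y w _ _; rewrite lee_fin mulr_ge0.
rewrite -sumEFin; apply: eq_bigr => w _.
under eq_esum do rewrite EFinM.
by rewrite esumZl// ?(kappa_pmf _).2 ?mule1// => y; rewrite lee_fin.
Qed.

Lemma seq_entropy_cat s1 s2 a : nneg a -> seq_entropy (s1 ++ s2) a =
  \esum_(ys in [set: seq Y]) seq_entropy s2 (fun w => a w * seq_kernel s1 ys w).
Proof.
elim: s1 a => [|i s1 IH] a a0 /=.
  rewrite esum_seq_nil => [|ys|y ys].
  - by apply: eq_seq_entropy => w; rewrite mulr1.
  - apply: seq_entropy_ge0 => w; rewrite mulr_ge0//.
    exact: (seq_kernel_ge0 [::]).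
  - rewrite [LHS]esum1// => ys' _.
    by rewrite entropy0// => w; rewrite mulr0 mul0r.
rewrite seq_entropy_cons//.
transitivity (\esum_(y in [set: Y]) \esum_(ys in [set: seq Y])
    seq_entropy s2 (fun w => a w * kappa (f i w) y * seq_kernel s1 ys w)).
  by apply: eq_esum => y _; rewrite IH// => w; rewrite mulr_ge0.
rewrite [RHS]esum_seq_cons.
- apply: eq_esum => y _; apply: eq_esum => ys _.
  by apply: eq_seq_entropy => w; rewrite /= mulrA.
- move=> ys; apply: seq_entropy_ge0 => w; rewrite mulr_ge0//.
  exact: (seq_kernel_ge0 (i :: s1)).
- rewrite [LHS]esum1// => ys' _.
  by rewrite entropy0// => w; rewrite /= mulr0 mul0r.
Qed.

(** The channel is memoryless, so the kernels of the two groups commute and the later outputs may be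
    conditioned on first. *)
Lemma seq_entropy_catC s1 s2 a : nneg a -> seq_entropy (s1 ++ s2) a =
  \esum_(ys in [set: seq Y]) seq_entropy s1 (fun w => a w * seq_kernel s2 ys w).
Proof.
move=> a0; rewrite seq_entropy_cat// esum_swap; last first.
  move=> ys1 ys2; rewrite lee_fin; apply: entropy_ge0 => w.
  by rewrite !mulr_ge0 ?seq_kernel_ge0.
apply: eq_esum => ys _; apply: eq_esum => ys' _; congr EFin.
by apply: eq_entropy => w; rewrite mulrAC.
Qed.

(** Inputs that are constant on the support of [a] make the outputs independent of [w], so that
    observing them teaches nothing. *)
Lemma seq_entropy_const s a : nneg a ->
  (forall i, i \in s -> forall w w', a w != 0 -> a w' != 0 -> f i w = f i w') ->
  seq_entropy s a = (entropy a)%:E.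
Proof.
elim: s a => [|i s IH] a a0 ac; first by rewrite seq_entropy_nil.
rewrite seq_entropy_cons//.
transitivity (\esum_(y in [set: Y]) (entropy (fun w => a w * kappa (f i w) y))%:E).
  apply: eq_esum => y _; apply: IH => [w|]; first by rewrite mulr_ge0.
  move=> j js w w'; rewrite !mulf_eq0 => /norP[aw _] /norP[aw' _].
  by apply: ac; rewrite // inE js orbT.
have [[w0 aw0]|az] := pselect (exists w, a w != 0); last first.
  have a00 w : a w = 0.
    by apply/eqP; apply: contra_notT az => aw; exists w.
  rewrite esum1 ?entropy0// => y _; rewrite entropy0// => w.
  by rewrite a00 mul0r.
have az' y w : a w * kappa (f i w) y = kappa (f i w0) y * a w.
  have [->|aw] := eqVneq (a w) 0; first by rewrite mul0r mulr0.
  by rewrite mulrC (ac i (mem_head _ _) w w0).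
under eq_esum => y _ do rewrite (eq_entropy (az' y)) entropyZ EFinM.
rewrite esumZr ?entropy_ge0// ?(kappa_pmf _).2 ?mul1e// => y.
by rewrite lee_fin.
Qed.

Lemma seq_entropy_const_prefix s1 s2 a : nneg a ->
  (forall i, i \in s1 -> forall w w', a w != 0 -> a w' != 0 -> f i w = f i w') ->
  seq_entropy (s1 ++ s2) a = seq_entropy s2 a.
Proof.
move=> a0 ac; rewrite seq_entropy_catC//; apply: eq_esum => ys _.
rewrite seq_entropy_const//.
  by move=> w; rewrite mulr_ge0// seq_kernel_ge0.
move=> i i1 w w'; rewrite !mulf_eq0 => /norP[aw _] /norP[aw' _].
exact: ac.
Qed.

End Kernel.

End SeqKernel.

Section CapacitySign.
Context {R : realType} {U V Z : countType}.
Variable ch : U -> V * Z -> R.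
Hypothesis hch : forall u, is_pmf (ch u).

(** If there is no input PMF, as for an empty [U], the supremum is over the empty set and equals
    minus infinity, against finiteness. *)
Lemma capacity_ge0 : capacity ch \is a fin_num -> 0 <= fine (capacity ch).
Proof.
move=> hC; rewrite fine_ge0//.
have [[pu hpu]|no_pmf] := pselect (exists pu : U -> R, is_pmf pu).
  set P := fun w : U * (V * Z) => pu w.1 * ch w.1 w.2.
  have hP : is_pmf P.
    split=> [w|]; first by rewrite mulr_ge0 ?hpu.1 ?(hch _).1.
    rewrite esum_pair => [|w]; last by rewrite lee_fin mulr_ge0 ?hpu.1 ?(hch _).1.
    rewrite -hpu.2; apply: eq_esum => u _; rewrite /P /=.
    under eq_esum do rewrite EFinM.
    rewrite esumZl ?hpu.1// ?channel_sum ?mule1// => y.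
    by rewrite lee_fin (hch _).1.
  apply: le_trans (mutual_info_ge0 hP (fun w => w.1) (fun w => w.2.1)) _.
  by apply: ereal_sup_ubound; exists pu.
move: hC; rewrite /capacity; set A := (X in ereal_sup X).
suff -> : A = set0 by rewrite ereal_sup0.
by rewrite -subset0 => x [pu hpu _]; apply: no_pmf; exists pu.
Qed.

Lemma secrecy_capacity_ge0 : secrecy_capacity ch \is a fin_num ->
  0 <= fine (secrecy_capacity ch).
Proof.
move=> hC; rewrite fine_ge0//.
have [[u0 _]|noU] := pselect (exists u : U, True).
  (* A one-point auxiliary variable makes both informations 0. *)
  pose b (_ : 'I_1) : R := 1.
  have b0 : nneg b by move=> ?; rewrite ler01.
  have b1 : \sum_w b w = 1 by rewrite big_ord1.
  have ent1 (a : 'I_1 -> R) : entropy a = 0.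
    rewrite /entropy !big_ord1; have [->|a0] := eqVneq (a ord0) 0.
      by rewrite mul0r.
    by rewrite divff// log2_1 mulr0.
  apply: ereal_sup_ubound; exists 'I_1, (det_input (fun=> u0) b).
  split; first exact: det_input_pmf.
  rewrite (minfo_det_input hch (fun=> u0) fst)// (minfo_det_input hch (fun=> u0) snd)//.
  by rewrite !esum1 ?ent1 ?sube0// => y _; rewrite ent1.
move: hC; rewrite /secrecy_capacity; set A := (X in ereal_sup X).
suff -> : A = set0 by rewrite ereal_sup0.
rewrite -subset0 => x [W [pwu [[_ hpwu] _]]].
move: hpwu; rewrite esum1 => [|[w u] _]; last by case: noU; exists u.
by move/eqP; rewrite eqe eq_sym oner_eq0.
Qed.

End CapacitySign.

(** * Adding and exchanging outputs over several uses *)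

Section CodingBounds.
Context {R : realType} {U V Z : countType} {W : finType} {I : eqType}.
Variable ch : U -> V * Z -> R.
Hypothesis hch : forall u, is_pmf (ch u).
Hypothesis hC : capacity ch \is a fin_num.
Hypothesis hS : secrecy_capacity ch \is a fin_num.
Variable f : I -> W -> U.

Let C := fine (capacity ch).
Let S := fine (secrecy_capacity ch).
Let C0 : 0 <= C := capacity_ge0 hch hC.
Let S0 : 0 <= S := secrecy_capacity_ge0 hch hS.

Definition kV (u : U) (v : V) : R := law (ch u) fst v.
Definition kZ (u : U) (z : Z) : R := law (ch u) snd z.

Lemma kV_pmf u : is_pmf (kV u). Proof. exact: law_pmf. Qed.
Lemma kZ_pmf u : is_pmf (kZ u). Proof. exact: law_pmf. Qed.

Let kV0 u y : 0 <= kV u y. Proof. exact: (kV_pmf u).1. Qed.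
Let kZ0 u y : 0 <= kZ u y. Proof. exact: (kZ_pmf u).1. Qed.

Let mass0 (a : W -> R) (k : nat) (c : R) : nneg a -> 0 <= c ->
  0 <= k%:R * (\sum_w a w) * c.
Proof. by move=> a0 c0; rewrite !mulr_ge0// sumr_ge0. Qed.

Lemma seq_entropy_capacity0 s (a : W -> R) : nneg a ->
  ((entropy a)%:E <= seq_entropy f kV s a + ((size s)%:R * (\sum_w a w) * C)%:E)%E.
Proof.
elim: s a => [|i s IH] a a0.
  by rewrite (seq_entropy_nil f kV_pmf)//= !mul0r adde0.
apply: (le_trans (capacity_use hch (f i) hC a0)).
rewrite seq_entropy_cons//=; last exact: kV_pmf.
rewrite -[(size s).+1]addn1 natrD !mulrDl mul1r EFinD addeA; apply: leeD2r.
have -> : ((size s)%:R * (\sum_w a w) * C)%:E = \esum_(v in [set: V])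
    ((size s)%:R * (\sum_w a w * kV (f i w) v) * C)%:E.
  rewrite mulrAC EFinM -(kappa_mass f kV_pmf i a0) -esumZl ?mulr_ge0//; last first.
    by move=> v; rewrite lee_fin sumr_ge0// => w _; rewrite mulr_ge0.
  by apply: eq_esum => v _; rewrite -EFinM mulrAC.
rewrite -esumD => [||v _]; last first.
- by rewrite lee_fin mass0// => w; rewrite mulr_ge0.
- move=> v _; apply: (seq_entropy_ge0 f kV_pmf) => w.
  by rewrite mulr_ge0.
apply: le_esum => v _.
exact: (IH _ (fun w => mulr_ge0 (a0 w) (kV0 (f i w) v))).
Qed.

Lemma seq_entropy_capacity s1 s2 (a : W -> R) : nneg a ->
  (seq_entropy f kV s1 a <=
   seq_entropy f kV (s1 ++ s2) a + ((size s2)%:R * (\sum_w a w) * C)%:E)%E.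
Proof.
move=> a0; rewrite seq_entropy_cat//; last exact: kV_pmf.
have n0 ys w : 0 <= a w * seq_kernel f kV s1 ys w.
  by rewrite mulr_ge0// seq_kernel_ge0//; exact: kV_pmf.
have -> : ((size s2)%:R * (\sum_w a w) * C)%:E = \esum_(ys in [set: seq V])
    ((size s2)%:R * (\sum_w a w * seq_kernel f kV s1 ys w) * C)%:E.
  rewrite mulrAC EFinM -(kernel_mass f kV_pmf s1 a0) -esumZl ?mulr_ge0//; last first.
    by move=> v; rewrite lee_fin sumr_ge0.
  by apply: eq_esum => v _; rewrite -EFinM mulrAC.
rewrite -esumD => [||v _]; last first.
- by rewrite lee_fin mass0.
- by move=> v _; apply: seq_entropy_ge0 => //; exact: kV_pmf.
by apply: le_esum => v _; apply: seq_entropy_capacity0.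
Qed.

Lemma seq_entropy_secrecy s (a : W -> R) : nneg a ->
  (seq_entropy f kZ s a <=
   seq_entropy f kV s a + ((size s)%:R * (\sum_w a w) * S)%:E)%E.
Proof.
elim: s a => [|i s IH] a a0.
  by rewrite !seq_entropy_nil// ?mul0r ?adde0//; [exact: kV_pmf|exact: kZ_pmf].
have aZ0 z w : 0 <= a w * kZ (f i w) z by rewrite mulr_ge0.
have aV0 ys w : 0 <= a w * seq_kernel f kV s ys w.
  by rewrite mulr_ge0// seq_kernel_ge0//; exact: kV_pmf.
rewrite seq_entropy_cons//; last exact: kZ_pmf.
have H1 : (\esum_(z in [set: Z]) seq_entropy f kZ s (fun w => (a w * kZ (f i w) z)%R) <=
    \esum_(z in [set: Z]) seq_entropy f kV s (fun w => (a w * kZ (f i w) z)%R) +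
    ((size s)%:R * (\sum_w a w) * S)%:E)%E.
  have -> : ((size s)%:R * (\sum_w a w) * S)%:E = \esum_(z in [set: Z])
      ((size s)%:R * (\sum_w a w * kZ (f i w) z) * S)%:E.
    rewrite mulrAC EFinM -(kappa_mass f kZ_pmf i a0) -esumZl ?mulr_ge0//; last first.
      by move=> v; rewrite lee_fin sumr_ge0.
    by apply: eq_esum => v _; rewrite -EFinM mulrAC.
  rewrite -esumD => [||v _]; last first.
  - by rewrite lee_fin mass0.
  - by move=> v _; apply: seq_entropy_ge0 => //; exact: kV_pmf.
  by apply: le_esum => z _; apply: IH.
apply: (le_trans H1).
rewrite /= -[(size s).+1]addn1 natrD !mulrDl mul1r EFinD addeCA addeC.
apply: leeD2r.
(* The later outputs are V's by now. Reversing the order of summation makes them the condition under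
   which the first Z is exchanged for a V. *)
rewrite /seq_entropy esum_swap; last first.
  move=> z ys; rewrite lee_fin; apply: entropy_ge0 => w.
  by rewrite mulr_ge0// seq_kernel_ge0//; exact: kV_pmf.
rewrite -[X in (_ <= X + _)%E]/(seq_entropy f kV (i :: s) a) -(cat1s i s).
rewrite seq_entropy_catC//; last exact: kV_pmf.
have -> : ((\sum_w a w) * S)%:E = \esum_(ys in [set: seq V])
    ((\sum_w a w * seq_kernel f kV s ys w) * S)%:E.
  rewrite EFinM -(kernel_mass f kV_pmf s a0) -esumZr//.
  by move=> v; rewrite lee_fin sumr_ge0.
rewrite -esumD => [||v _]; last first.
- by rewrite lee_fin mulr_ge0// sumr_ge0.
- by move=> v _; apply: seq_entropy_ge0 => //; exact: kV_pmf.
apply: le_esum => ys _.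
rewrite (seq_entropy1 f kV_pmf)//; apply: le_trans (secrecy_use hch (f i) hS (aV0 ys)).
apply: le_esum => z _; rewrite lee_fin le_eqVlt; apply/orP; left; apply/eqP.
by apply: eq_entropy => w; rewrite mulrAC.
Qed.

End CodingBounds.

Section CondSeqEntropy.
Context {R : realType} {U : Type} {W : finType} {I : eqType} {Y : choiceType}.
Variables (f : I -> W -> U) (kappa : U -> Y -> R).
Hypothesis kappa_pmf : forall u, is_pmf (kappa u).

Definition cond_seq_entropy (E : finType) (F : W -> E) (s : seq I) (a : W -> R) : R :=
  \sum_e fine (seq_entropy f kappa s (restr F a e)).

Let n0 (a : W -> R) s ys w : nneg a -> 0 <= a w * seq_kernel f kappa s ys w.
Proof. by move=> a0; rewrite mulr_ge0// seq_kernel_ge0. Qed.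

Lemma cond_seq_entropyE (E : finType) (F : W -> E) s (a : W -> R) : nneg a ->
  (\esum_(ys in [set: seq Y])
     (cond_entropy F (fun w => a w * seq_kernel f kappa s ys w))%:E =
   (cond_seq_entropy F s a)%:E)%E.
Proof.
move=> a0; under eq_esum do rewrite /cond_entropy -sumEFin.
rewrite esum_sum; last first.
  by move=> ys e _ _; rewrite lee_fin entropy_ge0// => w; apply: nneg_restr => ?; apply: n0.
rewrite /cond_seq_entropy -sumEFin; apply: eq_bigr => e _.
rewrite fineK; last by apply: seq_entropy_fin => // w; exact: nneg_restr.
apply: eq_esum => ys _; congr EFin; apply: eq_entropy => w.
by rewrite /restr; case: ifP; rewrite ?mul0r.
Qed.

Lemma sum_restr (E : finType) (F : W -> E) (a : W -> R) :
  \sum_e \sum_w restr F a e w = \sum_w a w.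
Proof.
rewrite exchange_big/=; apply: eq_bigr => w _.
rewrite (bigD1 (F w))//= /restr eqxx big1 ?addr0// => e.
by rewrite eq_sym => /negPf ->.
Qed.

Lemma seq_entropy_restr_prefix (E : finType) (F : W -> E) s1 s2 (a : W -> R) e :
  nneg a -> (forall i, i \in s1 -> forall w w', F w = F w' -> f i w = f i w') ->
  seq_entropy f kappa (s1 ++ s2) (restr F a e) =
  seq_entropy f kappa s2 (restr F a e).
Proof.
move=> a0 Fm; apply: seq_entropy_const_prefix => // [w|i i1 w w'].
  exact: nneg_restr.
rewrite /restr; case: ifP => [/eqP we _|]; last by rewrite eqxx.
case: ifP => [/eqP we' _|]; last by rewrite eqxx.
by apply: Fm => //; rewrite we we'.
Qed.

Lemma entropy_push_kernel_le (E : finType) (F : W -> E) s (a : W -> R) : nneg a ->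
  (\esum_(ys in [set: seq Y])
     (entropy (push F (fun w => a w * seq_kernel f kappa s ys w)))%:E <=
   (entropy (push F a))%:E)%E.
Proof.
move=> a0; apply: entropy_superadd => [ys e|e].
  by apply: sumr_ge0 => w _; apply: n0.
under eq_esum do rewrite /push -sumEFin.
rewrite esum_sum; last by move=> ys w _ _; rewrite lee_fin n0.
rewrite -sumEFin; apply: eq_bigr => w _.
under eq_esum do rewrite EFinM.
rewrite esumZl// ?seq_kernel_sum ?mule1// => ys.
by rewrite lee_fin seq_kernel_ge0.
Qed.

(* Conditioning on [F], of which the inputs in [s] need not be functions,
   decreases the information that the outputs give about the source; and that
   information all goes through [J]. *)
Lemma cond_entropy_leak (E EJ : finType) (F : W -> E) (J : W -> EJ) s
    (a : W -> R) (l : R) : nneg a ->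
  (forall i, i \in s -> forall w w', J w = J w' -> f i w = f i w') ->
  ((entropy (push J a))%:E - \esum_(ys in [set: seq Y])
     (entropy (push J (fun w => a w * seq_kernel f kappa s ys w)))%:E <= l%:E)%E ->
  cond_entropy F a <= cond_seq_entropy F s a + l.
Proof.
move=> a0 Jm leak.
have split_cond (E' : finType) (F' : W -> E') : seq_entropy f kappa s a =
    (\esum_(ys in [set: seq Y])
      (entropy (push F' (fun w => a w * seq_kernel f kappa s ys w)))%:E +
     (cond_seq_entropy F' s a)%:E)%E.
  rewrite -cond_seq_entropyE// -esumD => [|ys _|ys _].
  - apply: eq_esum => ys _; rewrite -EFinD -entropy_cond// => w; exact: n0.
  - by rewrite lee_fin entropy_ge0// => e; apply: nneg_push => w; exact: n0.
  - by rewrite lee_fin cond_entropy_ge0// => w; exact: n0.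
have push_fin (E' : finType) (F' : W -> E') : \esum_(ys in [set: seq Y])
    (entropy (push F' (fun w => a w * seq_kernel f kappa s ys w)))%:E \is a fin_num.
  apply: (@esum_fin_num _ _ _ _ (entropy (push F' a))) => [ys|].
    by rewrite lee_fin entropy_ge0// => e; apply: nneg_push => w; exact: n0.
  exact: entropy_push_kernel_le.
(* Given [J] the inputs in [s] are fixed, so the outputs say nothing more about the source. *)
have condJ : cond_seq_entropy J s a = cond_entropy J a.
  apply: eq_bigr => e _; rewrite -[s]cats0 seq_entropy_restr_prefix//.
  by rewrite seq_entropy_nil// => w; exact: nneg_restr.
(* Both expansions equal H(W | Y). Hence I(F;Y) + I(W;Y | F) = I(J;Y), which is at most [l], and
   I(F;Y) is nonnegative. *)
have := split_cond _ F; rewrite (split_cond _ J).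
move: leak (entropy_push_kernel_le F s a0).
rewrite -(fineK (push_fin _ F)) -(fineK (push_fin _ J)) -!EFinD.
move=> + + [].
rewrite !lee_fin condJ.
by have := entropy_cond F a0; rewrite (entropy_cond J a0); lra.
Qed.

End CondSeqEntropy.

Section CodingBounds.
Context {R : realType} {U V Z : countType} {W : finType} {I : eqType}.
Variable ch : U -> V * Z -> R.
Hypothesis hch : forall u, is_pmf (ch u).
Hypothesis hC : capacity ch \is a fin_num.
Variables (f : I -> W -> U) (E : finType) (F : W -> E) (a : W -> R).
Hypotheses (a0 : nneg a) (a1 : \sum_w a w = 1).

Let C := fine (capacity ch).
Let S := fine (secrecy_capacity ch).
Let kVp := kV_pmf hch.
Let kZp := kZ_pmf hch.

Let r0 e w : 0 <= restr F a e w. Proof. exact: nneg_restr. Qed.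

Let massE (k c : R) : k * c = \sum_e k * (\sum_w restr F a e w) * c.
Proof. by rewrite -mulr_suml -mulr_sumr sum_restr a1 mulr1. Qed.

Lemma cond_entropy_capacity (s1 s2 : seq I) :
  (forall i, i \in s1 -> forall w w', F w = F w' -> f i w = f i w') ->
  cond_entropy F a <=
  cond_seq_entropy f (kV ch) F (s1 ++ s2) a + (size s2)%:R * C.
Proof.
move=> Fm; rewrite massE.
rewrite /cond_entropy /cond_seq_entropy -big_split/=; apply: ler_sum => e _.
rewrite seq_entropy_restr_prefix// -lee_fin EFinD fineK ?seq_entropy_fin//.
apply: (seq_entropy_capacity0 hch hC f s2 (r0 e)).
Qed.

Hypothesis hS : secrecy_capacity ch \is a fin_num.

(** The Z's on [s1 ++ s2] are worth at most [l]. Given [F], those of [s1] are void and may be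
    replaced by V's for free; those of [s2] become V's at the price [S] each; the V's of [s3] are
    added at the price [C] each. *)
Lemma cond_entropy_secrecy (EJ : finType) (J : W -> EJ) (s1 s2 s3 : seq I) (l : R) :
  (forall i, i \in s1 -> forall w w', F w = F w' -> f i w = f i w') ->
  (forall i, i \in s1 ++ s2 -> forall w w', J w = J w' -> f i w = f i w') ->
  ((entropy (push J a))%:E - \esum_(zs in [set: seq Z])
     (entropy (push J (fun w => a w * seq_kernel f (kZ ch) (s1 ++ s2) zs w)))%:E
   <= l%:E)%E ->
  cond_entropy F a <=
  cond_seq_entropy f (kV ch) F (s1 ++ s2 ++ s3) a + (size s3)%:R * C +
  (size s2)%:R * S + l.
Proof.
move=> Fm Jm leak.
apply: (le_trans (cond_entropy_leak kZp F a0 Jm leak)); rewrite lerD2r.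
rewrite [_ * C]massE [_ * S]massE /cond_seq_entropy -!big_split/=.
apply: ler_sum => e _.
rewrite (seq_entropy_restr_prefix kVp (s2 ++ s3) e a0 Fm).
rewrite (seq_entropy_restr_prefix kZp s2 e a0 Fm).
have := seq_entropy_secrecy hch hS f s2 (r0 e).
have := seq_entropy_capacity hch hC f s2 s3 (r0 e).
rewrite -(fineK (seq_entropy_fin f kVp s2 (r0 e))).
rewrite -(fineK (seq_entropy_fin f kVp (s2 ++ s3) (r0 e))).
rewrite -(fineK (seq_entropy_fin f kZp s2 (r0 e))).
by rewrite -!EFinD !lee_fin /C /S /=; lra.
Qed.

End CodingBounds.

(** * Rate-distortion *)

Section Hellinger.
Context {R : realType}.

(* With s = sqrt (P / Q), [P ln (P / Q) - P + Q >= Q (1 - s)^2] and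
   [Q - P = Q (1 - s) (1 + s)]. *)
Lemma relative_entropy_gap (P Q e : R) : 0 <= P -> 0 < Q -> 0 < e ->
  0 <= P * ln (P / Q) - P + Q /\
  Q - P <= 2 / e * (P * ln (P / Q) - P + Q) + 2 * e * Q.
Proof.
rewrite le_eqVlt => /predU1P[<-|P0] Q0 e0.
  rewrite !mul0r !subr0 !add0r; split; first exact: ltW.
  rewrite -mulrDl ler_peMl ?(ltW Q0)//.
  have : 0 <= (e - 1) ^+ 2 / e by rewrite divr_ge0 ?sqr_ge0// ltW.
  have -> : (e - 1) ^+ 2 / e = e - 2 + e^-1 by field; rewrite gt_eqF.
  have : 0 < e^-1 by rewrite invr_gt0.
  by lra.
pose s := Num.sqrt (P / Q).
have PQ0 : 0 < P / Q by rewrite divr_gt0.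
have s0 : 0 < s by rewrite sqrtr_gt0.
have sE : s ^+ 2 = P / Q by rewrite sqr_sqrtr// ltW.
have PE : P = Q * s ^+ 2 by rewrite sE mulrC divfK ?gt_eqF.
have ls : 1 - s^-1 <= ln s.
  have := @le_ln1Dx R (s^-1 - 1).
  have -> : 1 + (s^-1 - 1) = s^-1 by ring.
  have si0 : 0 < s^-1 by rewrite invr_gt0.
  by rewrite lnV ?posrE// => H; have : - ln s <= s^-1 - 1; [apply: H; lra|lra].
have key : Q * (1 - s) ^+ 2 <= P * ln (P / Q) - P + Q.
  rewrite -sE lnXn// PE.
  have : Q * s ^+ 2 * (1 - s^-1) <= Q * s ^+ 2 * ln s.
    by rewrite ler_wpM2l// mulr_ge0 ?sqr_ge0// ltW.
  have -> : Q * s ^+ 2 * (1 - s^-1) = Q * (s ^+ 2 - s) by field; rewrite gt_eqF.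
  have -> : Q * s ^+ 2 * (ln s *+ 2) = (Q * s ^+ 2 * ln s) * 2.
    by rewrite mulr2n; ring.
  by move: (Q * s ^+ 2 * ln s) => t; nra.
split; first by rewrite (le_trans _ key)// mulr_ge0 ?sqr_ge0// ltW.
have e2 : 0 < 2 / e by rewrite divr_gt0.
apply: (@le_trans _ _ (2 / e * (Q * (1 - s) ^+ 2) + 2 * e * Q)); last first.
  by rewrite lerD2r ler_wpM2l// ltW.
have -> : 2 / e * (Q * (1 - s) ^+ 2) + 2 * e * Q =
    Q * (2 * ((1 - s) ^+ 2 / e + e)) by ring.
rewrite {1}PE (_ : Q - _ = Q * (1 - s ^+ 2)); last by ring.
rewrite ler_wpM2l ?(ltW Q0)//.
(* AM-GM with weight [e]: the resulting bound is linear in the divergence and in [Q], so that it can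
   be summed over letters. *)
have : 0 <= ((1 - s) - e) ^+ 2 / e by rewrite divr_ge0 ?sqr_ge0// ltW.
have -> : ((1 - s) - e) ^+ 2 / e = (1 - s) ^+ 2 / e + e - 2 * (1 - s).
  by field; rewrite gt_eqF.
have : 0 <= (1 - s) ^+ 2 / e by rewrite divr_ge0 ?sqr_ge0// ltW.
by have := sqr_ge0 (1 - s); move: (_ / e) => t; nra.
Qed.

End Hellinger.

Section RateDistortion.
Context {R : realType} (X : finType) (Xhat : choiceType).
Variables (p : X -> R) (d : X -> Xhat -> \bar R).
Hypothesis hp : is_pmf p.
Hypothesis hd : forall x xhat, (0 <= d x xhat)%E.

Let p0 x : 0 <= p x. Proof. exact: hp.1. Qed.

Lemma pmf_fin_sum : \sum_x p x = 1.
Proof. by apply: EFin_inj; rewrite -sumEFin -esum_fin ?hp.2. Qed.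

(* A coupling is the joint law of a source letter and its reconstruction. *)
Definition coupling (J : Xhat -> X -> R) : Prop :=
  (forall y x, 0 <= J y x) /\
  forall x, (\esum_(y in [set: Xhat]) (J y x)%:E = (p x)%:E)%E.

Definition coupling_cost (J : Xhat -> X -> R) : \bar R :=
  (\esum_(y in [set: Xhat]) \sum_x (J y x)%:E * d x y)%E.

Definition coupling_info (J : Xhat -> X -> R) : \bar R :=
  ((entropy p)%:E - \esum_(y in [set: Xhat]) (entropy (J y))%:E)%E.

Section TestChannel.
Variable q : X -> Xhat -> R.
Hypothesis hq : forall x, is_pmf (q x).

Let P := test_channel_law p q.

Let P0 w : 0 <= P w. Proof. by rewrite mulr_ge0 ?(hq _).1. Qed.

Lemma test_channel_pmf : is_pmf P.
Proof.
split=> //; rewrite esum_pair// -hp.2; apply: eq_esum => x _.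
rewrite /P /test_channel_law /=; under eq_esum do rewrite EFinM.
by rewrite esumZl// ?(hq _).2 ?mule1// => y; rewrite lee_fin (hq _).1.
Qed.

Lemma test_channel_coupling : coupling (fun y x => P (x, y)).
Proof.
split=> [y x|x]; first exact: P0.
rewrite /P /test_channel_law /=; under eq_esum do rewrite EFinM.
by rewrite esumZl// ?(hq _).2 ?mule1// => y; rewrite lee_fin (hq _).1.
Qed.

Lemma test_channel_cost :
  expectation_pmf P (fun w => d w.1 w.2) = coupling_cost (fun y x => P (x, y)).
Proof.
have n0 w : (0 <= (P w)%:E * d w.1 w.2)%E by rewrite mule_ge0 ?lee_fin.
rewrite /expectation_pmf esum_pair// esum_swap; last by move=> x y; exact: n0.
by apply: eq_esum => y _; rewrite esum_fin// => x; exact: n0.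
Qed.

Lemma test_channel_info :
  mutual_info P fst snd = coupling_info (fun y x => P (x, y)).
Proof.
have hP := test_channel_pmf.
have lP x y : law P (fun w => (w.1, w.2)) (x, y) = P (x, y).
  apply: EFin_inj; rewrite (lawE hP) (_ : _ @^-1` _ = [set (x, y)]) ?esum_set1 ?lee_fin//.
  by apply/seteqP; split=> -[a b] /= [-> ->].
rewrite (mutual_info_fin hP); congr (_ - _)%E.
  congr EFin; apply: eq_entropy => x; apply: EFin_inj.
  rewrite -(law_marginl hP fst snd) -(test_channel_coupling).2.
  by apply: eq_esum => y _; rewrite lP.
apply: eq_esum => y _; congr EFin; apply: eq_entropy => x; exact: lP.
Qed.

End TestChannel.

Lemma coupling_channel J : coupling J -> exists q : X -> Xhat -> R,
  (forall x, is_pmf (q x)) /\ (fun y x => test_channel_law p q (x, y)) = J.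
Proof.
move=> [J0 J1].
have Jsum : (\esum_(y in [set: Xhat]) (\sum_x J y x)%:E = 1)%E.
  under eq_esum do rewrite -sumEFin.
  rewrite esum_sum; last by move=> y x _ _; rewrite lee_fin.
  by under eq_bigr do rewrite J1; rewrite sumEFin pmf_fin_sum.
(* Where [p x = 0] the conditional law is arbitrary; the marginal law of the reconstruction is a PMF
   at hand. *)
exists (fun x y => if p x == 0 then \sum_x J y x else J y x / p x); split.
  move=> x; case: eqVneq => [_|px]; split=> //.
  - by move=> y; rewrite sumr_ge0.
  - by move=> y; rewrite divr_ge0.
  - under eq_esum do rewrite EFinM.
    rewrite esumZr ?invr_ge0//; last by move=> y; rewrite lee_fin.
    by rewrite J1 -EFinM divff.
apply/funext => y; apply/funext => x; rewrite /test_channel_law /=.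
case: eqVneq => [px|px]; last by rewrite mulrC divfK.
rewrite px mul0r; apply/eqP; rewrite eq_le J0/= -lee_fin -px -J1.
by apply: (esum_term_le (f := fun y => (J y x)%:E)) => y'; rewrite lee_fin.
Qed.

Lemma coupling_info_ge0 J : coupling J -> (0 <= coupling_info J)%E.
Proof.
move=> /coupling_channel[q [hq <-]]; rewrite -test_channel_info//.
exact: (mutual_info_ge0 (test_channel_pmf hq)).
Qed.

Lemma coupling_cost_ge0 J : coupling J -> (0 <= coupling_cost J)%E.
Proof.
move=> [J0 _]; apply: esum_ge0 => y _; apply: sume_ge0 => x _.
by rewrite mule_ge0 ?lee_fin.
Qed.

Lemma distortion_rate_le J (r : R) : coupling J ->
  (coupling_info J <= r%:E)%E -> (distortion_rate p d r <= coupling_cost J)%E.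
Proof.
move=> hJ; have := coupling_cost_ge0 hJ.
have [q [hq <-]] := coupling_channel hJ.
rewrite -test_channel_info// -test_channel_cost//.
case E : (expectation_pmf _ _) => [e| |]//= _ Ir; last by rewrite leey.
apply: ereal_inf_lbound; exists e => //=.
apply: le_trans Ir; apply: ereal_inf_lbound; exists q; split=> //.
by rewrite E.
Qed.

(** [distortion_rate] and [rate_distortion] are both infima that need not be attained: the first is
    unfolded at the strict inequality below [D], the second costs the extra rate [e]. *)
Lemma distortion_rate_lt (r e D : R) : 0 < e -> (distortion_rate p d r < D%:E)%E ->
  exists J, [/\ coupling J, (coupling_cost J <= D%:E)%E &
                (coupling_info J <= (r + e)%:E)%E].
Proof.
move=> e0 /ereal_inf_lt[_ [D' /= rD' <-]]; rewrite lte_fin => D'D.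
have : (rate_distortion p d D' < (r + e)%:E)%E.
  by rewrite (le_lt_trans rD')// lte_fin ltrDl.
move=> /ereal_inf_lt[_ [q [hq cq ->]] Iq].
exists (fun y x => test_channel_law p q (x, y)); split.
- exact: test_channel_coupling.
- by rewrite -test_channel_cost// (le_trans cq)// lee_fin ltW.
- by rewrite -test_channel_info// ltW.
Qed.

Lemma distortion_rate_ge0 (r : R) : (0 <= distortion_rate p d r)%E.
Proof.
rewrite leNgt; apply/negP => D0.
have [J [hJ cJ _]] : exists J, [/\ coupling J, (coupling_cost J <= 0%:E)%E &
    (coupling_info J <= (r + 1)%:E)%E] by apply: distortion_rate_lt.
have : (distortion_rate p d r < 0%:E)%E by [].
move=> /ereal_inf_lt[_ [D' /= rD' <-]]; rewrite lte_fin => D'0.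
have : (rate_distortion p d D' < (r + 1)%:E)%E.
  by rewrite (le_lt_trans rD')// lte_fin ltrDl.
move=> /ereal_inf_lt[_ [q [hq cq ->]] Iq].
have := coupling_cost_ge0 (test_channel_coupling hq).
rewrite -test_channel_cost// => /le_trans/(_ cq).
by rewrite lee_fin leNgt D'0.
Qed.

Lemma distortion_rate_antitone (r r' : R) : r <= r' ->
  (distortion_rate p d r' <= distortion_rate p d r)%E.
Proof.
move=> rr'; apply: ereal_inf_le_tmp => _ [D /= rD <-]; exists D => //=.
by rewrite (le_trans rD)// lee_fin.
Qed.

Section Bounded.
Variable M : R.
Hypothesis hM : forall r, 0 <= r -> (distortion_rate p d r <= M%:E)%E.

Definition drate (r : R) : R := fine (distortion_rate p d r).

Lemma drateE (r : R) : 0 <= r -> (drate r)%:E = distortion_rate p d r.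
Proof.
move=> r0; rewrite fineK// ge0_fin_numE ?distortion_rate_ge0//.
by rewrite (le_lt_trans (hM r0))// ltry.
Qed.

Lemma drate_ge0 r : 0 <= drate r.
Proof. by rewrite fine_ge0// distortion_rate_ge0. Qed.

Lemma drate_le r : 0 <= r -> drate r <= M.
Proof. by move=> r0; rewrite -lee_fin drateE// hM. Qed.

Lemma drate_antitone r r' : 0 <= r -> r <= r' -> drate r' <= drate r.
Proof.
move=> r0 rr'; rewrite -lee_fin !drateE ?(le_trans r0)//.
exact: distortion_rate_antitone.
Qed.

Lemma drate_near (r e : R) : 0 <= r -> 0 < e ->
  exists J, [/\ coupling J, (coupling_cost J <= (drate r + e)%:E)%E &
                (coupling_info J <= (r + e)%:E)%E].
Proof.
move=> r0 e0; apply: distortion_rate_lt => //.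
by rewrite -drateE// lte_fin ltrDl.
Qed.

Lemma coupling_info_fin J : coupling J ->
  \esum_(y in [set: Xhat]) (entropy (J y))%:E \is a fin_num.
Proof.
move=> [J0 J1]; apply: (@esum_fin_num _ _ _ _ (entropy p)) => [y|].
  by rewrite lee_fin entropy_ge0.
exact: entropy_superadd.
Qed.

(** Excess rate alone is absorbed without any continuity, because [rate_distortion] at the fixed
    distortion [D] is an infimum. *)
Lemma drate_le_lim (r D : R) : 0 <= r ->
  (forall e, 0 < e -> exists J, [/\ coupling J, (coupling_cost J <= D%:E)%E &
    (coupling_info J <= (r + e)%:E)%E]) -> drate r <= D.
Proof.
move=> r0 H; rewrite -lee_fin drateE//; apply: ereal_inf_lbound; exists D => //=.
apply/lee_addgt0Pr => e e0; have [J [hJ cJ iJ]] := H e e0.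
rewrite -EFinD; apply: le_trans iJ; have [q [hq Jq]] := coupling_channel hJ.
apply: ereal_inf_lbound; exists q; split=> //.
- by rewrite test_channel_cost// Jq.
- by rewrite test_channel_info// Jq.
Qed.

Lemma coupling_mid J1 J2 : coupling J1 -> coupling J2 ->
  let J := fun y x => (J1 y x + J2 y x) / 2 in
  [/\ coupling J,
   coupling_cost J = (2^-1%:E * (coupling_cost J1 + coupling_cost J2))%E &
   (coupling_info J <= 2^-1%:E * (coupling_info J1 + coupling_info J2))%E].
Proof.
move=> [J10 J11] [J20 J21] J; have i2 : 0 <= 2^-1 :> R by rewrite invr_ge0.
have hJ : coupling J.
  split=> [y x|x]; first by rewrite mulr_ge0// addr_ge0.
  rewrite /J; under eq_esum do rewrite EFinM EFinD.
  rewrite esumZr//; last by move=> y; rewrite adde_ge0// lee_fin.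
  rewrite esumD; try by move=> y _; rewrite lee_fin.
  by rewrite J11 J21 -EFinD -EFinM; congr EFin; lra.
have n0 K y : (forall y x, 0 <= K y x) -> (0 <= \sum_x (K y x)%:E * d x y)%E.
  by move=> K0; apply: sume_ge0 => x _; rewrite mule_ge0// lee_fin.
split=> //.
  rewrite /coupling_cost -esumD; try by move=> y _; exact: n0.
  rewrite -esumZl//; last by move=> y; rewrite adde_ge0// n0.
  apply: eq_esum => y _; rewrite -big_split/= ge0_sume_distrr.
    apply: eq_bigr => x _; rewrite /J mulrC EFinM EFinD -muleA ge0_muleDl//;
      by rewrite lee_fin.
  by move=> x _; rewrite adde_ge0// mule_ge0// lee_fin.
have f1 := coupling_info_fin (conj J10 J11).
have f2 := coupling_info_fin (conj J20 J21).
have f := coupling_info_fin hJ.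
rewrite /coupling_info.
have : (2^-1%:E * (\esum_(y in [set: Xhat]) (entropy (J1 y))%:E +
    \esum_(y in [set: Xhat]) (entropy (J2 y))%:E) <=
    \esum_(y in [set: Xhat]) (entropy (J y))%:E)%E.
  rewrite -esumD; try by move=> y _; rewrite lee_fin entropy_ge0.
  rewrite -esumZl//; last by move=> y; rewrite adde_ge0// lee_fin entropy_ge0.
  apply: le_esum => y _.
  rewrite -EFinD -EFinM lee_fin mulrDr -!entropyZ.
  (* The two halves of [J y], indexed by [bool] for [entropy_superadd]: concavity of conditional
     entropy is convexity of the information. *)
  pose a (b : bool) x := if b then 2^-1 * J1 y x else 2^-1 * J2 y x.
  have a0 b x : 0 <= a b x by rewrite /a; case: b; rewrite mulr_ge0.
  have := @entropy_superadd R X bool setT a (J y) a0.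
  rewrite esum_fin => [|b]; last by rewrite lee_fin entropy_ge0.
  rewrite sumEFin big_bool lee_fin; apply => x.
  rewrite esum_fin => [|b]; last by rewrite lee_fin.
  by rewrite sumEFin big_bool /a /J /=; congr EFin; ring.
rewrite -(fineK f1) -(fineK f2) -(fineK f) -!EFinD -!EFinM !lee_fin /=.
by lra.
Qed.

(** Obtained by averaging two nearly optimal couplings. The midpoint form is the one that second
    differences on an equidistant grid call for. *)
Lemma drate_midpoint r1 r2 : 0 <= r1 -> 0 <= r2 ->
  2 * drate ((r1 + r2) / 2) <= drate r1 + drate r2.
Proof.
move=> r10 r20; have r0 : 0 <= (r1 + r2) / 2 by rewrite divr_ge0 ?addr_ge0.
suff H e : 0 < e -> drate ((r1 + r2) / 2) <= (drate r1 + drate r2) / 2 + e.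
  have : drate ((r1 + r2) / 2) <= (drate r1 + drate r2) / 2.
    by apply/ler_addgt0Pr => e; exact: H.
  by lra.
move=> e0; apply: drate_le_lim => // e' e'0.
have near r : 0 <= r -> exists J, [/\ coupling J,
    (coupling_cost J <= (drate r + e)%:E)%E & (coupling_info J <= (r + e')%:E)%E].
  by move=> rr; apply: distortion_rate_lt => //; rewrite -drateE// lte_fin ltrDl.
have [J1 [hJ1 c1 i1]] := near _ r10.
have [J2 [hJ2 c2 i2]] := near _ r20.
have [hJ cJ iJ] := coupling_mid hJ1 hJ2.
have h2 : (0 <= 2^-1%:E :> \bar R)%E by rewrite lee_fin invr_ge0.
exists (fun y x => (J1 y x + J2 y x) / 2); split=> //.
- rewrite cJ (le_trans (lee_wpmul2l h2 (leeD c1 c2)))//.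
  by rewrite -EFinD -EFinM lee_fin; lra.
- rewrite (le_trans iJ)// (le_trans (lee_wpmul2l h2 (leeD i1 i2)))//.
  by rewrite -EFinD -EFinM lee_fin; lra.
Qed.

(** The constant reconstruction [y] carries no information. *)
Lemma drate0_le y : ((drate 0)%:E <= \sum_x (p x)%:E * d x y)%E.
Proof.
pose J y' x := p x * (y' == y)%:R.
have J0 y' x : 0 <= J y' x by rewrite mulr_ge0.
have hJ : coupling J.
  split=> // x; rewrite (esum_only (t0 := y)) => [|y'|y' /negPf yy'].
  - by rewrite /J eqxx mulr1.
  - by rewrite lee_fin.
  - by rewrite /J yy' mulr0.
have Jy x : J y x = p x by rewrite /J eqxx mulr1.
rewrite drateE//; apply: (@le_trans _ _ (coupling_cost J)).
  apply: distortion_rate_le => //; rewrite /coupling_info.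
  rewrite (esum_only (t0 := y)) => [|y'|y' /negPf yy'].
  - by rewrite (eq_entropy Jy) subee.
  - by rewrite lee_fin entropy_ge0.
  - by rewrite entropy0// => x; rewrite /J yy' mulr0.
rewrite /coupling_cost (esum_only (t0 := y)) => [|y'|y' /negPf yy'].
- by under eq_bigr do rewrite Jy.
- by apply: sume_ge0 => x _; rewrite mule_ge0// lee_fin.
- by rewrite big1// => x _; rewrite /J yy' mulr0 mul0e.
Qed.

Let mass_y (J : Xhat -> X -> R) y := \sum_x J y x.
(** Mass of [y] times the relative entropy, in bits, of the source given [y] with respect to [p];
    its sum over [y] is [coupling_info]. *)
Let divergence (J : Xhat -> X -> R) y :=
  \sum_x J y x * log2 (p x)^-1 - entropy (J y).
(** One-sided L1 distance from [J y] to the product law with the same mass of [y]. *)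
Let deficit (J : Xhat -> X -> R) y :=
  \sum_x Num.max 0 (p x * mass_y J y - J y x).

Let coupling_abs J y x : coupling J -> p x = 0 -> J y x = 0.
Proof.
move=> [J0 J1] px; apply/eqP; rewrite eq_le J0 andbT -lee_fin -px -J1.
by apply: (esum_term_le (f := fun y => (J y x)%:E)) => y'; rewrite lee_fin.
Qed.

Let p_le1 x : p x <= 1. Proof. by rewrite -pmf_fin_sum mass_ge. Qed.

Let log2Vp x : 0 <= log2 (p x)^-1.
Proof.
have [->|px] := eqVneq (p x) 0; first by rewrite invr0 /log2 ln0// mul0r.
by rewrite log2_ge0// invf_ge1// lt_neqAle eq_sym px p0.
Qed.

Let deficit_le J y e : coupling J -> 0 < e -> 0 <= divergence J y /\
  deficit J y <= 2 / e * (ln 2 * divergence J y) + 2 * e * mass_y J y.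
Proof.
move=> hJ e0; have [J0 J1] := hJ.
have m0 : 0 <= mass_y J y by apply: sumr_ge0.
pose G x := J y x * ln (J y x / (p x * mass_y J y)) - J y x + p x * mass_y J y.
have GE : ln 2 * divergence J y = \sum_x G x.
  rewrite /G big_split/= big_split/= sumrN -mulr_suml pmf_fin_sum mul1r subrK.
  rewrite /divergence /entropy -sumrB mulr_sumr; apply: eq_bigr => x _.
  have [->|Jx] := eqVneq (J y x) 0; first by rewrite !mul0r subrr mulr0.
  have Jx0 : 0 < J y x by rewrite lt_neqAle eq_sym Jx J0.
  have px0 : 0 < p x.
    by rewrite lt_neqAle p0 andbT eq_sym; apply: contra_neq Jx => /(coupling_abs y hJ).
  have mx0 : 0 < mass_y J y by rewrite (lt_le_trans Jx0)// mass_ge.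
  rewrite -/(mass_y J y) log2V// log2_div// /log2.
  rewrite ln_div ?posrE ?mulr_gt0// lnM ?posrE//.
  by field; rewrite gt_eqF// ln2_gt0.
have Gx x : 0 <= G x /\ Num.max 0 (p x * mass_y J y - J y x) <=
    2 / e * G x + 2 * e * (p x * mass_y J y).
  have e2 : 0 < 2 / e by rewrite divr_gt0.
  have [Q0|Q0] := eqVneq (p x * mass_y J y) 0.
    have Jx : J y x = 0.
      move: Q0 => /eqP; rewrite mulf_eq0 => /orP[/eqP/(coupling_abs y hJ)//|/eqP mx].
      by apply/eqP; rewrite eq_le J0 andbT -mx mass_ge.
    by rewrite /G Q0 Jx !mul0r subr0 maxxx !(mulr0, addr0).
  have Q_gt0 : 0 < p x * mass_y J y by rewrite lt_neqAle eq_sym Q0 mulr_ge0.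
  have [H1 H2] := relative_entropy_gap (J0 y x) Q_gt0 e0.
  split=> //; rewrite ge_max H2 andbT.
  by rewrite addr_ge0// mulr_ge0// ?(ltW e2)// ?mulr_ge0// ltW.
split.
  have : 0 <= ln 2 * divergence J y by rewrite GE sumr_ge0// => x _; case: (Gx x).
  by rewrite pmulr_rge0// ln2_gt0.
have -> : 2 / e * (ln 2 * divergence J y) + 2 * e * mass_y J y =
    \sum_x (2 / e * G x + 2 * e * (p x * mass_y J y)).
  by rewrite GE [RHS]big_split/= -!mulr_sumr -mulr_suml pmf_fin_sum mul1r.
by apply: ler_sum => x _; have [] := Gx x.
Qed.

Let mass_y_sum J : coupling J -> (\esum_(y in [set: Xhat]) (mass_y J y)%:E = 1)%E.
Proof.
move=> [J0 J1]; under eq_esum do rewrite /mass_y -sumEFin.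
rewrite esum_sum; last by move=> y x _ _; rewrite lee_fin.
by under eq_bigr do rewrite J1; rewrite sumEFin pmf_fin_sum.
Qed.

Let divergence_sum J : coupling J ->
  (\esum_(y in [set: Xhat]) (divergence J y)%:E = coupling_info J)%E.
Proof.
move=> hJ; have [J0 J1] := hJ.
have f := coupling_info_fin hJ.
have : (\esum_(y in [set: Xhat]) (divergence J y)%:E +
    \esum_(y in [set: Xhat]) (entropy (J y))%:E = (entropy p)%:E)%E.
  rewrite -esumD => [|y _|y _].
  - under eq_esum do rewrite -EFinD /divergence subrK -sumEFin.
    rewrite esum_sum; last by move=> y x _ _; rewrite lee_fin mulr_ge0.
    rewrite /entropy pmf_fin_sum -sumEFin; apply: eq_bigr => x _.
    under eq_esum do rewrite EFinM.
    rewrite esumZr//; last by move=> y; rewrite lee_fin.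
    by rewrite J1 div1r.
  - by rewrite lee_fin; have [] := deficit_le y hJ ltr01.
  - by rewrite lee_fin entropy_ge0.
by move=> E; rewrite /coupling_info -E addeK.
Qed.

(** Dominates [(p x)^-1] at each letter of the support, [0^-1] being 0, and so replaces the
    reciprocal of the least positive probability. *)
Let Kp := \sum_x (p x)^-1.

Let Kp_ge0 : 0 <= Kp. Proof. by apply: sumr_ge0 => x _; rewrite invr_ge0. Qed.

Let cost_y J y : coupling J ->
  ((mass_y J y * drate 0)%:E <=
   \sum_x (J y x)%:E * d x y + (Kp * drate 0 * deficit J y)%:E)%E.
Proof.
move=> hJ; have [J0 J1] := hJ.
have t0 x : 0 <= Num.max 0 (p x * mass_y J y - J y x) by rewrite le_max lexx.
have def0 : 0 <= deficit J y by apply: sumr_ge0.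
(* [J y] dominates [t] times [p], since [p x * Kp] is at least 1 on the support; so [y] costs at
   least [t] times as much as the constant reconstruction by [y]. *)
set t := mass_y J y - Kp * deficit J y.
have sum0 : (0 <= \sum_x (J y x)%:E * d x y)%E.
  by apply: sume_ge0 => x _; rewrite mule_ge0// lee_fin.
suff : ((t * drate 0)%:E <= \sum_x (J y x)%:E * d x y)%E.
  rewrite -leeBlDr// -EFinB; congr (_ <= _)%E; congr EFin.
  by rewrite /t; ring.
have [t_le0|t_gt0] := leP t 0.
  apply: le_trans sum0; rewrite lee_fin mulr_le0_ge0// drate_ge0//.
have tJ x : t * p x <= J y x.
  have [px|px] := eqVneq (p x) 0; first by rewrite px mulr0.
  have px0 : 0 < p x by rewrite lt_neqAle eq_sym px p0.
  have : p x * mass_y J y - J y x <= deficit J y.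
    apply: (@le_trans _ _ (Num.max 0 (p x * mass_y J y - J y x))).
      by rewrite le_max lexx orbT.
    exact: (@mass_ge R X (fun x => Num.max 0 (p x * mass_y J y - J y x))).
  have : deficit J y <= p x * (Kp * deficit J y).
    rewrite mulrA ler_peMl// -(mulfV px) ler_wpM2l//.
    by apply: (@mass_ge R X (fun x => (p x)^-1)) => x'; rewrite invr_ge0.
  by rewrite /t; nra.
rewrite EFinM (le_trans (lee_wpmul2l _ (drate0_le y))) ?lee_fin ?(ltW t_gt0)//.
rewrite ge0_sume_distrr; last by move=> x _; rewrite mule_ge0// lee_fin.
apply: lee_sum => x _; rewrite muleA -EFinM.
by apply: lee_wpmul2r; rewrite ?lee_fin.
Qed.

(** Sums [cost_y] over [y]: a coupling of small information costs nearly [drate 0], up to a choice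
    of the AM-GM weight [e]. *)
Lemma drate0_coupling J (r e : R) : coupling J -> (coupling_info J <= r%:E)%E ->
  0 < e ->
  ((drate 0)%:E <= coupling_cost J +
    (Kp * drate 0 * (2 / e * (ln 2 * r) + 2 * e))%:E)%E.
Proof.
move=> hJ iJ e0; have [J0 J1] := hJ.
have c0 : 0 <= Kp * drate 0 by rewrite mulr_ge0// drate_ge0.
have div0 y : 0 <= divergence J y by have [] := deficit_le y hJ e0.
have m0 y : 0 <= mass_y J y by apply: sumr_ge0.
have def0 y : 0 <= deficit J y by apply: sumr_ge0 => x _; rewrite le_max lexx.
have sum0 y : (0 <= \sum_x (J y x)%:E * d x y)%E.
  by apply: sume_ge0 => x _; rewrite mule_ge0// lee_fin.
have l2 : 0 < ln 2 :> R := ln2_gt0.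
have -> : (drate 0)%:E = \esum_(y in [set: Xhat]) (mass_y J y * drate 0)%:E.
  under eq_esum do rewrite EFinM.
  by rewrite esumZr ?drate_ge0// mass_y_sum// mul1e.
apply: (le_trans (le_esum (fun y _ => cost_y y hJ))).
rewrite esumD//; last by move=> y _; rewrite lee_fin mulr_ge0.
rewrite /coupling_cost leeD2l//.
under eq_esum do rewrite EFinM.
rewrite esumZl// [leRHS]EFinM; apply: lee_wpmul2l; first by rewrite lee_fin.
apply: (@le_trans _ _ (\esum_(y in [set: Xhat])
    ((2 / e * ln 2)%:E * (divergence J y)%:E + (2 * e)%:E * (mass_y J y)%:E))%E).
  apply: le_esum => y _; rewrite -!EFinM -EFinD lee_fin.
  by have [_ ] := deficit_le y hJ e0; rewrite !mulrA.
have c1 : 0 <= 2 / e * ln 2 by rewrite mulr_ge0 ?(ltW l2)// divr_ge0 ?(ltW e0).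
have c2 : 0 <= 2 * e by rewrite mulr_ge0 ?(ltW e0).
rewrite esumD => [|y _|y _]; try by rewrite -EFinM lee_fin mulr_ge0.
rewrite !esumZl//.
rewrite mass_y_sum// divergence_sum// mule1 EFinD; apply: leeD2r.
rewrite (mulrA (2 / e)) [leRHS]EFinM; by apply: lee_wpmul2l.
Qed.

Lemma drate_cont0 (h : R) : 0 < h ->
  exists2 t, 0 < t & drate 0 <= drate t + h.
Proof.
move=> h0; pose A := Kp * drate 0.
have A0 : 0 <= A by rewrite mulr_ge0// drate_ge0.
have A1 : 0 < A + 1 by rewrite ltr_wpDl.
have l2 : 0 < ln 2 :> R := ln2_gt0.
(* With this [e] and [t0] below, the two error terms and the slack [t] in the cost are at most
   [h / 4] each; [A + 1] keeps the denominators positive. *)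
pose e := h / (8 * (A + 1)).
have e0 : 0 < e by rewrite divr_gt0// mulr_gt0.
pose t0 := e * h / (16 * ln 2 * (A + 1)).
have t00 : 0 < t0.
  by apply: divr_gt0; [exact: mulr_gt0|rewrite !mulr_gt0].
pose t := Num.min t0 (h / 4).
have t_gt0 : 0 < t by rewrite lt_min t00 divr_gt0.
exists t => //.
have [J [hJ cJ iJ]] := drate_near (ltW t_gt0) t_gt0.
have := drate0_coupling hJ iJ e0; rewrite -/A => H.
have : drate 0 <= drate t + t + A * (2 / e * (ln 2 * (t + t)) + 2 * e).
  by rewrite -lee_fin (le_trans H)// EFinD leeD2r.
have H1 : A * (2 / e * (ln 2 * (t + t))) <= h / 4.
  apply: (@le_trans _ _ ((A + 1) * (2 / e * (ln 2 * (t0 + t0))))).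
    apply: ler_pM => //.
    - by rewrite !mulr_ge0 ?invr_ge0 ?addr_ge0 ?ltW.
    - by rewrite lerDl.
    - apply: ler_wpM2l; first by rewrite divr_ge0// ltW.
      apply: ler_wpM2l; first exact: ltW.
      by rewrite lerD// ge_min lexx.
  rewrite le_eqVlt; apply/orP; left; apply/eqP; rewrite /t0.
  by field; rewrite !gt_eqF.
have H2 : A * (2 * e) <= h / 4.
  apply: (@le_trans _ _ ((A + 1) * (2 * e))).
    by rewrite ler_wpM2r ?lerDl// mulr_ge0// ltW.
  rewrite le_eqVlt; apply/orP; left; apply/eqP; rewrite /e.
  by field; rewrite gt_eqF.
have H3 : t <= h / 4 by rewrite ge_min lexx orbT.
by rewrite mulrDr; lra.
Qed.

End Bounded.

End RateDistortion.

(** * Laws induced by a code *)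

Section LawExpectation.
Context {R : realType}.

(** The factor may be [+oo], as a distortion may be: then both sides are [+oo] as soon as some [f t]
    with [t] in [D] is nonzero, and 0 otherwise. *)
Lemma esumZr_ereal (T : choiceType) (D : set T) (f : T -> R) (g : \bar R) :
  nneg f -> (0 <= g)%E ->
  (\esum_(t in D) ((f t)%:E * g) = (\esum_(t in D) (f t)%:E) * g)%E.
Proof.
move=> f0; case: g => [g| |]// g0; first by rewrite esumZr.
have [[t [Dt ft]]|H] := pselect (exists t, D t /\ f t != 0); last first.
  have fz t : D t -> f t = 0.
    by move=> Dt; apply/eqP; apply: contra_notT H => ft; exists t.
  by rewrite !esum1 ?mul0e// => t Dt; rewrite fz// mul0e.
have ft0 : (0 < (f t)%:E)%E by rewrite lte_fin lt_neqAle eq_sym ft f0.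
have le1 (h : T -> \bar R) : (forall t, (0 <= h t)%E) -> (h t <= \esum_(t in D) h t)%E.
  move=> h0; rewrite -(@esum_set1 _ _ t h)// esum_mkcond [leRHS]esum_mkcond.
  apply: le_esum => u _; case: ifPn => [/set_mem/= ->|_]; first by rewrite mem_set.
  by case: ifP.
rewrite [RHS]gt0_muley; last by rewrite (lt_le_trans ft0)// le1.
apply/eqP; rewrite -leye_eq -[leLHS](gt0_muley ft0).
apply: (le1 (fun t => (f t)%:E * +oo)%E) => u.
by apply: mule_ge0; rewrite ?lee_fin.
Qed.

Lemma esum_law (T A : choiceType) (p : T -> R) (f : T -> A) (g : A -> \bar R) :
  is_pmf p -> (forall a, (0 <= g a)%E) ->
  (\esum_(t in [set: T]) ((p t)%:E * g (f t)) =
   \esum_(a in [set: A]) ((law p f a)%:E * g a))%E.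
Proof.
move=> hp g0; rewrite -(esum_fiber f); last first.
  by move=> t; rewrite mule_ge0// lee_fin hp.1.
apply: eq_esum => a _; rewrite (lawE hp) -esumZr_ereal//; last exact: hp.1.
by apply: eq_esum => t /= ->.
Qed.

End LawExpectation.

Section KernelImage.
Context {R : realType} {U : Type} {W : finType} {I : eqType}.
Context {Y Y' : choiceType}.
Variables (f : I -> W -> U) (kappa : U -> Y -> R) (h : Y -> Y').
Hypothesis kappa_pmf : forall u, is_pmf (kappa u).

Lemma seq_kernel_size s ys w : size ys != size s -> seq_kernel f kappa s ys w = 0.
Proof.
elim: s ys => [|i s IH] [|y ys]//=; rewrite eqSS => /IH ->.
by rewrite mulr0.
Qed.

(** A memoryless channel seen through [h] on its first [M] uses is the memoryless channel of the
    marginals. A general [Phi], not just an indicator, lets the induction absorb the first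
    output. *)
Lemma seq_kernel_image s M w (Phi : seq Y' -> \bar R) :
  (forall ys, (0 <= Phi ys)%E) ->
  (\esum_(ys in [set: seq Y])
     ((seq_kernel f kappa s ys w)%:E * Phi (take M (map h ys))) =
   \esum_(ys in [set: seq Y'])
     ((seq_kernel f (fun u => law (kappa u) h) (take M s) ys w)%:E * Phi ys))%E.
Proof.
have k0 ys s' : 0 <= seq_kernel f kappa s' ys w by apply: seq_kernel_ge0.
have k0' ys s' : 0 <= seq_kernel f (fun u => law (kappa u) h) s' ys w.
  by apply: seq_kernel_ge0 => u; exact: law_pmf.
elim: s M Phi => [|i s IH] M Phi Phi0.
  rewrite esum_seq_nil => [|ys|y ys]; last 2 first.
  - by rewrite mule_ge0// lee_fin.
  - by rewrite mul0e.
  rewrite [RHS]esum_seq_nil => [//=|ys|y ys].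
  - by rewrite mule_ge0// lee_fin.
  - by rewrite mul0e.
case: M => [|M].
  under eq_esum do rewrite take0.
  rewrite esumZr_ereal// seq_kernel_sum// take0 esum_seq_nil.
  - by [].
  - by move=> ys; rewrite mule_ge0// lee_fin.
  - by move=> y ys; rewrite mul0e.
rewrite esum_seq_cons; last 2 first.
- by move=> ys; rewrite mule_ge0// lee_fin.
- by rewrite mul0e.
rewrite [RHS]esum_seq_cons; last 2 first.
- by move=> ys; rewrite mule_ge0// lee_fin.
- by rewrite mul0e.
rewrite /=.
transitivity (\esum_(y in [set: Y]) ((kappa (f i w) y)%:E *
    \esum_(ys in [set: seq Y'])
    ((seq_kernel f (fun u => law (kappa u) h) (take M s) ys w)%:E * Phi (h y :: ys))))%E.
  apply: eq_esum => y _; rewrite -(IH _ (fun ys => Phi (h y :: ys)))//.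
  rewrite -esumZl ?(kappa_pmf _).1//.
    by apply: eq_esum => ys _; rewrite muleA EFinM.
  by move=> ys; rewrite mule_ge0// lee_fin.
rewrite (@esum_law _ _ _ _ h (fun y => \esum_(ys in [set: seq Y'])
    ((seq_kernel f (fun u => law (kappa u) h) (take M s) ys w)%:E * Phi (y :: ys)))%E)//.
  apply: eq_esum => y _; rewrite -esumZl.
  - by apply: eq_esum => ys _; rewrite muleA EFinM.
  - exact: (law_ge0 (kappa_pmf _)).
  - by move=> ys; rewrite mule_ge0// lee_fin.
by move=> y; apply: esum_ge0 => ys _; rewrite mule_ge0// lee_fin.
Qed.

End KernelImage.

Lemma esum_tuple {R : realType} (Y : choiceType) (m : nat) (f : seq Y -> \bar R) :
  (forall ys, (0 <= f ys)%E) -> (forall ys, size ys != m -> f ys = 0%E) ->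
  (\esum_(ys in [set: seq Y]) f ys = \esum_(t in [set: m.-tuple Y]) f t)%E.
Proof.
move=> f0 fm; rewrite -(@reindex_esum _ (m.-tuple Y) (seq Y) setT
  [set ys | size ys = m] val f); last first.
  split=> [t _ /=|t t' _ _ /val_inj//|ys /= ym]; first by rewrite size_tuple.
  by exists (Tuple (introT eqP ym)).
rewrite [RHS]esum_mkcond; apply: eq_esum => ys _.
case: ifPn => // ym; apply: fm; apply: contra ym => /eqP ym.
exact: mem_set.
Qed.

Section JointKernel.
Context {R : realType} {V Z : countType} {U : Type} {W : finType}.
Variable ch : U -> V * Z -> R.
Hypothesis hch : forall u, is_pmf (ch u).

Lemma seq_kernel_prod (m : nat) (f : 'I_m -> W -> U) (v : m.-tuple V)
    (z : m.-tuple Z) w :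
  seq_kernel f ch (enum 'I_m) (zip v z) w =
  \prod_(t < m) ch (f t w) (tnth v t, tnth z t).
Proof.
elim: m f v z => [|m IH] f v z.
  by rewrite big_ord0 enum_ord0 tuple0 [z]tuple0.
rewrite big_ord_recl enum_ordSl.
case/tupleP: v => v0 v; case/tupleP: z => z0 z /=.
rewrite !tnth0; congr (_ * _).
rewrite (_ : seq_kernel _ _ _ _ _ =
    seq_kernel (fun t => f (lift ord0 t)) ch (enum 'I_m) (zip v z) w); last first.
  elim: (enum 'I_m) (zip v z) => [|i s IHs] [|y ys]//=.
  by rewrite IHs.
by rewrite IH; apply: eq_bigr => t _; rewrite !tnthS.
Qed.

Lemma esum_channel (m : nat) (f : 'I_m -> W -> U) w (Psi : seq (V * Z) -> \bar R) :
  (forall ys, (0 <= Psi ys)%E) ->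
  (\esum_(y in [set: m.-tuple V * m.-tuple Z])
     ((\prod_(t < m) ch (f t w) (tnth y.1 t, tnth y.2 t))%:E * Psi (zip y.1 y.2)) =
   \esum_(ys in [set: seq (V * Z)])
     ((seq_kernel f ch (enum 'I_m) ys w)%:E * Psi ys))%E.
Proof.
move=> Psi0; rewrite (esum_tuple (m := m)); last 2 first.
- by move=> ys; rewrite mule_ge0// lee_fin seq_kernel_ge0.
- by move=> ys ym; rewrite seq_kernel_size ?mul0e// size_enum_ord.
rewrite (@reindex_esum _ (m.-tuple V * m.-tuple Z)%type _ setT setT
    (fun y => [tuple (tnth y.1 t, tnth y.2 t) | t < m])).
  apply: eq_esum => -[v z] _.
  rewrite -seq_kernel_prod; set t := [tuple _ | _ < m].
  suff -> : t = zip v z :> seq _ by [].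
  have -> : zip v z = val [tuple of zip v z] by [].
  congr val; apply: eq_from_tnth => i.
  rewrite tnth_mktuple /=.
  have [v0 z0] : V * Z by exact: (tnth v i, tnth z i).
  rewrite [RHS](tnth_nth (v0, z0)) /= nth_zip ?size_tuple//.
  by rewrite -!tnth_nth.
split=> // [[v z] [v' z'] _ _ /= H|y _].
  congr pair; apply: eq_from_tnth => i; have := congr1 (fun t => tnth t i) H;
    by rewrite !tnth_mktuple => -[].
exists ([tuple (tnth y t).1 | t < m], [tuple (tnth y t).2 | t < m]) => //=.
apply: eq_from_tnth => i; rewrite !tnth_mktuple.
by case: (tnth y i).
Qed.

End JointKernel.

(** * The source: words, prefixes and independence *)

Section TupleSums.
Context {R : realType} {X : finType}.

Lemma sum_tuple_prod (N : nat) (G : 'I_N -> X -> R) :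
  \sum_(w : N.-tuple X) \prod_j G j (tnth w j) = \prod_j \sum_c G j c.
Proof.
rewrite bigA_distr_bigA /=.
rewrite (reindex (fun w : N.-tuple X => [ffun j => tnth w j])) /=.
  by apply: eq_bigr => w _; apply: eq_bigr => j _; rewrite ffunE.
exists (fun g : {ffun 'I_N -> X} => [tuple g j | j < N]) => [w _|g _].
  by apply: eq_from_tnth => j; rewrite tnth_mktuple ffunE.
by apply/ffunP => j; rewrite ffunE tnth_mktuple.
Qed.

(** Bounded sequences put the prefixes of all lengths into one finite type, as [push] and
    [cond_entropy] demand. *)
Definition pref (N : nat) (l : nat) (w : N.-tuple X) : N.-bseq X :=
  take_bseq l (bseq_of_tuple w).

Lemma pref_eqP (N l : nat) (w w' : N.-tuple X) :
  reflect (take l w = take l w') (pref l w == pref l w').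
Proof. by apply: (iffP eqP) => [/(congr1 val)//|H]; exact: val_inj. Qed.

Lemma take_tuple_eqP (N l : nat) (w w' : N.-tuple X) :
  reflect (forall j : 'I_N, (j < l)%N -> tnth w j = tnth w' j) (pref l w == pref l w').
Proof.
apply: (iffP (pref_eqP l w w')) => [E j jl|H].
  have x0 := tnth w j; rewrite !(tnth_nth x0) -(nth_take x0 jl) E nth_take//.
have [N0|N0] := posnP N; first by subst N; rewrite (tuple0 w) (tuple0 w').
have x0 := tnth w (Ordinal N0).
apply: (@eq_from_nth _ x0); rewrite !size_take_min ?size_tuple// => j.
rewrite leq_min => /andP[jl jN]; rewrite !nth_take//.
by have := H (Ordinal jN) jl; rewrite !(tnth_nth x0).
Qed.

Lemma pref_succ (N : nat) (l : 'I_N) (w w' : N.-tuple X) :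
  (pref l.+1 w == pref l.+1 w') =
  (pref l w == pref l w') && (tnth w l == tnth w' l).
Proof.
apply/take_tuple_eqP/andP => [H|[/take_tuple_eqP H /eqP Hl] j].
  split; last by apply/eqP/H.
  by apply/take_tuple_eqP => j jl; apply: H; rewrite ltnS ltnW.
rewrite ltnS leq_eqVlt => /predU1P[jl|]; last exact: H.
by rewrite (val_inj jl).
Qed.

Lemma pref_full (N : nat) : injective (@pref N N).
Proof.
by move=> w w' /eqP/take_tuple_eqP H; apply: eq_from_tnth => j; exact: H.
Qed.

End TupleSums.

Lemma entropy_push_inj {R : realType} (W E : finType) (F : W -> E) (a : W -> R) :
  injective F -> entropy (push F a) = entropy a.
Proof.
move=> FI; rewrite entropy_push; apply: eq_bigr => w _.
congr (_ * log2 (_ / _)); rewrite /push (eq_bigl (pred1 w)) ?big_pred1_eq//.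
by move=> w'; rewrite /= (inj_eq FI).
Qed.

Section Source.
Context {R : realType} {X : finType}.
Variables (p : X -> R) (N : nat).
Hypothesis hp : is_pmf p.

Let p0 x : 0 <= p x. Proof. exact: hp.1. Qed.

Let p1 : \sum_x p x = 1.
Proof. by apply: EFin_inj; rewrite -sumEFin -esum_fin ?hp.2. Qed.

Definition iid (w : N.-tuple X) : R := \prod_j p (tnth w j).

Lemma iid_ge0 w : 0 <= iid w. Proof. by apply: prodr_ge0. Qed.

Lemma iid_sum : \sum_w iid w = 1.
Proof.
by rewrite (sum_tuple_prod (fun=> p)) big1.
Qed.

Lemma iid_indep (l : 'I_N) e x :
  push (fun w => tnth w l) (restr (pref l) iid e) x = push (pref l) iid e * p x.
Proof.
have [[w0 <-]|He] := pselect (exists w0, pref l w0 = e); last first.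
  rewrite /push !big1 ?mul0r// => w.
    by move=> /eqP we; case: He; exists w.
  move=> _; rewrite /restr; case: ifP => // /eqP we; by case: He; exists w.
(* Agreement with [w0] before position [l], written factor by factor so that the sum over words
   splits by [sum_tuple_prod]. *)
pose b (j : 'I_N) c : R := ((j < l)%N ==> (c == tnth w0 j))%:R.
have prodb w : \prod_j b j (tnth w j) = (pref l w == pref l w0)%:R.
  case: (take_tuple_eqP l w w0) => [H|/existsNP[j /not_implyP[jl /eqP wj]]].
    rewrite big1// => j _; rewrite /b; case: ltnP => // jl.
    by rewrite H// eqxx.
  by rewrite (bigD1 j)//= /b jl (negPf wj) mul0r.
rewrite /push.
transitivity (\sum_w \prod_j (p (tnth w j) * b j (tnth w j) *
    ((j == l) ==> (tnth w j == x))%:R)).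
  rewrite big_mkcond; apply: eq_bigr => w _.
  rewrite !big_split/= prodb /restr -/(iid w).
  rewrite (bigD1 l)//= eqxx big1 => [|j /negPf ->//].
  by rewrite /= mulr1; case: eqP => _; case: eqP => _; rewrite ?mulr0 ?mulr1 ?mul0r.
rewrite (sum_tuple_prod (fun j c => p c * b j c * ((j == l) ==> (c == x))%:R)).
have -> : \sum_(w | pref l w == pref l w0) iid w =
    \prod_j \sum_c p c * b j c.
  rewrite -(sum_tuple_prod (fun j c => p c * b j c)) big_mkcond; apply: eq_bigr => w _.
  by rewrite big_split/= prodb -/(iid w); case: eqP => _; rewrite ?mulr0 ?mulr1.
rewrite (bigD1 l)//= [in RHS](bigD1 l)//= eqxx /=.
have -> : \sum_c p c * b l c * (c == x)%:R = p x.
  rewrite (bigD1 x)//= eqxx mulr1 big1 ?addr0 => [|c /negPf ->]; last by rewrite mulr0.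
  by rewrite /b ltnn mulr1.
have -> : \sum_c p c * b l c = 1.
  by rewrite -p1; apply: eq_bigr => c _; rewrite /b ltnn mulr1.
rewrite mul1r mulrC; congr (_ * _); apply: eq_bigr => j /negPf ->.
by apply: eq_bigr => c _; rewrite mulr1.
Qed.

Lemma iid_letter (l : 'I_N) x : push (fun w => tnth w l) iid x = p x.
Proof.
transitivity (\sum_e push (fun w => tnth w l) (restr (pref l) iid e) x).
  rewrite exchange_big/=; apply: eq_bigr => w _.
  rewrite (bigD1 (pref l w))//= /restr eqxx big1 ?addr0// => e.
  by rewrite eq_sym => /negPf ->.
under eq_bigr do rewrite iid_indep.
by rewrite -mulr_suml sum_push iid_sum mul1r.
Qed.

Lemma iid_letter_entropy (l : 'I_N) :
  \sum_e entropy (push (fun w => tnth w l) (restr (pref l) iid e)) = entropy p.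
Proof.
under eq_bigr do rewrite (eq_entropy (iid_indep l _)) entropyZ.
by rewrite -mulr_suml sum_push iid_sum mul1r.
Qed.

(** The chain rule telescopes from the prefix of length [i] to the prefix of length [N], which
    determines the word. *)
Lemma entropy_letters (a : N.-tuple X -> R) i : nneg a -> (i <= N)%N ->
  \sum_(l < N | (i <= l)%N)
    \sum_e entropy (push (fun w => tnth w l) (restr (pref l) a e)) =
  cond_entropy (pref i) a.
Proof.
move=> a0 iN.
have E : entropy (push (pref N) a) = entropy a by rewrite entropy_push_inj//; exact: pref_full.
have := entropy_cond (pref i) a0; rewrite -E => /(canLR (addKr _)) <-.
transitivity (\sum_(l < N | (i <= l)%N)
    (entropy (push (pref l.+1) a) - entropy (push (pref l) a))).
  apply: eq_bigr => l _.
  rewrite (chain_rule (F := pref l) (G := fun w => tnth w l) a0 (pref_succ l)).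
  by rewrite addrAC subrr add0r.
transitivity (\sum_(i <= l < N)
    (entropy (push (pref l.+1) a) - entropy (push (pref l) a))).
  by rewrite big_geq_mkord.
by rewrite telescope_sumr// addrC.
Qed.

End Source.

Lemma mem_take_enum_ord (k i : nat) (j : 'I_k) :
  (j \in take i (enum 'I_k)) = (j < i)%N.
Proof.
rewrite -(mem_map val_inj) map_take val_enum_ord take_iota mem_iota /= add0n.
by rewrite leq_min ltn_ord andbT.
Qed.

Section Lengths.
Context {R : realType}.
Variables (G : R -> R) (k n : nat).
Hypothesis hG : regular_cumulative G.
Hypothesis k0 : (0 < k)%N.

Lemma grid01 i : (i <= k)%N -> i%:R / k%:R \in (`[0, 1] : interval R).
Proof.
move=> ik; rewrite in_itv/= divr_ge0//= ler_pdivrMr ?ltr0n// mul1r ler_nat.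
exact: ik.
Qed.

Lemma cumulative_le i j : (i <= j)%N -> (j <= k)%N -> G (i%:R / k%:R) <= G (j%:R / k%:R).
Proof.
case: hG => _ Gm _ _ ij jk; apply: Gm; rewrite ?grid01 ?(leq_trans ij)//.
by rewrite ler_pM2r ?invr_gt0 ?ltr0n// ler_nat.
Qed.

Lemma cum_len_le i j : (i <= j)%N -> (cum_len G k n i <= cum_len G k n j)%N.
Proof.
move=> ij; rewrite /cum_len.
rewrite (big_ord_widen j (fun l => block_len G k n l.+1) ij).
by rewrite [leqRHS](bigID (fun l : 'I_j => (l < i)%N)) leq_addr.
Qed.

(** Rounding down only shortens blocks, so a range of blocks has at most its nominal number of
    channel uses. *)
Lemma cum_len_sub_le i j : (i <= j)%N -> (j <= k)%N ->
  (cum_len G k n j - cum_len G k n i)%:R <=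
  (n * k)%:R * (G (j%:R / k%:R) - G (i%:R / k%:R)) :> R.
Proof.
move=> ij jk; rewrite natrB ?cum_len_le//.
elim: j ij jk => [|j IH].
  by rewrite leqn0 => /eqP -> _; rewrite !subrr mulr0.
rewrite leq_eqVlt => /predU1P[->|ij] jk; first by rewrite !subrr mulr0.
have := IH ij (ltnW jk).
have -> : cum_len G k n j.+1 = (cum_len G k n j + block_len G k n j.+1)%N.
  by rewrite /cum_len big_ord_recr.
have : (block_len G k n j.+1)%:R <= (n * k)%:R * rate G k j.+1.
  by rewrite truncn_le mulr_ge0// subr_ge0 cumulative_le.
by rewrite natrD /rate /= !mulrBr; lra.
Qed.

End Lengths.

Section Code.
Context {R : realType} (X : finType) (U V Z : countType) (Xhat : choiceType).
Variables (p : X -> R) (d : X -> Xhat -> \bar R) (ch : U -> V * Z -> R).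
Variables (G : R -> R) (k n : nat) (c : code X U V Xhat G k n).
Hypothesis hp : is_pmf p.
Hypothesis hd : forall x xhat, (0 <= d x xhat)%E.
Hypothesis hch : forall u, is_pmf (ch u).
Hypothesis k0 : (0 < k)%N.
Hypothesis n0 : (0 < n)%N.

Let N := (k * n)%N.
Let m := cum_len G k n k.
Let S := system_law p ch c.
Let a := @iid R X p N.

Let a0 w : 0 <= a w. Proof. exact: iid_ge0. Qed.

Definition letter_input (t : 'I_m) (w : N.-tuple X) : U := tnth (channel_input c w) t.
Let f := letter_input.
Let kVp := kV_pmf hch.
Let kZp := kZ_pmf hch.

Let S0 w : 0 <= S w.
Proof. by rewrite mulr_ge0// ?prodr_ge0// => t _; [exact: hp.1|exact: (hch _).1]. Qed.

Lemma esum_system (Psi : N.-tuple X -> seq (V * Z) -> \bar R) :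
  (forall w ys, (0 <= Psi w ys)%E) ->
  (\esum_(t in [set: N.-tuple X * (m.-tuple V * m.-tuple Z)])
     ((S t)%:E * Psi t.1 (zip t.2.1 t.2.2)) =
   \sum_w (a w)%:E * \esum_(ys in [set: seq (V * Z)])
     ((seq_kernel f ch (enum 'I_m) ys w)%:E * Psi w ys))%E.
Proof.
move=> Psi0; rewrite esum_pair; last by move=> t; rewrite mule_ge0// lee_fin.
rewrite esum_fin; last first.
  by move=> w; apply: esum_ge0 => t _; rewrite mule_ge0// lee_fin.
apply: eq_bigr => w _; rewrite -(esum_channel hch) // -esumZl//; last first.
  move=> y; rewrite mule_ge0// lee_fin prodr_ge0// => t _; exact: (hch _).1.
by apply: eq_esum => y _; rewrite muleA -EFinM.
Qed.

Lemma system_pmf : is_pmf S.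
Proof.
split=> //.
transitivity (\esum_(t in [set: N.-tuple X * (m.-tuple V * m.-tuple Z)])
   ((S t)%:E * (fun _ _ => 1) t.1 (zip t.2.1 t.2.2)))%E.
  by apply: eq_esum => t _; rewrite mule1.
rewrite (esum_system (Psi := fun _ _ => 1%E))//.
under eq_bigr => w _.
  rewrite (eq_esum (b := fun ys => (seq_kernel f ch (enum 'I_m) ys w)%:E)); last first.
    by move=> ys _; rewrite mule1.
  rewrite seq_kernel_sum// mule1; over.
by rewrite sumEFin iid_sum.
Qed.

(** One computation for all the joint laws in use: [h] selects the outputs of the decoder or of the
    eavesdropper, and [M] truncates them. *)
Lemma law_system (E : finType) (A : N.-tuple X -> E) (Y : choiceType)
    (h : V * Z -> Y) M e ys :
  law S (fun t => (A t.1, take M (map h (zip t.2.1 t.2.2)))) (e, ys) =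
  push A (fun w => a w *
    seq_kernel f (fun u => law (ch u) h) (take M (enum 'I_m)) ys w) e.
Proof.
apply: EFin_inj; rewrite (lawE system_pmf) esum_mkcond.
pose Psi w zs : \bar R := if (A w == e) && (take M (map h zs) == ys) then 1%E else 0%E.
have Psi0 w zs : (0 <= Psi w zs)%E by rewrite /Psi; case: ifP.
transitivity (\esum_(t in [set: N.-tuple X * (m.-tuple V * m.-tuple Z)])
   ((S t)%:E * Psi t.1 (zip t.2.1 t.2.2)))%E.
  apply: eq_esum => t _; rewrite /Psi.
  case: ifPn => [/set_mem/= [-> ->]|/negP ht]; first by rewrite !eqxx mule1.
  rewrite ifF ?mule0//; apply/negP => /andP[/eqP Ae /eqP ty]; apply: ht.
  by apply/mem_set; rewrite /= Ae ty.
rewrite esum_system// /push -sumEFin big_mkcond [RHS]big_mkcond/=.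
rewrite big_mkcond; apply: eq_bigr => w _ /=.
case: ifPn => Aw; last first.
  rewrite esum1 ?mule0// => zs _.
  by rewrite /Psi (negPf Aw) mule0.
rewrite EFinM; congr (_ * _)%E.
pose Phi ys' : \bar R := if ys' == ys then 1%E else 0%E.
have Phi0 ys' : (0 <= Phi ys')%E by rewrite /Phi; case: ifP.
transitivity (\esum_(zs in [set: seq (V * Z)])
    ((seq_kernel f ch (enum 'I_m) zs w)%:E * Phi (take M (map h zs))))%E.
  by apply: eq_esum => zs _; rewrite /Psi Aw.
have law_h u : is_pmf (law (ch u) h) by exact: law_pmf.
rewrite (seq_kernel_image f h hch)// (esum_only (t0 := ys)) => [|ys'|ys' /negPf yy'].
- by rewrite /Phi eqxx mule1.
- by rewrite mule_ge0// lee_fin (seq_kernel_ge0 f law_h).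
- by rewrite /Phi yy' mule0.
Qed.

(** Causality: the first [i] encoders see only the first [i * n] letters, and their blocks, of total
    length [cum_len G k n i], come first in the input. *)
Lemma source_input_eq i t w w' : (i <= k)%N -> t \in take (cum_len G k n i) (enum 'I_m) ->
  pref (i * n) w = pref (i * n) w' -> f t w = f t w'.
Proof.
move=> ik; rewrite mem_take_enum_ord => ti /eqP/take_tuple_eqP ww'.
pose es (w : N.-tuple X) :=
  [seq tval (encoder c (source_prefix w j)) | j <- enum 'I_k].
have tk (g : 'I_k -> seq U) :
    take i [seq g j | j <- enum 'I_k] = [seq g j | j <- take i (enum 'I_k)].
  by rewrite map_take.
have es_eq : take i (es w) = take i (es w').
  rewrite /es !tk; apply/eq_in_map => j; rewrite mem_take_enum_ord => ji.
  congr (tval (encoder c _)); apply: eq_from_tnth => l; rewrite !tnth_mktuple.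
  apply: ww' => /=; rewrite (leq_trans (ltn_ord l))// leq_mul2r; by rewrite ji orbT.
have size_es (v : N.-tuple X) : size (flatten (take i (es v))) = cum_len G k n i.
  rewrite /es tk size_flatten /shape -map_comp sumnE big_map.
  rewrite /cum_len -(big_mkord predT (fun j => block_len G k n j.+1)).
  rewrite (eq_bigr (fun j : 'I_k => block_len G k n j.+1)); last first.
    by move=> j _ /=; rewrite size_tuple.
  rewrite -(big_map val predT (fun j => block_len G k n j.+1)).
  by rewrite map_take val_enum_ord take_iota (minn_idPl ik) /index_iota subn0.
rewrite /f /letter_input; have u0 := tnth (channel_input c w) t.
rewrite !(tnth_nth u0) /= /channel_input_seq -/(es w) -/(es w').
rewrite -{1}(cat_take_drop i (es w)) -{1}(cat_take_drop i (es w')) !flatten_cat.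
by rewrite !nth_cat !size_es ti es_eq.
Qed.

Lemma leakage_info i : (i <= k)%N ->
  leakage_rate p ch c i = (((n * k)%:R^-1)%:E *
   ((entropy (push (pref (i * n)) a))%:E -
    \esum_(zs in [set: seq Z]) (entropy (push (pref (i * n)) (fun w => a w *
      seq_kernel f (kZ ch) (take (cum_len G k n i) (enum 'I_m)) zs w)))%:E))%E.
Proof.
move=> ik; rewrite /leakage_rate; congr (_ * _)%E.
set M := cum_len G k n i.
have -> : mutual_info S (fun w => take (i * n) w.1) (fun w => take M w.2.2) =
    mutual_info S (fun t => pref (i * n) t.1)
      (fun t => take M (map snd (zip t.2.1 t.2.2))).
  (* Plain prefixes live in an infinite type; the injection of bounded sequences into sequences
     leaves the information unchanged. *)
  rewrite -(mutual_info_inj system_pmf _ _ (h := @bseqval N X)); last exact: val_inj.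
  congr mutual_info; apply/funext => t /=.
  by rewrite -/(unzip2 _) unzip2_zip ?size_tuple.
rewrite (mutual_info_fin system_pmf).
have L zs e : law S (fun t => (pref (i * n) t.1, take M (map snd (zip t.2.1 t.2.2))))
    (e, zs) = push (pref (i * n)) (fun w => a w *
      seq_kernel f (kZ ch) (take M (enum 'I_m)) zs w) e.
  exact: law_system.
congr (_ - _)%E; last first.
  by apply: eq_esum => zs _; congr EFin; apply: eq_entropy => e; exact: L.
congr EFin; apply: eq_entropy => e; apply: EFin_inj.
rewrite -(law_marginl system_pmf _ (fun t => take M (map snd (zip t.2.1 t.2.2)))).
under eq_esum do rewrite L /push -sumEFin.
rewrite esum_sum; last first.
  by move=> zs w _ _; rewrite lee_fin mulr_ge0// (seq_kernel_ge0 f kZp).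
rewrite /push -sumEFin; apply: eq_bigr => w _.
under eq_esum do rewrite EFinM.
by rewrite esumZl// ?seq_kernel_sum ?mule1// => zs; rewrite lee_fin (seq_kernel_ge0 f kZp).
Qed.

Definition decoder_law (t : N.-tuple X * m.-tuple V) : R :=
  a t.1 * seq_kernel f (kV ch) (enum 'I_m) t.2 t.1.
Let PV := decoder_law.

Let skV0 ys w s : 0 <= seq_kernel f (kV ch) s ys w.
Proof. exact: (seq_kernel_ge0 f kVp). Qed.

Lemma decoder_lawE : law S (fun t => (t.1, t.2.1)) =1 PV.
Proof.
move=> [w v]; transitivity (law S (fun t => (id t.1, take m (map fst (zip t.2.1 t.2.2))))
    (w, val v)).
  congr (fine (esum _ _)); apply/seteqP; split=> -[w' [v' z']] /=;
    rewrite -/(unzip1 _) unzip1_zip ?size_tuple// take_oversize ?size_tuple//.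
    by move=> [-> ->].
  by move=> [-> /val_inj ->].
rewrite (law_system id) push_id take_oversize ?size_enum_ord//.
Qed.

Lemma decoder_law_pmf : is_pmf PV.
Proof.
have -> : PV = law S (fun t => (t.1, t.2.1)).
  by apply/funext => t; rewrite decoder_lawE.
exact: law_pmf system_pmf _ _.
Qed.

Lemma law_decoder_law (E : finType) (A : N.-tuple X -> E) e v :
  law PV (fun t => (A t.1, t.2)) (e, v) =
  push A (fun w => a w * seq_kernel f (kV ch) (enum 'I_m) v w) e.
Proof.
apply: EFin_inj; rewrite (lawE decoder_law_pmf) esum_mkcond esum_pair; last first.
  by move=> t; case: ifP => _; rewrite lee_fin// decoder_law_pmf.1.
rewrite esum_fin; last first.
  move=> w; apply: esum_ge0 => v' _.
  by case: ifP => _; rewrite lee_fin// decoder_law_pmf.1.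
rewrite /push -sumEFin [RHS]big_mkcond; apply: eq_bigr => w _.
rewrite (esum_only (t0 := v)) => [|v'|v' /eqP vv'].
- case: eqP => Aw; first by rewrite mem_set//= Aw.
  by rewrite memNset// => -[].
- by case: ifP => _; rewrite lee_fin// decoder_law_pmf.1.
- by rewrite memNset// => -[].
Qed.

Lemma esum_decoder_push (E : finType) (A : N.-tuple X -> E) e :
  (\esum_(v in [set: m.-tuple V])
     (push A (fun w => a w * seq_kernel f (kV ch) (enum 'I_m) v w) e)%:E =
   (push A a e)%:E)%E.
Proof.
rewrite -(esum_tuple (f := fun vs =>
    (push A (fun w => a w * seq_kernel f (kV ch) (enum 'I_m) vs w) e)%:E)).
- rewrite /push; under eq_esum do rewrite -sumEFin.
  rewrite esum_sum; last by move=> vs w _ _; rewrite lee_fin mulr_ge0.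
  rewrite -sumEFin; apply: eq_bigr => w _.
  under eq_esum do rewrite EFinM.
  by rewrite esumZl// ?(seq_kernel_sum f kVp) ?mule1// => vs; rewrite lee_fin.
- by move=> vs; rewrite lee_fin sumr_ge0// => w _; rewrite mulr_ge0.
- move=> vs vm; rewrite /push big1// => w _.
  by rewrite seq_kernel_size ?mulr0// size_enum_ord.
Qed.

Definition letter_coupling (l : 'I_N) (y : Xhat) (x : X) : R :=
  law PV (fun t => (tnth t.1 l, tnth (decoder c t.2) l)) (x, y).
Let J := letter_coupling.

Lemma letter_couplingP l : coupling p (J l).
Proof.
split=> [y x|x]; first exact: (law_ge0 decoder_law_pmf).
rewrite (law_marginl decoder_law_pmf (fun t => tnth t.1 l)
  (fun t => tnth (decoder c t.2) l)).
rewrite -(law_marginl decoder_law_pmf (fun t => tnth t.1 l) snd).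
under eq_esum do rewrite (law_decoder_law (fun w => tnth w l)).
by rewrite (esum_decoder_push (fun w => tnth w l)) iid_letter.
Qed.

Lemma letter_couplingE l y x : ((J l y x)%:E =
  \esum_(v in [set: m.-tuple V]) (if tnth (decoder c v) l == y then
    push (fun w => tnth w l)
      (fun w => a w * seq_kernel f (kV ch) (enum 'I_m) v w) x else 0)%:E)%E.
Proof.
rewrite (lawE decoder_law_pmf) -(esum_fiber_setI snd); last first.
  by move=> t; rewrite lee_fin decoder_law_pmf.1.
apply: eq_esum => v _; rewrite -(law_decoder_law (fun w => tnth w l)).
case: eqP => vy.
  rewrite (lawE decoder_law_pmf); congr esum; apply/seteqP; split=> t /=.
    by move=> [[-> _] ->].
  by move=> [-> ->]; rewrite vy.
rewrite esum1// => t /= [[_ ty] tv]; case: vy.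
by rewrite -tv.
Qed.

Lemma expected_distortionE : expected_distortion p ch d c =
  (((n * k)%:R^-1)%:E * \sum_l coupling_cost d (J l))%E.
Proof.
rewrite /expected_distortion /expectation_pmf /avg_distortion -/S.
have i0 : 0 <= (n * k)%:R^-1 :> R by rewrite invr_ge0.
under eq_esum do rewrite muleCA.
rewrite esumZl//; last first.
  by move=> t; rewrite mule_ge0 ?lee_fin// sume_ge0.
congr (_ * _)%E.
under eq_esum => t _ do rewrite ge0_sume_distrr//.
rewrite esum_sum; last by move=> t l _ _; rewrite mule_ge0// lee_fin.
apply: eq_bigr => l _.
rewrite (@esum_law _ _ _ _ (fun t => (tnth t.1 l, tnth (decoder c t.2.1) l))
  (fun xy => d xy.1 xy.2) system_pmf)//.
have lawJ : law S (fun t => (tnth t.1 l, tnth (decoder c t.2.1) l)) =1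
    fun xy => J l xy.2 xy.1.
  move=> [x y]; exact: (law_comp system_pmf (phi := fun t => (t.1, t.2.1))
    (fun t => (tnth t.1 l, tnth (decoder c t.2) l)) decoder_lawE).
under eq_esum do rewrite lawJ.
have J0 x y : 0 <= J l y x by exact: (law_ge0 decoder_law_pmf).
rewrite esum_pair; last by move=> [x y]; rewrite mule_ge0// lee_fin.
rewrite esum_swap; last by move=> x y; rewrite mule_ge0// lee_fin.
by apply: eq_esum => y _; rewrite esum_fin// => x; rewrite mule_ge0// lee_fin.
Qed.

(** Summed over [vs], this is H(X_l | X^(l-1), V^m). *)
Let letter_term (l : 'I_N) (vs : seq V) : R :=
  \sum_e entropy (push (fun w => tnth w l) (restr (pref l)
    (fun w => a w * seq_kernel f (kV ch) (enum 'I_m) vs w) e)).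

Let letter_term_ge0 l vs : 0 <= letter_term l vs.
Proof.
apply: sumr_ge0 => e _; apply/entropy_ge0/nneg_push/nneg_restr => w.
by rewrite mulr_ge0.
Qed.

Let letter_term_fin l : (\esum_(vs in [set: seq V]) (letter_term l vs)%:E)%E \is a fin_num.
Proof.
apply: (@esum_fin_num _ _ _ _ (entropy (push (pref l.+1) a))) => [vs|].
  by rewrite lee_fin.
apply: le_trans (entropy_push_kernel_le f kVp (pref l.+1) (enum 'I_m) a0).
apply: le_esum => vs _; rewrite lee_fin.
have b0 w : 0 <= a w * seq_kernel f (kV ch) (enum 'I_m) vs w by rewrite mulr_ge0.
rewrite (chain_rule (F := pref l) (G := fun w => tnth w l) b0 (pref_succ l)).
by rewrite lerDr entropy_ge0//; exact: nneg_push.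
Qed.

(* [H(X_l) - H(X_l | X^(l-1), V^m)]; the past letters stay in the condition so
   that the sums over tails telescope. *)
Definition letter_rate (l : 'I_N) : R :=
  entropy p - fine (\esum_(vs in [set: seq V]) (letter_term l vs)%:E)%E.

(** [J l y] adds up the mass functions of letter [l] over all pairs of a past and an output decoded
    to [y] at [l]. Superadditivity then makes H(X_l | Xhat_l) at least H(X_l | X^(l-1), V^m). *)
Lemma letter_rateP l : (coupling_info p (J l) <= (letter_rate l)%:E)%E.
Proof.
rewrite EFinB fineK// leeB//.
pose D y : set (m.-tuple V * N.-bseq X) := [set t | tnth (decoder c t.1) l = y].
pose b (t : m.-tuple V * N.-bseq X) := push (fun w => tnth w l) (restr (pref l)
    (fun w => a w * seq_kernel f (kV ch) (enum 'I_m) t.1 w) t.2).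
have b0 t x : 0 <= b t x.
  by apply/nneg_push/nneg_restr => w; rewrite mulr_ge0.
rewrite (esum_tuple (m := m)); last 2 first.
- by move=> vs; rewrite lee_fin.
- move=> vs vm; rewrite /letter_term big1// => e _; rewrite entropy0// => x.
  rewrite /push big1// => w _; rewrite /restr seq_kernel_size ?mulr0; last first.
    by rewrite size_enum_ord.
  by case: ifP.
apply: (@le_trans _ _ (\esum_(t in [set: m.-tuple V * N.-bseq X]) (entropy (b t))%:E)%E).
  rewrite esum_pair; last by move=> t; rewrite lee_fin entropy_ge0.
  apply: le_esum => v _; rewrite esum_fin; last first.
    by move=> e; rewrite lee_fin entropy_ge0.
  by rewrite sumEFin.
rewrite -(esum_fiber (fun t : m.-tuple V * N.-bseq X => tnth (decoder c t.1) l)); last first.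
  by move=> t; rewrite lee_fin entropy_ge0.
apply: le_esum => y _; apply: entropy_superadd => // x.
rewrite letter_couplingE esum_mkcond esum_pair; last first.
  by move=> t; case: ifP; rewrite lee_fin.
apply: eq_esum => v _; rewrite esum_fin; last by move=> e; case: ifP; rewrite lee_fin.
case: eqP => vy; last by rewrite big1// => e _; rewrite memNset.
under eq_bigr do rewrite mem_set//.
rewrite sumEFin; congr EFin.
rewrite /b /= exchange_big/=; apply: eq_bigr => w _.
rewrite (bigD1 (pref l w))//= /restr eqxx big1 ?addr0// => e.
by rewrite eq_sym => /negPf ->.
Qed.

Lemma letter_rate_ge0 l : 0 <= letter_rate l.
Proof.
rewrite -lee_fin; apply: le_trans (letter_rateP l).
exact: (coupling_info_ge0 hp (letter_couplingP l)).
Qed.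

Lemma sum_letter_rate i : (i <= k)%N ->
  \sum_(l < N | (i * n <= l)%N) letter_rate l =
  cond_entropy (pref (i * n)) a -
  cond_seq_entropy f (kV ch) (pref (i * n)) (enum 'I_m) a.
Proof.
move=> ik; have iN : (i * n <= N)%N by rewrite leq_mul2r ik orbT.
rewrite sumrB; congr (_ - _).
  rewrite -(entropy_letters a0 iN); apply: eq_bigr => l _.
  by rewrite iid_letter_entropy.
apply: EFin_inj; rewrite -(cond_seq_entropyE f kVp)// -sumEFin.
under eq_bigr do rewrite fineK//.
rewrite -esum_sum; last by move=> vs l _ _; rewrite lee_fin.
apply: eq_esum => vs _; rewrite sumEFin; congr EFin.
by apply: entropy_letters => // w; rewrite mulr_ge0.
Qed.

End Code.

Section Converse.
Context {R : realType} (X : finType) (U V Z : countType) (Xhat : choiceType).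
Variables (p : X -> R) (d : X -> Xhat -> \bar R) (ch : U -> V * Z -> R).
Variables (G : R -> R) (k n : nat) (c : code X U V Xhat G k n).
Hypothesis hp : is_pmf p.
Hypothesis hd : forall x xhat, (0 <= d x xhat)%E.
Hypothesis hch : forall u, is_pmf (ch u).
Hypothesis hC : capacity ch \is a fin_num.
Hypothesis hS : secrecy_capacity ch \is a fin_num.
Hypothesis hG : regular_cumulative G.
Hypothesis k0 : (0 < k)%N.
Hypothesis n0 : (0 < n)%N.

Let m := cum_len G k n k.
Let C := fine (capacity ch).
Let CS := fine (secrecy_capacity ch).
Let C0 : 0 <= C. Proof. exact: capacity_ge0. Qed.
Let CS0 : 0 <= CS. Proof. exact: secrecy_capacity_ge0. Qed.
Let f := letter_input c.
Let a := @iid R X p (k * n).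
Let a0 w : 0 <= a w. Proof. exact: iid_ge0. Qed.
Let a1 : \sum_w a w = 1. Proof. exact: iid_sum. Qed.

Local Notation Gk i := (G (i%:R / k%:R)).

Lemma tail_capacity i : (i <= k)%N ->
  \sum_(l < k * n | (i * n <= l)%N) letter_rate p ch c l <=
  (n * k)%:R * (C * (Gk k - Gk i)).
Proof.
move=> ik; rewrite sum_letter_rate//.
set s := enum 'I_m; rewrite -[s](cat_take_drop (cum_len G k n i)).
have := @cond_entropy_capacity _ _ _ _ _ _ ch hch hC f _ (pref (i * n)) a a0 a1
  (take (cum_len G k n i) s) (drop (cum_len G k n i) s).
move=> H; have {}H := H (fun t ti w w' => source_input_eq c ik ti).
rewrite lerBlDl; apply: (le_trans H); rewrite lerD2l.
rewrite size_drop size_enum_ord (mulrC C) mulrA; apply: ler_wpM2r => //.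
exact: cum_len_sub_le.
Qed.

Lemma tail_secrecy i j (Lj : R) : (i <= j)%N -> (j <= k)%N ->
  (leakage_rate p ch c j <= Lj%:E)%E ->
  \sum_(l < k * n | (i * n <= l)%N) letter_rate p ch c l <=
  (n * k)%:R * (C * (Gk k - Gk j) + CS * (Gk j - Gk i) + Lj).
Proof.
move=> ij jk leak; have ik := leq_trans ij jk; rewrite sum_letter_rate//.
have nk0 : 0 < (n * k)%:R :> R by rewrite ltr0n muln_gt0 n0.
move: leak; rewrite leakage_info// lee_pdivrMl// => leak.
set s := enum 'I_m in leak *.
set mi := cum_len G k n i; set mj := cum_len G k n j in leak *.
have mij : (mi <= mj)%N by exact: cum_len_le.
(* [s1] is fixed by the first [i] source blocks, [s2] is where Z's are exchanged for V's, and [s3]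
   is charged the full capacity. *)
pose s1 := take mi s; pose s2 := take (mj - mi) (drop mi s); pose s3 := drop mj s.
have s12 : s1 ++ s2 = take mj s by rewrite /s1 /s2 -takeD subnKC.
have sE : s = s1 ++ s2 ++ s3 by rewrite catA s12 cat_take_drop.
rewrite -s12 in leak.
have := @cond_entropy_secrecy _ _ _ _ _ _ ch hch hC f _ (pref (i * n)) a a0 a1 hS
  _ (pref (j * n)) s1 s2 s3 _ _ _ leak.
move=> H; have {}H : cond_entropy (pref (i * n)) a <=
    cond_seq_entropy f (kV ch) (pref (i * n)) s a +
    (size s3)%:R * C + (size s2)%:R * CS + (n * k)%:R * Lj.
  rewrite sE; apply: H => t tl w w'.
    exact: source_input_eq.
  by rewrite s12 in tl; exact: source_input_eq.
have size3 : (size s3)%:R * C <= (n * k)%:R * (C * (Gk k - Gk j)).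
  rewrite size_drop size_enum_ord (mulrC C) mulrA; apply: ler_wpM2r => //.
  exact: cum_len_sub_le.
have size2 : (size s2)%:R * CS <= (n * k)%:R * (CS * (Gk j - Gk i)).
  rewrite (mulrC CS) mulrA; apply: ler_wpM2r => //.
  apply: le_trans (cum_len_sub_le n hG k0 ij jk).
  by rewrite ler_nat /s2 size_take_min geq_minl.
rewrite lerBlDl; apply: (le_trans H); rewrite !mulrDr.
by move: size3 size2; lra.
Qed.

Lemma expected_distortion_ge (M : R) :
  (forall r, 0 <= r -> (distortion_rate p d r <= M%:E)%E) ->
  (((n * k)%:R^-1 * \sum_l drate p d (letter_rate p ch c l))%:E <=
   expected_distortion p ch d c)%E.
Proof.
move=> hM; rewrite expected_distortionE// EFinM; apply: lee_wpmul2l.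
  by rewrite lee_fin invr_ge0.
rewrite -sumEFin; apply: lee_sum => l _.
rewrite (drateE hp hd hM) ?letter_rate_ge0//.
apply: distortion_rate_le => //; first exact: letter_couplingP.
exact: letter_rateP.
Qed.

End Converse.

(** * Concavity and hinges *)

Section Hinge.
Context {R : realType}.

Definition hinge (s x : R) : R := Num.max 0 (s - x).

Lemma hinge_ge0 s x : 0 <= hinge s x. Proof. by rewrite le_max lexx. Qed.

Lemma hinge_ge s x : s - x <= hinge s x. Proof. by rewrite le_max lexx orbT. Qed.

Lemma hinge_antitone s x y : x <= y -> hinge s y <= hinge s x.
Proof. by move=> xy; rewrite /hinge ge_max !le_max lexx/= lerB// orbT. Qed.

Lemma hinge_shift s t x : hinge s (x + t) = hinge (s - t) x.
Proof. by rewrite /hinge opprD addrA addrAC. Qed.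

Variable D : R -> R.
Hypothesis D0 : forall r : R, 0 <= D r.
Hypothesis Danti : forall r r' : R, 0 <= r -> r <= r' -> D r' <= D r.
Hypothesis Dmid : forall r r' : R, 0 <= r -> 0 <= r' -> 2 * D ((r + r') / 2) <= D r + D r'.

(* The interpolation of [D] at the multiples of [tau], flattened to the right
   of [T * tau]; [mu i] is the jump of its slope at [(i + 1) * tau]. *)
Lemma hinge_approx (tau eps : R) : 0 < tau -> 0 < eps ->
  exists (T : nat) (c : R) (mu : nat -> R),
  let H x := c + \sum_(i < T) mu i * hinge (i.+1%:R * tau) x in
  [/\ 0 <= c, forall i, (i < T)%N -> 0 <= mu i,
      forall r, 0 <= r -> H (r + tau) <= D r,
      forall r, 0 <= r -> D r <= H (r - tau) + eps
    & (\sum_(i < T) mu i) * tau <= D 0 - D tau].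
Proof.
move=> tau0 eps0.
pose A := [set D r | r in [set r | 0 <= r]].
have hA : has_inf A.
  split; first by exists (D 0), 0 => //=; exact: lexx.
  by exists 0 => _ [r _ <-].
(* [D] need not tend to 0: its infimum [c] is the constant part, reached within [eps] at
   [T * tau]. *)
pose c := inf A.
have cD r : 0 <= r -> c <= D r by move=> r0; apply: ge_inf; [exact: hA.2|exists r].
have c0 : 0 <= c by apply: lb_le_inf; [exact: hA.1|move=> _ [r _ <-]].
have [_ [r0 /= r00 <-] Dr0] := inf_adherent eps0 hA.
pose T := (Num.truncn (r0 / tau)).+1.
have DT : D (T%:R * tau) <= c + eps.
  apply: le_trans (ltW Dr0); apply: Danti => //.
  by rewrite -ler_pdivrMr// ltW// truncnS_gt.
(* Downward slopes of the interpolation, set to 0 from [T] on. Their decrements [mu i] are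
   nonnegative by midpoint convexity, and for [i = T - 1] by monotonicity. *)
pose dd i := if (i < T)%N then (D (i%:R * tau) - D (i.+1%:R * tau)) / tau else 0.
pose mu i := dd i - dd i.+1.
have tn0 i : 0 <= i%:R * tau by rewrite mulr_ge0// ltW.
have mu0 i : (i < T)%N -> 0 <= mu i.
  move=> iT; rewrite subr_ge0 /dd iT; case: ifP => _; last first.
    apply: divr_ge0; last exact: ltW.
    rewrite subr_ge0; apply: Danti => //.
    by rewrite ler_pM2r// ler_nat.
  rewrite ler_pM2r ?invr_gt0//.
  have := Dmid (tn0 i) (tn0 i.+2).
  have -> : (i%:R * tau + i.+2%:R * tau) / 2 = i.+1%:R * tau.
    by rewrite -[i.+2]addn2 -[i.+1]addn1 !natrD; field.
  by lra.
have ddT : dd T = 0 by rewrite /dd ltnn.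
have sum_mu s : (s <= T)%N -> \sum_(s <= i < T) mu i = dd s.
  move=> sT; have /eqP := telescope_sumr dd sT.
  rewrite ddT sub0r -eqr_oppLR => /eqP <-; rewrite -sumrN.
  by apply: eq_bigr => i _; rewrite opprB.
pose H x := c + \sum_(i < T) mu i * hinge (i.+1%:R * tau) x.
have Hanti x y : x <= y -> H y <= H x.
  move=> xy; rewrite lerD2l; apply: ler_sum => i _.
  by rewrite ler_wpM2l ?mu0// hinge_antitone.
have Hc s : (T <= s)%N -> H (s%:R * tau) = c.
  move=> Ts; rewrite /H big1 ?addr0// => i _.
  rewrite /hinge max_l ?mulr0// subr_le0 ler_pM2r// ler_nat.
  by rewrite (leq_trans (ltn_ord i)).
(* Descent from [T], where [H] is [c]: on each cell to the left [H] and [D] have the same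
   increment. *)
have HE u : (u <= T)%N ->
    H ((T - u)%:R * tau) = c + D ((T - u)%:R * tau) - D (T%:R * tau).
  elim: u => [|u IH] uT; first by rewrite subn0 Hc// addrK.
  have := IH (ltnW uT); rewrite -{1 2}(subnSK uT).
  set s := (T - u.+1)%N => Hs.
  have sT : (s < T)%N by rewrite /s ltn_subrL.
  suff : H (s%:R * tau) - H (s.+1%:R * tau) = D (s%:R * tau) - D (s.+1%:R * tau).
    by rewrite Hs; lra.
  rewrite /H opprD addrACA subrr add0r -sumrB.
  transitivity ((\sum_(i < T | (s <= i)%N) mu i) * tau).
    rewrite mulr_suml [RHS]big_mkcond; apply: eq_bigr => i _; rewrite -mulrBr.
    case: leqP => si.
      rewrite /hinge !max_r; last 2 first.
      - by rewrite subr_ge0 ler_pM2r// ler_nat.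
      - by rewrite subr_ge0 ler_pM2r// ler_nat leqW.
      by congr (_ * _); rewrite -[s.+1]addn1 natrD; ring.
    rewrite /hinge !max_l ?subrr ?mulr0//; rewrite subr_le0 ler_pM2r// ler_nat.
      exact: leqW.
    exact: si.
  rewrite (_ : \sum_(i < T | (s <= i)%N) mu i = \sum_(s <= i < T) mu i); last first.
    by rewrite big_geq_mkord.
  rewrite sum_mu ?(ltnW sT)//.
  by rewrite /dd sT divfK// gt_eqF.
have HleD s : H (s%:R * tau) <= D (s%:R * tau).
  have [Ts|/ltnW sT] := leqP T s; first by rewrite Hc// cD.
  have := HE (T - s)%N (leq_subr _ _); rewrite subKn// => ->.
  by have := cD _ (tn0 T); lra.
have DleH s : D (s%:R * tau) <= H (s%:R * tau) + eps.
  have [Ts|/ltnW sT] := leqP T s.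
    rewrite Hc//; apply: le_trans DT; apply: Danti => //.
    by rewrite ler_pM2r// ler_nat.
  have := HE (T - s)%N (leq_subr _ _); rewrite subKn// => ->.
  by move: DT; lra.
exists T, c, mu; split=> // [r r_ge0|r r_ge0|].
(* Rounding [r] to a multiple of [tau], up here and down in the next case, moves it by at most
   [tau]: this is the origin of both shifts. *)
- rewrite -/(H _); set s := (Num.truncn (r / tau)).+1.
  have rs : r <= s%:R * tau by rewrite -ler_pdivrMr// ltW// truncnS_gt.
  have sr : s%:R * tau <= r + tau.
    rewrite /s -natr1 mulrDl mul1r lerD2r -ler_pdivlMr//.
    by rewrite truncn_le divr_ge0// ltW.
  by rewrite (le_trans (Hanti _ _ sr))// (le_trans (HleD s))// Danti.
- rewrite -/(H _); set s := Num.truncn (r / tau).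
  have sr : s%:R * tau <= r by rewrite -ler_pdivlMr// truncn_le divr_ge0// ltW.
  have rs : r - tau <= s%:R * tau.
    rewrite lerBlDr -[X in _ + X]mul1r -mulrDl natr1 -ler_pdivrMr// ltW//.
    exact: truncnS_gt.
  rewrite (le_trans (Danti (tn0 s) sr))// (le_trans (DleH s))// lerD2r.
  exact: Hanti.
(* The jumps add up to the initial downward slope [dd 0]. *)
- rewrite -(big_mkord predT mu) sum_mu// /dd /=.
  by rewrite divfK ?gt_eqF// mul0r mul1r.
Qed.

End Hinge.

Section Concave.
Context {R : realType}.
Implicit Types (E : R -> R).

Lemma concave_le E x y t : concave_on01 E -> 0 <= x <= 1 -> 0 <= y <= 1 ->
  0 <= t <= 1 -> t * E x + (1 - t) * E y <= E (t * x + (1 - t) * y).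
Proof.
move=> h hx hy /andP[t0 t1].
have := h (Itv01 t0 t1) x y; rewrite !inE /= !in_itv /= => /(_ hx hy).
change (- E (t * x + (1 - t) * y) <= t * - E x + (1 - t) * - E y ->
  t * E x + (1 - t) * E y <= E (t * x + (1 - t) * y)).
by lra.
Qed.

Lemma concave_slope E x y z : concave_on01 E -> 0 <= x -> x < y -> y < z -> z <= 1 ->
  (E z - E y) * (y - x) <= (E y - E x) * (z - y).
Proof.
move=> h x0 xy yz z1; have zx : 0 < z - x by lra.
have t01 : 0 <= (z - y) / (z - x) <= 1.
  by rewrite divr_ge0 ?ler_pdivrMr//=; lra.
have H : (z - y) / (z - x) * E x + (1 - (z - y) / (z - x)) * E z <= E y.
  have hx : 0 <= x <= 1 by rewrite x0/=; lra.
  have hz : 0 <= z <= 1 by rewrite z1 andbT; lra.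
  have := concave_le h hx hz t01.
  suff -> : (z - y) / (z - x) * x + (1 - (z - y) / (z - x)) * z = y by [].
  by field; rewrite gt_eqF.
move: H; rewrite -(ler_pM2r zx).
have -> : ((z - y) / (z - x) * E x + (1 - (z - y) / (z - x)) * E z) * (z - x) =
   (z - y) * E x + (y - x) * E z by field; rewrite gt_eqF.
by lra.
Qed.

Lemma affine_concave (s q : R) : concave_on01 (fun a => s * a + q).
Proof.
move=> t x y _ _.
change (- (s * (t%:num * x + (1 - t%:num) * y) + q) <=
  t%:num * - (s * x + q) + (1 - t%:num) * - (s * y + q)).
by rewrite le_eqVlt; apply/orP; left; apply/eqP; ring.
Qed.

End Concave.

(** The positive terms of an increasing [g] form a final segment, empty when even the last term is
    nonpositive. *)
Lemma sum_pos_suffix (R : realType) (g : nat -> R) m K : (m <= K)%N ->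
  (forall i, (m <= i)%N -> (i.+1 < K)%N -> g i <= g i.+1) ->
  exists2 i0, (m <= i0 <= K)%N &
    \sum_(m <= i < K) Num.max 0 (g i) <= \sum_(i0 <= i < K) g i.
Proof.
elim: K => [|K IH].
  rewrite leqn0 => /eqP -> _; exists 0%N => //.
  by rewrite !big_geq.
rewrite leq_eqVlt => /predU1P[->|mK] gm.
  by exists K.+1; rewrite ?leqnn// !big_geq.
have [gK|gK] := leP (g K) 0.
  exists K.+1; first by rewrite ltnW//= leqnn.
  rewrite [leRHS]big_geq// le_eqVlt; apply/orP; left; apply/eqP.
  rewrite big_nat_cond big1// => i /andP[/andP[mi iK] _].
  rewrite max_l//; apply: le_trans gK.
  have : forall j, (i + j <= K)%N -> g i <= g (i + j)%N.
    elim=> [|j IHj]; first by rewrite addn0.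
    rewrite addnS => ij; apply: le_trans (IHj (ltnW ij)) _.
    by apply: gm; rewrite ?ltnS// (leq_trans mi)// leq_addr.
  by move=> /(_ (K - i)%N); rewrite subnKC// => ->.
have [|i0 /andP[mi iK] H] := IH mK.
  by move=> i mi iK; apply: gm => //; rewrite ltnS ltnW.
exists i0; first by rewrite mi ltnW.
by rewrite !big_nat_recr//= lerD// max_r// ltW.
Qed.

(** * Tail sums against slopes of the envelope *)

Section Envelope.
Context {R : realType}.
Variables (Gamma E : R -> R).
Hypothesis hE : concave_envelope Gamma E.
Hypothesis Gm : forall x y : R, 0 <= x -> x <= y -> y <= 1 -> Gamma x <= Gamma y.

Let Ec : concave_on01 E. Proof. by case: hE. Qed.

Lemma envelope_ge x : 0 <= x <= 1 -> Gamma x <= E x.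
Proof. by case: hE => _ H _ hx; apply: H; rewrite in_itv. Qed.

Lemma envelope_le_affine s q : (forall x, 0 <= x <= 1 -> Gamma x <= s * x + q) ->
  forall x, 0 <= x <= 1 -> E x <= s * x + q.
Proof.
case: hE => _ _ H h x hx; apply: (H (fun x => s * x + q)) => //.
exact: affine_concave.
Qed.

(** The constant [Gamma 1] is an affine majorant, so [E] is largest at 1; a concave function with
    its maximum at the right end is nondecreasing. *)
Lemma envelope_monotone x y : 0 <= x -> x <= y -> y <= 1 -> E x <= E y.
Proof.
move=> x0; rewrite le_eqVlt => /predU1P[->//|xy].
have le1 z : 0 <= z <= 1 -> E z <= E 1.
  move=> hz; apply: (@le_trans _ _ (Gamma 1)); last first.
    by apply: envelope_ge; rewrite ler01 lexx.
  have := @envelope_le_affine 0 (Gamma 1).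
  rewrite -[in leRHS](add0r (Gamma 1)) -[in leRHS](mul0r z) => H; apply: H => //.
  by move=> w /andP[w0 w1]; rewrite mul0r add0r Gm.
rewrite le_eqVlt => /predU1P[y1|y1].
  by rewrite y1; apply: le1; rewrite x0/= -y1 ltW.
have := concave_slope Ec x0 xy y1 (lexx 1).
have := le1 y; have : 0 <= y <= 1 by apply/andP; split; lra.
move=> hy /(_ hy) => H1 H2.
rewrite -subr_ge0 -(@pmulr_lge0 _ (1 - y)); last by lra.
by apply: le_trans H2; rewrite mulr_ge0//; lra.
Qed.

Lemma grid_step K i : (0 < K)%N -> (i.+1 < K)%N ->
  E (i.+2%:R / K%:R) - E (i.+1%:R / K%:R) <= E (i.+1%:R / K%:R) - E (i%:R / K%:R).
Proof.
move=> K0 iK; have K_gt0 : 0 < K%:R :> R by rewrite ltr0n.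
have := @concave_slope _ E (i%:R / K%:R) (i.+1%:R / K%:R) (i.+2%:R / K%:R) Ec.
rewrite !ltr_pM2r ?invr_gt0// !ltr_nat ler_pdivrMr// mul1r ler_nat.
rewrite divr_ge0// => /(_ isT (ltnSn _) (ltnSn _) iK).
have e j : j.+1%:R / K%:R - j%:R / K%:R = K%:R^-1 :> R.
  by rewrite -[j.+1]addn1 natrD mulrDl addrAC subrr add0r mul1r.
by rewrite !e ler_pM2r// invr_gt0.
Qed.

(** The thresholds differ by [2 * tau] because [hinge_approx] shifts its argument by [tau] in
    opposite directions for the two bounds on [D]. Cell 0 is left out, as each cell of the integral
    will be charged to the next one. *)
Lemma envelope_hinge (k n K : nat) (rho : 'I_(k * n) -> R) (s tau delta : R) :
  (0 < k)%N -> (0 < n)%N -> (0 < K)%N -> 0 <= s -> 0 <= tau ->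
  (forall i, (i <= k)%N -> \sum_(l < k * n | (i * n <= l)%N) rho l <=
     (n * k)%:R * (Gamma 1 - Gamma (i%:R / k%:R) + delta)) ->
  K%:R^-1 * \sum_(1 <= i < K)
     hinge s (K%:R * (E (i.+1%:R / K%:R) - E (i%:R / K%:R))) <=
  (n * k)%:R^-1 * \sum_l hinge (s - 2 * tau) (rho l) + 2 * tau + delta + s / k%:R.
Proof.
move=> k0 n0 K0 s0 tau0 tail.
have k_gt0 : 0 < k%:R :> R by rewrite ltr0n.
have K_gt0 : 0 < K%:R :> R by rewrite ltr0n.
have nk0 : 0 < (n * k)%:R :> R by rewrite ltr0n muln_gt0 n0.
set L := (n * k)%:R^-1 * _.
(* Chosen so that the line [s * x + Q] exceeds [Gamma 1] at [x = 1] by exactly the right-hand side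
   of the goal. *)
pose Q := L + 2 * tau + delta + s / k%:R + Gamma 1 - s.
have step1 i : (i <= k)%N -> Gamma (i%:R / k%:R) <= s * (i%:R / k%:R) + Q - s / k%:R.
  move=> ik; have H : (k%:R - i%:R) * n%:R * (s - 2 * tau) -
      \sum_(l < k * n | (i * n <= l)%N) rho l <= (n * k)%:R * L.
    rewrite /L mulrA divff ?gt_eqF// mul1r.
    apply: (@le_trans _ _ (\sum_(l < k * n | (i * n <= l)%N) hinge (s - 2 * tau) (rho l))).
      apply: (@le_trans _ _ (\sum_(l < k * n | (i * n <= l)%N) ((s - 2 * tau) - rho l))).
        rewrite sumrB lerD2r -(big_geq_mkord (i * n) (k * n) predT (fun=> s - 2 * tau)).
        by rewrite sumr_const_nat -mulnBl -[leRHS]mulr_natr natrM (natrB _ ik) mulrC.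
      by apply: ler_sum => l _; exact: hinge_ge.
    rewrite [leLHS]big_mkcond; apply: ler_sum => l _.
    by case: ifP => // _; exact: hinge_ge0.
  have := tail i ik; rewrite natrM in H nk0 *.
  set T := \sum_(l < _ | _) _ in H *; set g := Gamma (i%:R / k%:R).
  move=> HT.
  have HH : (k%:R - i%:R) * n%:R * (s - 2 * tau) <=
      n%:R * k%:R * (L + (Gamma 1 - g + delta)) by rewrite mulrDr; lra.
  have ik' : 0 <= (i%:R / k%:R : R) <= 1.
    by apply/andP; split; [exact: divr_ge0|rewrite ler_pdivrMr// mul1r ler_nat].
  have : (1 - i%:R / k%:R) * (s - 2 * tau) <= L + (Gamma 1 - g + delta).
    rewrite -(ler_pM2l nk0); apply: le_trans HH.
    rewrite le_eqVlt; apply/orP; left; apply/eqP.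
    by field; rewrite gt_eqF.
  rewrite /Q; move: (i%:R / k%:R) ik' => t /andP[t0 t1].
  have : 0 <= t * tau by rewrite mulr_ge0.
  by lra.
(* Off the grid [x] is rounded up: [Gamma] only grows, and the line rises by at most [s / k], which
   [step1] holds in reserve. *)
have step2 x : 0 <= x <= 1 -> Gamma x <= s * x + Q.
  move=> /andP[x0 x1].
  have [i ik /andP[xi ix]] : exists2 i, (i <= k)%N & x <= i%:R / k%:R <= x + k%:R^-1.
    have kx0 : 0 <= k%:R * x by rewrite mulr_ge0// ltW.
    have tle : (Num.truncn (k%:R * x))%:R <= k%:R * x by rewrite truncn_le.
    have tlt : k%:R * x < (Num.truncn (k%:R * x)).+1%:R by rewrite truncnS_gt.
    have [tk|kt] := ltnP (Num.truncn (k%:R * x)) k.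
      exists (Num.truncn (k%:R * x)).+1 => //.
      rewrite ler_pdivlMr// ler_pdivrMr// mulrDl mulVf ?gt_eqF//.
      by rewrite (mulrC x) (ltW tlt) -natr1 lerD2r.
    exists k => //; rewrite divff ?gt_eqF// x1/=.
    have : k%:R <= k%:R * x by apply: le_trans tle; rewrite ler_nat.
    rewrite -[X in X <= _]mulr1 ler_pM2l// => x1'.
    by apply: (le_trans x1'); rewrite lerDl invr_ge0 ltW.
  have i1 : i%:R / k%:R <= 1 :> R by rewrite ler_pdivrMr// mul1r ler_nat.
  apply: (le_trans (Gm x0 xi i1)); apply: (le_trans (step1 i ik)).
  have : s * (i%:R / k%:R) <= s * (x + k%:R^-1) by rewrite ler_wpM2l.
  by rewrite mulrDr; lra.
have step3 := envelope_le_affine step2.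
pose g i := s / K%:R - (E (i.+1%:R / K%:R) - E (i%:R / K%:R)).
have [||i0 /andP[i01 iK] Hsum] := @sum_pos_suffix _ g 1 K => //.
  by move=> i _ iK; rewrite lerD2l lerN2; exact: grid_step.
have -> : K%:R^-1 * \sum_(1 <= i < K)
     hinge s (K%:R * (E (i.+1%:R / K%:R) - E (i%:R / K%:R))) =
   \sum_(1 <= i < K) Num.max 0 (g i).
  rewrite mulr_sumr; apply: eq_bigr => i _.
  rewrite /hinge maxr_pMr ?invr_ge0 ?ltW// mulr0 mulrBr mulKf ?gt_eqF//.
  by rewrite (mulrC _ s).
apply: (le_trans Hsum).
(* What remains is the gap between line and envelope at 1 minus the gap at [i0 / K], and the latter
   is nonnegative by [step3]. *)
rewrite /g sumrB telescope_sumr// sumr_const_nat divff ?gt_eqF//.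
have i0K : 0 <= (i0%:R / K%:R : R) <= 1.
  by apply/andP; split; [exact: divr_ge0|rewrite ler_pdivrMr// mul1r ler_nat].
have := step3 _ i0K; have := envelope_ge (x := 1); rewrite ler01 lexx => /(_ isT).
have -> : (s / K%:R) *+ (K - i0) = s - s * (i0%:R / K%:R).
  by rewrite -mulr_natr natrB//; field; rewrite gt_eqF.
by rewrite /Q; lra.
Qed.

End Envelope.

(** * Integrating along a concave function *)

Section IntegralMajorant.
Context {R : realType}.
Local Notation mu := (@lebesgue_measure R).

(* The integral of a nonnegative function is a supremum over simple functions,
   so [f] need not be measurable. *)
Lemma integral_le_majorant (D N : set R) (f g : R -> \bar R) :
  (forall x, D x -> 0 <= f x)%E -> (forall x, 0 <= g x)%E ->
  measurable_fun setT g -> countable N ->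
  (forall x, D x -> ~ N x -> (f x <= g x)%E) ->
  (\int[mu]_(x in D) f x <= \int[mu]_x g x)%E.
Proof.
move=> f0 g0 mg Nc fg; rewrite ge0_integralE//.
apply: ge_ereal_sup => _ [h /= hf <-].
rewrite -integralT_nnsfun; apply: ae_ge0_le_integral => //.
- by move=> x _; rewrite lee_fin; exact: fun_ge0.
- exact/measurable_EFinP/measurable_funTS.
- exists N; split; first exact: countable_measurable.
    exact: countable_lebesgue_measure0.
  move=> x /= H; apply: contrapT => Nx; apply: H => _.
  apply: (le_trans (hf x)); rewrite patchE; case: ifPn => [/set_mem Dx|_]; last exact: g0.
  exact: fg.
Qed.

(** Open cells suffice: the grid points together with [N] are still countable, hence null. *)
Lemma integral_le_steps (N : set R) (f : R -> \bar R) (K : nat) (B : nat -> R) :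
  (0 < K)%N -> (forall x : R, 0 <= x <= 1 -> (0 <= f x)%E) ->
  (forall i, (i < K)%N -> 0 <= B i) -> countable N ->
  (forall i x, (i < K)%N -> i%:R / K%:R < x -> x < i.+1%:R / K%:R -> ~ N x ->
     (f x <= (B i)%:E)%E) ->
  (\int[mu]_(x in `[0%R, 1%R]%classic) f x <= (\sum_(i < K) B i * K%:R^-1)%:E)%E.
Proof.
move=> K0 f0 B0 Nc fB; have K_gt0 : 0 < K%:R :> R by rewrite ltr0n.
pose I (i : 'I_K) : set R := `]i%:R / K%:R, i.+1%:R / K%:R[%classic.
pose g x : \bar R := (\sum_(i < K) (B i)%:E * (\1_(I i) x)%:E)%E.
have term0 (i : 'I_K) x : (0 <= (B i)%:E * (\1_(I i) x)%:E)%E.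
  by rewrite -EFinM lee_fin mulr_ge0// B0.
have mI i : measurable (I i) by exact: measurable_itv.
have mind (i : 'I_K) : measurable_fun setT (fun x => (\1_(I i) x)%:E : \bar R).
  by apply/measurable_EFinP; exact: measurable_indic.
have mterm (i : 'I_K) : measurable_fun setT (fun x => (B i)%:E * (\1_(I i) x)%:E)%E.
  by apply: measurable_funeM; exact: mind.
have -> : ((\sum_(i < K) B i * K%:R^-1)%:E = \int[mu]_x g x)%E.
  rewrite /g ge0_integral_sum// -sumEFin; apply: eq_bigr => i _.
  rewrite ge0_integralZl_EFin; [|by []|by move=> x _; rewrite lee_fin|exact: mind|exact: B0].
  rewrite integral_indic; [|by []|exact: mI].
  rewrite setIT EFinM; congr (_ * _)%E.
  transitivity (lebesgue_measure (I i)); last by [].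
  rewrite /I lebesgue_measure_itv /= lte_fin ltr_pM2r ?invr_gt0// ltr_nat leqnn.
  rewrite -EFinB; congr _%:E.
  by rewrite -[i.+1]addn1 natrD mulrDl addrAC subrr add0r mul1r.
pose grid := range (fun i : nat => i%:R / K%:R : R).
pose N' := \bigcup_(b in [set: bool]) (if b then N else grid).
have Nc' : countable N'.
  apply: bigcup_countable => [|[] _ //]; first exact: countableP.
  exact: sub_countable (card_image_le _ _) (countableP _).
apply: (integral_le_majorant (N := N')) => //.
- by move=> x; apply: sume_ge0.
- exact: emeasurable_sum.
move=> x /=; rewrite in_itv/= => /andP[x0 x1] N'x.
have Nx : ~ N x by move=> Nx; apply: N'x; exists true.
have xgrid : ~ grid x by move=> Gx; apply: N'x; exists false.
have [i iK [xi ix]] : exists2 i, (i < K)%N & i%:R / K%:R < x /\ x < i.+1%:R / K%:R.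
  have Kx0 : 0 <= x * K%:R by rewrite mulr_ge0// ltW.
  have tle : (Num.truncn (x * K%:R))%:R <= x * K%:R by rewrite truncn_le.
  have tlt : x * K%:R < (Num.truncn (x * K%:R)).+1%:R by rewrite truncnS_gt.
  have neq j : x != j%:R / K%:R by apply/eqP => xj; apply: xgrid; exists j.
  have x1' : x < 1.
    by rewrite lt_neqAle x1 andbT; have := neq K; rewrite divff// gt_eqF.
  exists (Num.truncn (x * K%:R)).
    by rewrite -(ltr_nat R); apply: (le_lt_trans tle); rewrite gtr_pMl.
  split; last by rewrite ltr_pdivlMr.
  by rewrite lt_neqAle eq_sym neq/= ler_pdivrMr.
apply: (le_trans (fB i x iK xi ix Nx)).
rewrite /g (bigD1 (Ordinal iK))//=.
rewrite indicE mem_set/=; last by rewrite /I /= in_itv/= xi ix.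
by rewrite mule1 leeDl// sume_ge0.
Qed.

End IntegralMajorant.

Section ConcaveDerivative.
Context {R : realType}.
Variable E : R -> R.
Hypothesis Ec : concave_on01 E.

Let sl x y := (E y - E x) / (y - x).

Let slope_le x y z : 0 <= x -> x < y -> y < z -> z <= 1 -> sl y z <= sl x y.
Proof.
move=> x0 xy yz z1; have := concave_slope Ec x0 xy yz z1.
by rewrite /sl ler_pdivrMr ?subr_gt0// mulrAC ler_pdivlMr ?subr_gt0.
Qed.

Let slope_mid x y z : x < y -> y < z ->
  sl x z * (z - x) = sl x y * (y - x) + sl y z * (z - y).
Proof.
by move=> xy yz; rewrite /sl; field; rewrite !gt_eqF ?subr_gt0// (lt_trans xy).
Qed.

Let slope_le_l x y z : 0 <= x -> x < y -> y < z -> z <= 1 -> sl x z <= sl x y.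
Proof.
move=> x0 xy yz z1; have := slope_le x0 xy yz z1; have := slope_mid xy yz.
have : 0 < z - x by rewrite subr_gt0 (lt_trans xy).
move=> zx H1 H2; rewrite -(ler_pM2r zx) H1.
have : sl y z * (z - y) <= sl x y * (z - y) by rewrite ler_wpM2r// subr_ge0 ltW.
by lra.
Qed.

Let slope_le_r x y z : 0 <= x -> x < y -> y < z -> z <= 1 -> sl y z <= sl x z.
Proof.
move=> x0 xy yz z1; have := slope_le x0 xy yz z1; have := slope_mid xy yz.
have : 0 < z - x by rewrite subr_gt0 (lt_trans xy).
move=> zx H1 H2; rewrite -(ler_pM2r zx) H1.
have : sl y z * (y - x) <= sl x y * (y - x) by rewrite ler_wpM2r// subr_ge0 ltW.
by lra.
Qed.

(* Points where a gap separates the slopes to the right from those to the left. *)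
Definition kink (q : R) (x : R) : Prop :=
  (forall y, x < y <= 1 -> sl x y <= q) /\
  exists2 e, 0 < e & forall y, 0 <= y < x -> q + e <= sl y x.

Definition kinks : set R := [set x | 0 < x < 1 /\ exists q : rat, kink (ratr q) x].

(** For kinks [x < y], the slope from [x] to [y] is at most the rational of [x] and strictly above
    that of [y]; so distinct kinks get distinct rationals. *)
Lemma kinks_countable : countable kinks.
Proof.
apply/countable_injP.
pose q x : rat := if pselect (exists q : rat, kink (ratr q) x) is left H
  then projT1 (cid H) else 0.
exists (fun x => pickle (q x)).
suff H x y : kinks x -> kinks y -> x < y -> q x <> q y.
  move=> x y; rewrite !inE => kx ky /(pcan_inj (@pickleK _)) qxy.
  have [xy|yx|//] := ltgtP x y; first by case: (H _ _ kx ky xy).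
  by case: (H _ _ ky kx yx).
move=> [/andP[x0 x1] kx] [/andP[y0 y1] ky] xy.
rewrite /q; case: pselect => // kx'; case: pselect => // ky'.
case: cid => /= qx [Hx _]; case: cid => /= qy [_ [e e0 Hy]] qxy.
have := Hx y; rewrite xy ltW// => /(_ isT) h1.
have := Hy x; rewrite xy ltW// => /(_ isT) h2.
by move: h1 h2; rewrite qxy; lra.
Qed.

(** By concavity the slopes to the right of [x] increase to their supremum [L] as the other point
    approaches [x]; without a kink those to the left decrease to [L] as well, so [L] is the
    derivative. *)
Lemma derive1_ge_slope x y : 0 < x < 1 -> ~ kinks x -> x < y <= 1 ->
  sl x y <= derive1 E x.
Proof.
move=> /andP[x0 x1] nk xy1.
pose A := [set sl x y | y in [set y | x < y <= 1]].
have A_ub z : 0 <= z < x -> ubound A (sl z x).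
  move=> /andP[z0 zx] _ [w /andP[xw w1] <-]; exact: slope_le.
have hA : has_sup A.
  split; first by exists (sl x 1), 1 => //=; rewrite x1 lexx.
  by exists (sl 0 x); apply: A_ub; rewrite lexx.
pose L := sup A.
have slL w : x < w <= 1 -> sl x w <= L.
  by move=> hw; apply: sup_upper_bound => //; exists w.
suff dL : derive1 E x = L by rewrite dL slL.
rewrite /derive1; apply: cvg_lim => //.
apply/cvgrPdist_le => e e0.
have [_ [w /= /andP[xw w1] <-] Lw] := sup_adherent e0 hA.
(* Otherwise all slopes to the left exceed [L + e], and a rational between [L] and [L + e] shows
   that [x] is a kink. *)
have [z /andP[z0 zx] zL] : exists2 z, 0 <= z < x & sl z x <= L + e.
  apply: contrapT => Hno; apply: nk; split; first by rewrite x0.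
  have [q] := @rat_in_itvoo R L (L + e) ltac:(by rewrite ltrDl).
  rewrite in_itv/= => /andP[Lq qL]; exists q; split.
    by move=> t ht; rewrite (le_trans (slL t ht))// ltW.
  exists (L + e - ratr q); first by rewrite subr_gt0.
  move=> t ht; rewrite addrC subrK leNgt; apply/negP => tL; apply: Hno.
  by exists t => //; rewrite ltW.
near=> h.
have h0 : h != 0 by near: h; exact: nbhs_dnbhs_neq.
have hlt : `|h| < Num.min (w - x) (x - z).
  near: h; apply: dnbhs0_lt; rewrite lt_min !subr_gt0 xw//.
move: hlt; rewrite lt_min => /andP[h1 h2].
have -> : h^-1 *: (E (h + x) - E x) = (E (h + x) - E x) / h by rewrite mulrC.
have [hneg|hpos|hz] := ltgtP h 0; last by rewrite hz eqxx in h0.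
- rewrite ltr0_norm// in h1 h2.
  have -> : (E (h + x) - E x) / h = sl (h + x) x.
    by rewrite /sl opprD addrCA subrr addr0 invrN mulrN -mulNr opprB.
  have hx : z < h + x by lra.
  have H1 : sl (h + x) x <= sl z x by apply: slope_le_r => //; lra.
  have H2 : L <= sl (h + x) x.
    by apply: ge_sup; [exact: hA.1|apply: A_ub; lra].
  by rewrite ler_norml; lra.
- rewrite gtr0_norm// in h1 h2.
  have -> : (E (h + x) - E x) / h = sl x (h + x).
    by rewrite /sl; congr (_ / _); lra.
  have H1 : sl x w <= sl x (h + x) by apply: slope_le_l => //; lra.
  have H2 : sl x (h + x) <= L by apply: slL; lra.
  rewrite -/L in Lw.
  by rewrite ler_norml; lra.
Unshelve. all: by end_near.
Qed.

(** For a nonincreasing [D], this bounds [D] of the derivative on one cell by [D] of the mean slope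
    on the next. *)
Lemma derive1_ge_step x y z : 0 < x < 1 -> ~ kinks x -> x < y -> y < z -> z <= 1 ->
  (E z - E y) / (z - y) <= derive1 E x.
Proof.
move=> x01 nk xy yz z1; have /andP[x0 x1] := x01.
apply: (le_trans (slope_le (ltW x0) xy yz z1)); apply: derive1_ge_slope => //.
by rewrite xy (le_trans (ltW yz)).
Qed.

Lemma derive1_ge0 x : {in `[0, 1] &, {homo E : a b / a <= b}} ->
  0 < x < 1 -> ~ kinks x -> 0 <= derive1 E x.
Proof.
move=> Em x01 nk; have /andP[x0 x1] := x01.
apply: (@le_trans _ _ (sl x 1)); last by apply: derive1_ge_slope; rewrite // x1 lexx.
rewrite divr_ge0 ?subr_ge0 ?(ltW x1)//.
by apply: Em; rewrite ?in_itv/= ?lexx ?ler01 ?(ltW x0) ?(ltW x1).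
Qed.

End ConcaveDerivative.

(** * The converse *)

Section Transfer.
Context {R : realType}.
Variables (Gamma E D : R -> R).
Hypothesis hE : concave_envelope Gamma E.
Hypothesis Gm : forall x y : R, 0 <= x -> x <= y -> y <= 1 -> Gamma x <= Gamma y.

(** Both averages of [D] are compared with averages of hinge sums, and [envelope_hinge] is applied
    to each hinge; the last sum collects its errors, weighted by [mu]. *)
Lemma envelope_transfer (k n K T : nat) (rho : 'I_(k * n) -> R)
    (tau eps delta c : R) (mu : nat -> R) :
  (0 < k)%N -> (0 < n)%N -> (0 < K)%N -> 0 <= tau -> 0 <= c + eps ->
  (forall i, (i < T)%N -> 0 <= mu i) -> (forall l, 0 <= rho l) ->
  let H x := c + \sum_(i < T) mu i * hinge (i.+1%:R * tau) x in
  (forall r, 0 <= r -> H (r + tau) <= D r) ->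
  (forall r, 0 <= r -> D r <= H (r - tau) + eps) ->
  (forall i, (i <= k)%N -> \sum_(l < k * n | (i * n <= l)%N) rho l <=
     (n * k)%:R * (Gamma 1 - Gamma (i%:R / k%:R) + delta)) ->
  K%:R^-1 * \sum_(1 <= j < K) D (K%:R * (E (j.+1%:R / K%:R) - E (j%:R / K%:R))) <=
  (n * k)%:R^-1 * \sum_l D (rho l) + eps +
  \sum_(i < T) mu i * (2 * tau + delta + (i.+1%:R * tau + tau) / k%:R).
Proof.
move=> k0 n0 K0 tau0 ce0 mu0 rho0 H HD DH tail.
have K_gt0 : 0 < K%:R :> R by rewrite ltr0n.
have nk0 : 0 < (n * k)%:R :> R by rewrite ltr0n muln_gt0 n0.
pose e j := K%:R * (E (j.+1%:R / K%:R) - E (j%:R / K%:R)).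
have e0 j : (j < K)%N -> 0 <= e j.
  move=> jK; rewrite mulr_ge0 ?(ltW K_gt0)// subr_ge0.
  apply: (envelope_monotone hE Gm).
  - by rewrite divr_ge0// ltW.
  - by rewrite ler_pM2r ?invr_gt0// ler_nat.
  - by rewrite ler_pdivrMr// mul1r ler_nat.
have upper : K%:R^-1 * \sum_(1 <= j < K) D (e j) <=
    c + eps + \sum_(i < T) mu i *
      (K%:R^-1 * \sum_(1 <= j < K) hinge (i.+1%:R * tau + tau) (e j)).
  apply: (@le_trans _ _ (K%:R^-1 * \sum_(1 <= j < K) (c + eps +
      \sum_(i < T) mu i * hinge (i.+1%:R * tau + tau) (e j)))).
    rewrite ler_wpM2l ?invr_ge0 ?(ltW K_gt0)//.
    rewrite !big_nat; apply: ler_sum => j /andP[_ jK].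
    apply: (le_trans (DH _ (e0 _ jK))).
    rewrite /H addrAC lerD2l le_eqVlt; apply/orP; left; apply/eqP.
    by apply: eq_bigr => i _; rewrite hinge_shift opprK.
  rewrite big_split/= mulrDr lerD//.
    (* Only [K - 1] of the [K] cells are summed, so the constant enters with a factor at most 1, and
       [c + eps] has to be nonnegative. *)
    rewrite sumr_const_nat -[X in _ * X]mulr_natl mulrA ler_piMl//.
    by rewrite ler_pdivrMl// mulr1 ler_nat leq_subr.
  rewrite exchange_big/= mulr_sumr; apply: ler_sum => i _.
  by rewrite -mulr_sumr mulrCA.
have lower : c + \sum_(i < T) mu i *
      ((n * k)%:R^-1 * \sum_l hinge (i.+1%:R * tau - tau) (rho l)) <=
    (n * k)%:R^-1 * \sum_l D (rho l).
  apply: (@le_trans _ _ ((n * k)%:R^-1 * \sum_l H (rho l + tau))); last first.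
    rewrite ler_wpM2l ?invr_ge0 ?(ltW nk0)//.
    by apply: ler_sum => l _; exact: HD.
  rewrite /H big_split/= mulrDr lerD//.
    rewrite sumr_const card_ord -[X in _ * X]mulr_natl (mulnC k) mulrA.
    by rewrite mulVf ?mul1r// gt_eqF.
  rewrite exchange_big/= mulr_sumr; apply: ler_sum => i _.
  rewrite -mulr_sumr mulrCA; apply: ler_wpM2l; first by rewrite invr_ge0 ltW.
  apply: ler_wpM2l; first exact: mu0.
  by apply: ler_sum => l _; rewrite hinge_shift.
have mid : \sum_(i < T) mu i *
      (K%:R^-1 * \sum_(1 <= j < K) hinge (i.+1%:R * tau + tau) (e j)) <=
    \sum_(i < T) mu i *
      ((n * k)%:R^-1 * \sum_l hinge (i.+1%:R * tau - tau) (rho l)) +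
    \sum_(i < T) mu i * (2 * tau + delta + (i.+1%:R * tau + tau) / k%:R).
  rewrite -big_split/=; apply: ler_sum => i _; rewrite -mulrDr ler_wpM2l ?mu0//.
  have s0 : 0 <= i.+1%:R * tau + tau by rewrite addr_ge0// mulr_ge0.
  have := envelope_hinge hE Gm k0 n0 K0 s0 tau0 tail.
  have -> : i.+1%:R * tau + tau - 2 * tau = i.+1%:R * tau - tau by ring.
  by rewrite !addrA.
by move: upper lower mid; lra.
Qed.

End Transfer.

Section Final.
Context {R : realType}.

Lemma limn_esup_ge (u : nat -> \bar R) (x : \bar R) :
  (forall n, x <= u n)%E -> (x <= limn_esup u)%E.
Proof.
move=> xu; apply: le_ereal_inf_tmp => _ [V [N _ NV] <-].
apply: (le_trans (xu N)); apply: ereal_sup_ubound; exists N => //.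
by apply: NV => /=.
Qed.

(** By right-continuity the value stays above [s] just to the right of [b], where any fine enough
    grid has a point; [b = 1] is itself a grid point. *)
Lemma right_grid (F : R -> R) (s : R) :
  (forall a : R, 0 <= a < 1 -> F x @[x --> a^'+] --> F a) ->
  (exists2 b, 0 <= b <= 1 & s < F b) ->
  exists k0, forall k, (k0 <= k)%N -> (0 < k)%N ->
    exists2 j, (j <= k)%N & s < F (j%:R / k%:R).
Proof.
move=> Fr [b /andP[b0 b1] sb].
move: b1; rewrite le_eqVlt => /predU1P[b1|b1].
  exists 0%N => k _ k0; exists k => //.
  by rewrite divff; [rewrite -b1|rewrite pnatr_eq0 -lt0n].
have hb : 0 <= b < 1 by rewrite b0.
have /cvgr_gt /(_ s sb) [e /= e0 He] := Fr b hb.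
pose e' := Num.min e (1 - b).
have e'0 : 0 < e' by rewrite lt_min e0 subr_gt0.
exists (Num.truncn e'^-1).+1 => k kk k0.
have k_gt0 : 0 < k%:R :> R by rewrite ltr0n.
have ke : k%:R^-1 < e'.
  rewrite -[ltRHS]invrK ltf_pV2 ?posrE ?invr_gt0//.
  by apply: (lt_le_trans (truncnS_gt _)); rewrite ler_nat.
move: ke; rewrite lt_min => /andP[ke k1].
have kb0 : 0 <= b * k%:R by rewrite mulr_ge0// ltW.
set t := Num.truncn (b * k%:R).
have tle : t%:R <= b * k%:R by rewrite truncn_le.
have tlt : b * k%:R < t.+1%:R by rewrite truncnS_gt.
have h1 : b < t.+1%:R / k%:R by rewrite ltr_pdivlMr.
have h2 : t.+1%:R / k%:R <= b + k%:R^-1.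
  by rewrite ler_pdivrMr// mulrDl mulVf ?gt_eqF// -natr1 lerD2r.
exists t.+1.
  rewrite -(ler_nat R) -[leRHS]mul1r -ler_pdivrMr//.
  by apply: (le_trans h2); lra.
apply: He => //=.
by rewrite ltr0_norm ?subr_lt0//; lra.
Qed.

End Final.

Section Geff.
Context {R : realType}.
Variables (C CS : R) (G L : R -> R).
Hypothesis CS0 : 0 <= CS.
Hypothesis CSC : CS <= C.
Hypothesis hG : regular_cumulative G.
Hypothesis hL : regular_cumulative L.

Let V := [set (C - CS) * G b - L b | b in `[0, 1]].
Let S := sup V.

Let L0 x : 0 <= x <= 1 -> 0 <= L x.
Proof. by case: hL => H _ _ _ hx; apply: H; rewrite in_itv. Qed.

Let Gmono x y : 0 <= x -> x <= y -> y <= 1 -> G x <= G y.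
Proof.
case: hG => _ H _ _ x0 xy y1; apply: H => //; rewrite in_itv/=.
  by rewrite x0 (le_trans xy).
by rewrite y1 andbT (le_trans x0).
Qed.

Let hV : has_sup V.
Proof.
split.
  exists ((C - CS) * G 0 - L 0), 0 => //=.
  by rewrite in_itv/= lexx ler01.
exists ((C - CS) * G 1) => _ [b hb <-].
move: hb; rewrite /= in_itv/= => /andP[b0 b1].
rewrite lerBlDr ler_wpDr ?L0 ?b0// ler_wpM2l ?subr_ge0//.
exact: Gmono.
Qed.

Lemma Geff_out_monotone x y : 0 <= x -> x <= y -> y <= 1 ->
  Geff_out C CS G L x <= Geff_out C CS G L y.
Proof.
move=> x0 xy y1; have Gxy := Gmono x0 xy y1.
have C0 : 0 <= C := le_trans CS0 CSC.
rewrite /Geff_out ge_max !le_max ler_wpM2l//= lerB// ?orbT//.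
by rewrite ler_wpM2l.
Qed.

(** Each of the two bounds on [t] controls one branch of the maximum at [x], the first one
    [C * G x - S] and the second one [CS * G x]; at 1 the branch with [C] is a lower bound. *)
Lemma Geff_out_tail x (t delta : R) : 0 <= x <= 1 ->
  t <= C * (G 1 - G x) + delta ->
  t <= C * G 1 - CS * G x - S + delta ->
  t <= Geff_out C CS G L 1 - Geff_out C CS G L x + delta.
Proof.
move=> hx t1 t2.
have H1 : C * G 1 - S <= Geff_out C CS G L 1 by rewrite /Geff_out le_max lexx orbT.
have H2 : Geff_out C CS G L x <= C * G 1 - S + delta - t.
  rewrite /Geff_out ge_max -/V -/S.
  by apply/andP; split; move: t1 t2; rewrite ?mulrBr; lra.
by lra.
Qed.

Lemma near_sup_grid (delta : R) : 0 < delta ->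
  exists k0, forall k, (k0 <= k)%N -> (0 < k)%N ->
    exists2 j, (j <= k)%N &
      S - delta <= (C - CS) * G (j%:R / k%:R) - L (j%:R / k%:R).
Proof.
move=> d0; have [k0 Hk] : exists k0, forall k, (k0 <= k)%N -> (0 < k)%N ->
    exists2 j, (j <= k)%N &
      S - delta < (C - CS) * G (j%:R / k%:R) - L (j%:R / k%:R).
  apply: (@right_grid _ (fun b => (C - CS) * G b - L b)) => [b hb|]; last first.
    have [_ [b /= hb <-] Hb] := sup_adherent d0 hV.
    by exists b; rewrite // in_itv in hb.
  have bi : b \in `[0, 1[ by rewrite in_itv.
  case: hG => _ _ _ /(_ b bi) cG; case: hL => _ _ _ /(_ b bi) cL.
  exact: (cvgB (cvgM (cvg_cst _) cG) cL).
by exists k0 => k kk kpos; have [j jk /ltW Hj] := Hk k kk kpos; exists j.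
Qed.

End Geff.

Theorem theorem1 (R : realType) (X : finType) (U V Z : countType)
    (Xhat : choiceType) (p : X -> R) (d : X -> Xhat -> \bar R)
    (ch : U -> V * Z -> R) (G L Ghat : R -> R) (dbar : R)
    (hp : is_pmf p)
    (hd : forall x xhat, (0 <= d x xhat)%E)
    (hD : exists M : R, forall r : R, 0 <= r ->
            (distortion_rate p d r <= M%:E)%E)
    (hch : forall u, is_pmf (ch u))
    (hC : capacity ch \is a fin_num)
    (hCWT : secrecy_capacity ch \is a fin_num)
    (hG : regular_cumulative G)
    (hL : regular_cumulative L)
    (hach : achievable p d ch G L dbar)
    (hGhat : concave_envelope
       (Geff_out (fine (capacity ch)) (fine (secrecy_capacity ch)) G L) Ghat) :
  (\int[@lebesgue_measure R]_(a in `[0%R, 1%R]%classic)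
     distortion_rate p d (derive1 Ghat a) <= dbar%:E)%E.
Proof.
case: hD => M hM.
set C := fine (capacity ch) in hGhat *; set CS := fine (secrecy_capacity ch) in hGhat *.
have CS0 : 0 <= CS by exact: secrecy_capacity_ge0.
have CSC : CS <= C by rewrite /CS /C fine_le// secrecy_capacity_le.
have Gm := Geff_out_monotone L CS0 CSC hG.
set Gamma := Geff_out C CS G L in hGhat Gm.
have Ec : concave_on01 Ghat by case: hGhat.
have D0 := drate_ge0 hp hd.
have Danti := drate_antitone hp hd hM.
have Dmid := drate_midpoint hp hd hM.
have M0 : 0 <= M := le_trans (D0 0) (drate_le hp hd hM (lexx 0)).
apply/lee_addgt0Pr => h h0.
(* One [eps] each for the hinge approximation, [m * delta], [A / k] and [M / K], and two for
   [2 * m * tau]. *)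
pose eps := h / 6.
have eps0 : 0 < eps by rewrite divr_gt0.
have [tau tau0 Dtau] := drate_cont0 hp hd hM eps0.
have [T [c [mu [c0 mu0 HD DH mutau]]]] := hinge_approx D0 Danti Dmid tau0 eps0.
pose m := \sum_(i < T) mu i.
have m0 : 0 <= m by apply: sumr_ge0 => i _; exact: mu0.
pose A := \sum_(i < T) mu i * (i.+1%:R * tau + tau).
have A0 : 0 <= A.
  by apply: sumr_ge0 => i _; rewrite mulr_ge0 ?mu0// addr_ge0 ?mulr_ge0 ?(ltW tau0).
pose delta := eps / (m + 1).
have m1 : 0 < m + 1 by rewrite ltr_wpDl.
have delta0 : 0 < delta by rewrite divr_gt0.
have mdelta : m * delta <= eps.
  by rewrite /delta mulrCA ler_piMr ?(ltW eps0)// ler_pdivrMr// mul1r lerDl.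
pose K := (Num.truncn (M / eps)).+1.
have K_gt0 : 0 < K%:R :> R by rewrite ltr0n.
have MK : M * K%:R^-1 <= eps.
  by rewrite ler_pdivrMr// mulrC -ler_pdivrMr// ltW// truncnS_gt.
have [k0 Hk] := near_sup_grid CSC hG hL delta0.
pose k := (maxn k0 (Num.truncn (A / eps)).+1).
have k_pos : (0 < k)%N by rewrite leq_max orbT.
have k_gt0 : 0 < k%:R :> R by rewrite ltr0n.
have Ak : A / k%:R <= eps.
  rewrite ler_pdivrMr// mulrC -ler_pdivrMr// ltW//.
  by apply: (lt_le_trans (truncnS_gt _)); rewrite ler_nat leq_maxr.
have [j jk Hj] := Hk k (leq_maxl _ _) k_pos.
have [code [limd leak]] := hach k k_pos.
have Gk1 : G (k%:R / k%:R) = G 1 by rewrite divff// gt_eqF.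
have G00 : G 0 = 0 by case: hG.
have L00 : L 0 = 0 by case: hL.
have step (n : nat) :
    K%:R^-1 * \sum_(1 <= i < K) drate p d (K%:R * (Ghat (i.+1%:R / K%:R) - Ghat (i%:R / K%:R)))
    <= (n.+1 * k)%:R^-1 * \sum_l drate p d (letter_rate p ch (code n) l) + 5 * eps.
  have tail i : (i <= k)%N ->
      \sum_(l < k * n.+1 | (i * n.+1 <= l)%N) letter_rate p ch (code n) l <=
      (n.+1 * k)%:R * (Gamma 1 - Gamma (i%:R / k%:R) + delta).
    move=> ik; have nk0 : 0 < (n.+1 * k)%:R :> R by rewrite ltr0n muln_gt0 k_pos.
    rewrite -ler_pdivrMl//.
    have hi : 0 <= (i%:R / k%:R : R) <= 1.
      by have := @grid01 R k k_pos i ik; rewrite in_itv.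
    have H1 : (n.+1 * k)%:R^-1 *
        \sum_(l < k * n.+1 | (i * n.+1 <= l)%N) letter_rate p ch (code n) l <=
        C * (G 1 - G (i%:R / k%:R)).
      rewrite ler_pdivrMl// -Gk1.
      exact: tail_capacity.
    apply: Geff_out_tail => //; first by rewrite (le_trans H1)// lerDl ltW.
    (* For [j < i] the capacity bound is enough: [(C - CS) * G] is nondecreasing and [L]
       nonnegative, so the supremum is at most [(C - CS) * G] at [i / k], plus [delta]. *)
    have [ij|ji] := leqP i j; last first.
      apply: (le_trans H1).
      have : (C - CS) * G (j%:R / k%:R) <= (C - CS) * G (i%:R / k%:R).
        by rewrite ler_wpM2l ?subr_ge0// cumulative_le// ltnW.
      have : 0 <= L (j%:R / k%:R).
        by case: hL => L0 _ _ _; apply: L0; exact: grid01.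
      by move: Hj; rewrite !mulrBr !mulrBl; lra.
    (* Leakage is constrained from block 1 on only. For [j = 0] the supremum is at most [delta], as
       [G] and [L] vanish at 0, and the capacity bound is again enough. *)
    have [j0|j0] := posnP j.
      apply: (le_trans H1).
      move: ij Hj; rewrite j0 leqn0 => /eqP ->.
      by rewrite mul0r G00 L00 !(mulr0, subr0); lra.
    have H2 : (n.+1 * k)%:R^-1 *
        \sum_(l < k * n.+1 | (i * n.+1 <= l)%N) letter_rate p ch (code n) l <=
        C * (G 1 - G (j%:R / k%:R)) + CS * (G (j%:R / k%:R) - G (i%:R / k%:R)) +
        L (j%:R / k%:R).
      rewrite ler_pdivrMl// -Gk1.
      apply: tail_secrecy => //; apply: leak.
      by rewrite j0.
    apply: (le_trans H2).
    by move: Hj; rewrite !mulrBr !mulrBl; lra.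
  have rho0 l := letter_rate_ge0 (code n) hp hch l.
  have ce0 : 0 <= c + eps by rewrite addr_ge0// ltW.
  have := envelope_transfer hGhat Gm k_pos (ltn0Sn n) (ltn0Sn _ : (0 < K)%N)
    (ltW tau0) ce0 mu0 rho0 HD DH tail.
  have -> : \sum_(i < T) mu i * (2 * tau + delta + (i.+1%:R * tau + tau) / k%:R) =
      m * tau * 2 + m * delta + A / k%:R.
    rewrite /m /A !mulr_suml -!big_split/=; apply: eq_bigr => i _.
    by ring.
  have mtau : m * tau <= eps by apply: (le_trans mutau); rewrite lerBlDl.
  move=> /le_trans; apply; rewrite -addrA lerD2l.
  have arith (a b b' b'' : R) : b <= a -> b' <= a -> b'' <= a ->
      a + (b * 2 + b' + b'') <= 5 * a by lra.
  exact: arith.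
(* Cell [i] is charged with the mean slope of cell [i + 1]; the last cell has no successor and gets
   [M]. *)
pose B i := if (i.+1 < K)%N then
  drate p d (K%:R * (Ghat (i.+2%:R / K%:R) - Ghat (i.+1%:R / K%:R))) else M.
have intB : (\int[@lebesgue_measure R]_(a in `[0%R, 1%R]%classic)
     distortion_rate p d (derive1 Ghat a) <= (\sum_(i < K) B i * K%:R^-1)%:E)%E.
  apply: (integral_le_steps (N := kinks Ghat)) => //.
  - by move=> x _; exact: distortion_rate_ge0.
  - by move=> i iK; rewrite /B; case: ifP.
  - exact: kinks_countable.
  move=> i x iK ix xi nx.
  have x01 : 0 < x < 1.
    rewrite (le_lt_trans _ ix) ?divr_ge0//= (lt_le_trans xi)//.
    by rewrite ler_pdivrMr// mul1r ler_nat.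
  rewrite /B; case: ifPn => i1K; last first.
    apply: hM; apply: derive1_ge0 => // a b; rewrite !in_itv/=.
    by move=> /andP[a0 _] /andP[_ b1] ab; apply: (envelope_monotone hGhat Gm).
  have g1 : i.+1%:R / K%:R < (i.+2%:R / K%:R : R).
    by rewrite ltr_pM2r ?invr_gt0// ltr_nat.
  have g2 : (i.+2%:R / K%:R : R) <= 1 by rewrite ler_pdivrMr// mul1r ler_nat.
  have := derive1_ge_step Ec x01 nx xi g1 g2.
  have -> : i.+2%:R / K%:R - i.+1%:R / K%:R = K%:R^-1 :> R.
    by rewrite -[i.+2]addn1 natrD mulrDl addrAC subrr add0r mul1r.
  rewrite invrK mulrC => Hs.
  have Hge0 : 0 <= K%:R * (Ghat (i.+2%:R / K%:R) - Ghat (i.+1%:R / K%:R)).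
    rewrite mulr_ge0 ?(ltW K_gt0)// subr_ge0.
    by apply: (envelope_monotone hGhat Gm); rewrite ?divr_ge0 ?(ltW g1).
  rewrite (drateE hp hd hM Hge0).
  exact: distortion_rate_antitone.
have sumB : \sum_(i < K) B i * K%:R^-1 =
    K%:R^-1 * \sum_(1 <= i < K) drate p d (K%:R * (Ghat (i.+1%:R / K%:R) - Ghat (i%:R / K%:R)))
    + M * K%:R^-1.
  rewrite -mulr_suml mulrC /K big_ord_recr/= mulrDr [X in _ + X]mulrC.
  rewrite /B ltnn; congr (_ * _ + _).
  rewrite big_add1 /= big_mkord; apply: eq_bigr => i _.
  by rewrite ltnS ltn_ord.
apply: (le_trans intB).
have : ((\sum_(i < K) B i * K%:R^-1 - h)%:E <= dbar%:E)%E.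
  apply: le_trans limd; apply: limn_esup_ge => n.
  have := expected_distortion_ge (code n) hp hd hch hM.
  apply: le_trans.
  rewrite lee_fin sumB lerBlDr; have := lerD (step n) MK.
  move=> /le_trans; apply; rewrite -addrA lerD2l /eps.
  by rewrite -mulr_natl; lra.
by rewrite EFinB leeBlDr.
Qed.
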